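(* Let $\mathcal{K}$ be a compact set of potential matrices in $L^1([0,1];\mathbb{C}^{2\times2})$ and $Q\in\mathcal{K}$. Let the boundary conditions be regular, let $\Delta_Q$ be the corresponding characteristic determinant, and let $\Lambda_Q=\{\lambda_{Q,n}\}_{n\in\mathbb{Z}}$ be the canonically ordered sequence of its zeros. Let also $\Lambda_0=\{\lambda_n^0\}_{n\in\mathbb{Z}}$ be the sequence of zeros of $\Delta_0$. Then the following estimates hold: (i) There exists a constant $M=M(\mathcal{K},B,A)>0$ that does not depend on $Q$ and such that $$\sup_{n\in\mathbb{Z}}|\lambda_{Q,n}-\lambda_n^0|\le M,\qquad Q\in\mathcal{K}.$$ In particular, there exist constants $h=h(\mathcal{K},B,A)>0$ and $d=d(\mathcal{K},B,A)$ that do not depend on $Q$ and such that $\Lambda_Q$ is an incompressible sequence of density $d$ lying in the strip $\Pi_h$. (ii) For any $\varepsilon>0$ there exists a constant $N_\varepsilon=N_\varepsilon(\mathcal{K},B,A)\in\mathbb{N}$ such that $$\sup_{|n|>N_\varepsilon}|\lambda_{Q,n}-\lambda_n^0|\le\varepsilon,\qquad Q\in\mathcal{K}.$$ If in addition the boundary conditions are strictly regular, then there exists $\varepsilon_0=\varepsilon_0(B,A)$ such that for any $\varepsilon\in(0,\varepsilon_0]$ the discs $\mathbb{D}_{2\varepsilon}(\lambda_{Q,n})$, $|n|>N_\varepsilon$, are disjoint, and there exists a constant $\widetilde C_\varepsilon=\widetilde C_\varepsilon(B,A)>0$ such that $$\min_{|\lambda-\lambda_{Q,n}|=2\varepsilon}|\Delta_Q(\lambda)|\ge\widetilde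 C_\varepsilon,\qquad|n|>N_\varepsilon,\quad Q\in\mathcal{K}.$$
   Context: Fix real numbers $b_1<0<b_2$, $B=\operatorname{diag}(b_1,b_2)$. A potential matrix is $Q=\begin{pmatrix}0&Q_{12}\\Q_{21}&0\end{pmatrix}$ with entries in $L^1[0,1]$. Fix linearly independent boundary conditions $U_j(y)=a_{j1}y_1(0)+a_{j2}y_2(0)+a_{j3}y_1(1)+a_{j4}y_2(1)=0$, $j\in\{1,2\}$, with $A=(a_{jk})\in\mathbb{C}^{2\times4}$; $J_{jk}$ is the determinant of the matrix formed by columns $j,k$ of $A$. Let $\Phi_Q(\cdot,\lambda)=(\Phi_1\ \Phi_2)$ be the fundamental matrix of $-iB^{-1}y'+Qy=\lambda y$ on $[0,1]$ with $\Phi_Q(0,\lambda)=I_2$. The characteristic determinant is $\Delta_Q(\lambda)=\det(U_j(\Phi_k(\cdot,\lambda)))_{j,k=1}^2$; for $Q=0$, $\Delta_0(\lambda)=J_{12}+J_{34}e^{i(b_1+b_2)\lambda}+J_{32}e^{ib_1\lambda}+J_{14}e^{ib_2\lambda}$. Zeros are counted with multiplicity. Boundary conditions are regular if $J_{14}J_{32}\ne0$. Let $\{\lambda_n^0\}_{n\in\mathbb{Z}}$ be the zeros of $\Delta_0$ ordered so that $\operatorname{Re}\lambda_n^0\le\operatorname{Re}\lambda_{n+1}^0$. Boundary conditions are strictly regular if they are regular and for some $n_0\in\mathbb{N}$, $\tau>0$: $|\lambda_n^0-\lambda_m^0|>2\tau$ for $n\ne m$, $|n|,|m|>n_0$. $\mathbb{D}_\rho(z)$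 is the disc of radius $\rho$ centred at $z$; $\Pi_h=\{\lambda\in\mathbb{C}:|\operatorname{Im}\lambda|\le h\}$. A sequence $\{\mu_n\}_{n\in\mathbb{Z}}$ is incompressible of density $d\in\mathbb{N}$ if $\operatorname{card}\{n\in\mathbb{Z}:|\operatorname{Re}\mu_n-t|\le1\}\le d$ for all $t\in\mathbb{R}$. Canonical ordering: for regular boundary conditions and every $\varepsilon>0$ there are constants $M_\varepsilon=M_\varepsilon(Q,B,A)>0$ and $C_\varepsilon=C_\varepsilon(B,A)>0$ such that $|\Delta_Q(\lambda)-\Delta_0(\lambda)|<|\Delta_0(\lambda)|$ and $|\Delta_Q(\lambda)|>C_\varepsilon(e^{-b_1\operatorname{Im}\lambda}+e^{-b_2\operatorname{Im}\lambda})$ for $\lambda\notin\widetilde\Omega_\varepsilon$, where $\widetilde\Omega_\varepsilon:=\mathbb{D}_{M_\varepsilon}(0)\cup\bigcup_{n\in\mathbb{Z}}\mathbb{D}_\varepsilon(\lambda_n^0)$. The sequence $\{\lambda_{Q,n}\}_{n\in\mathbb{Z}}$ of zeros of $\Delta_Q$ is canonically ordered if for all $\varepsilon>0$ and $n\in\mathbb{Z}$ the numbers $\lambda_{Q,n}$ and $\lambda_n^0$ belong to the same connected component of $\widetilde\Omega_\varepsilon$; such an ordering exists. *)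

(* Defs.v *)
From HB Require Import structures.
From mathcomp Require Import all_boot all_order all_algebra.
From mathcomp Require Import complex.
From mathcomp Require Import all_classical all_reals all_analysis.
From mathcomp Require Import measurable_realfun.

Set Implicit Arguments.
Unset Strict Implicit.
Unset Printing Implicit Defensive.

Import Order.TTheory GRing.Theory Num.Theory.
Import numFieldNormedType.Exports.
Import complex.

Local Open Scope classical_set_scope.
Local Open Scope ring_scope.
Local Open Scope complex_scope.

(* [normc] is the real-valued modulus; the norm [`|z|] of [R[i]] is itself
   valued in [R[i]]. *)
Notation normc := (@Normc.normc _).

Section complex_L1.
Context {R : realType}.
Local Notation mu := (@lebesgue_measure R).
Implicit Types (f g : R -> R[i]).

Definition cexp (z : R[i]) : R[i] :=
  (expR (Re z) * cos (Im z)) +i* (expR (Re z) * sin (Im z)).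

Definition cintegral (D : set R) f : R[i] :=
  (\int[mu]_(t in D) Re (f t)) +i* (\int[mu]_(t in D) Im (f t)).

Definition integrable01 f : Prop :=
  mu.-integrable `[0, 1] (EFin \o (fun t => Re (f t))) /\
  mu.-integrable `[0, 1] (EFin \o (fun t => Im (f t))).

(* [f] is absolutely continuous on [0, 1] with a.e. derivative [g] *)
Definition is_ac_derive01 f g : Prop :=
  integrable01 g /\
  forall x, 0 <= x <= 1 -> f x = f 0 + cintegral `[0, x] g.

Lemma integrable01B f g :
  integrable01 f -> integrable01 g -> integrable01 (fun t => f t - g t).
Proof.
move=> [rf imf] [rg img]; split.
- apply: (@eq_integrable _ _ _ mu `[0, 1] _ (fun t => (Re (f t))%:E - (Re (g t))%:E)%E) => //.
    by move=> t _ /=; case: (f t) (g t) => [? ?] [? ?].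
  exact: integrableB.
- apply: (@eq_integrable _ _ _ mu `[0, 1] _ (fun t => (Im (f t))%:E - (Im (g t))%:E)%E) => //.
    by move=> t _ /=; case: (f t) (g t) => [? ?] [? ?].
  exact: integrableB.
Qed.

Lemma integrable01_normc f : integrable01 f ->
  mu.-integrable `[0, 1] (EFin \o (fun t => normc (f t))).
Proof.
move=> [rf imf].
have /measurable_EFinP mr := measurable_int mu rf.
have /measurable_EFinP mi := measurable_int mu imf.
apply: (@le_integrable _ _ _ mu `[0, 1] _ _
  (fun t => (`|Re (f t)|)%:E + (`|Im (f t)|)%:E)%E) => //.
- apply/measurable_EFinP.
  rewrite (_ : (fun t => normc (f t)) =
    Num.sqrt \o (fun t => Re (f t) ^+ 2 + Im (f t) ^+ 2)); last first.
    by apply/funext => t /=; case: (f t).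
  apply: measurableT_comp.
    exact: (continuous_measurable_fun (@sqrt_continuous R)).
  by apply: measurable_funD; exact: measurable_funX.
- move=> t _ /=; rewrite lee_fin.
  case: (f t) => a b /=.
  rewrite ger0_norm ?sqrtr_ge0// ger0_norm ?addr_ge0//.
  rewrite -[leRHS]ger0_norm ?addr_ge0// -sqrtr_sqr ler_wsqrtr//.
  rewrite sqrrD !real_normK ?num_real// -addrA [leRHS]addrA.
  by rewrite -[leLHS]addr0 [leRHS]addrAC lerD// mulrn_wge0// mulr_ge0.
- by apply: integrableD => //; exact: integrable_norm.
Qed.

End complex_L1.

Record potential (R : realType) := Potential {
  pot12 : R -> R[i] ;
  pot21 : R -> R[i] ;
  pot12_L1 : integrable01 pot12 ;
  pot21_L1 : integrable01 pot21 }.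

(* Potentials are not quotiented by a.e. equality: [potential R] is a
   pseudometric space whose Kolmogorov quotient is the space of potential
   matrices in L^1([0, 1]; C^(2 x 2)). *)
Section potential_topology.
Context {R : realType}.
Local Notation mu := (@lebesgue_measure R).
Implicit Types (P Q : potential R).

Definition potmx Q (t : R) : 'M[R[i]]_2 :=
  \matrix_(j, k) if j == k then 0 else if j == 0 then pot12 Q t else pot21 Q t.

Definition L1dist P Q : R :=
  \int[mu]_(t in `[0, 1])
    (normc (pot12 P t - pot12 Q t) + normc (pot21 P t - pot21 Q t)).

Let integrable_diff P Q : mu.-integrable `[0, 1] (EFin \o (fun t =>
  normc (pot12 P t - pot12 Q t) + normc (pot21 P t - pot21 Q t))).
Proof.
apply: (@integrableD _ _ _ mu _ _
  (EFin \o (fun t => normc (pot12 P t - pot12 Q t)))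
  (EFin \o (fun t => normc (pot21 P t - pot21 Q t)))) => //.
- by apply/integrable01_normc/integrable01B; exact: pot12_L1.
- by apply/integrable01_normc/integrable01B; exact: pot21_L1.
Qed.

Let L1ball P (e : R) Q : Prop := L1dist P Q < e.

Let L1ball_center P (e : R) : 0 < e -> L1ball P e P.
Proof.
rewrite /L1ball /L1dist => e0.
rewrite (_ : (fun t => _) = cst 0) ?Rintegral_cst ?mul0r//.
by apply/funext => t /=; rewrite !subrr /= !expr0n /= addr0 sqrtr0 addr0.
Qed.

Let L1ball_sym P Q (e : R) : L1ball P e Q -> L1ball Q e P.
Proof.
have nC (x y : R[i]) : normc (x - y) = normc (y - x).
  by rewrite -[in LHS](opprB y x) normcN.
rewrite /L1ball /L1dist; congr (_ < _); congr (Rintegral _ _ _).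
by apply/funext => t /=; rewrite nC [in X in _ + X]nC.
Qed.

Let L1ball_triangle P Q S (e1 e2 : R) :
  L1ball P e1 Q -> L1ball Q e2 S -> L1ball P (e1 + e2) S.
Proof.
rewrite /L1ball => PQ QS; apply: le_lt_trans (ltrD PQ QS).
rewrite /L1dist -RintegralD//; try exact: integrable_diff.
apply: le_Rintegral => //.
  by apply: (@integrableD _ _ _ mu _ _ (EFin \o _) (EFin \o _)) => //;
    exact: integrable_diff.
move=> t _; rewrite addrACA; apply: lerD.
- by rewrite -(subrKA (pot12 Q t)); exact: le_normcD.
- by rewrite -(subrKA (pot21 Q t)); exact: le_normcD.
Qed.

HB.instance Definition _ := gen_eqMixin (potential R).
HB.instance Definition _ := gen_choiceMixin (potential R).
HB.instance Definition _ :=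
  hasNbhs.Build (potential R) (nbhs_ (entourage_ L1ball)).
HB.instance Definition _ := Nbhs_isPseudoMetric.Build R (potential R)
  (erefl : nbhs = nbhs_ (entourage_ L1ball))
  L1ball_center L1ball_sym L1ball_triangle erefl.

End potential_topology.

Section boundary_value_problem.
Context {R : realType}.
Variables (b1 b2 : R) (A : 'M[R[i]]_(2, 4)).
Implicit Types (Q : potential R) (Phi : R[i] -> R -> 'M[R[i]]_2) (lam : R[i]).

Definition Bmx : 'M[R[i]]_2 :=
  diag_mx (\row_j if j == 0 then b1%:C else b2%:C).

(* [y] solves [- i B^-1 y' + Q y = lam y] on [0, 1] in the Caratheodory sense *)
Definition dirac_solution Q lam (y : R -> 'cV[R[i]]_2) : Prop :=
  exists y' : R -> 'cV[R[i]]_2,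
    (forall j, is_ac_derive01 (fun x => y x j 0) (fun x => y' x j 0)) /\
    {ae (@lebesgue_measure R), forall t, 0 <= t <= 1 ->
      - 'i *: (invmx Bmx *m y' t) + potmx Q t *m y t = lam *: y t}.

Definition is_fundamental Q Phi : Prop :=
  forall lam, Phi lam 0 = 1%:M /\
    forall k, dirac_solution Q lam (fun x => col k (Phi lam x)).

Definition bc_form (j : 'I_2) (y : R -> 'cV[R[i]]_2) : R[i] :=
  A j 0 * y 0 0 0 + A j 1 * y 0 1 0 + A j 2%:R * y 1 0 0 + A j 3%:R * y 1 1 0.

Definition char_det Phi lam : R[i] :=
  \det (\matrix_(j, k) bc_form j (fun x => col k (Phi lam x))).

Definition is_char_det Q (Delta : R[i] -> R[i]) : Prop :=
  exists2 Phi, is_fundamental Q Phi & Delta = char_det Phi.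

(* columns are numbered from 0 here: [bc_minor 0 1] is J_12, [bc_minor 2%:R 1] is
   J_32, and so on *)
Definition bc_minor (j k : 'I_4) : R[i] :=
  \det (colsub (fun c : 'I_2 => if c == 0 then j else k) A).

Definition Delta0 lam : R[i] :=
  bc_minor 0 1 + bc_minor 2%:R 3%:R * cexp ('i * (b1 + b2)%:C * lam)
  + bc_minor 2%:R 1 * cexp ('i * b1%:C * lam)
  + bc_minor 0 3%:R * cexp ('i * b2%:C * lam).

Definition regular_bc : Prop := bc_minor 0 3%:R * bc_minor 2%:R 1 != 0.

End boundary_value_problem.

Section zeros.
Context {R : realType}.
Implicit Types (f : R[i] -> R[i]) (u : int -> R[i]) (z : R[i]).

(* the first non-vanishing derivative of [f] at [z] is the [m]-th one *)
Definition vanishing_order f z (m : nat) : Prop :=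
  let F : (R[i] : numFieldType) -> (R[i] : numFieldType) := f in
  (forall k, (k < m)%N -> derive1n k F z = 0) /\ derive1n m F z != 0.

(* every [z] occurs in [u] as many times as its multiplicity as a zero of [f] *)
Definition zeros_of f u : Prop :=
  forall z, exists2 m, vanishing_order f z m & ([set n | u n = z] #= `I_m)%card.

Definition disc z (r : R) : set R[i] := [set w | normc (w - z) < r].

Definition incompressible u (d : nat) : Prop :=
  forall t : R, ([set n | `|Re (u n) - t| <= 1] #<= `I_d)%card.

Definition strictly_regular_bc (A : 'M[R[i]]_(2, 4)) u : Prop :=
  regular_bc A /\
  exists (n0 : nat) (tau : R), 0 < tau /\
    forall n m : int, n != m -> (n0 < `|n|)%N -> (n0 < `|m|)%N ->
      2 * tau < normc (u n - u m).

Definition Omega u (eps M : R) : set R[i] :=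
  disc 0 M `|` \bigcup_n disc (u n) eps.

Definition localizes (b1 b2 : R) f f0 u (eps M C : R) : Prop :=
  forall lam, ~ Omega u eps M lam ->
    normc (f lam - f0 lam) < normc (f0 lam) /\
    C * (expR (- b1 * Im lam) + expR (- b2 * Im lam)) < normc (f lam).

(* No choice of the constants [M], [C] is singled out for a given [eps]: the
   matching of [u] with [u0] has to be compatible with all admissible ones. *)
Definition canonically_ordered (b1 b2 : R) f f0 u0 u : Prop :=
  zeros_of f u /\
  forall eps M C : R, 0 < eps -> 0 < M -> 0 < C ->
    localizes b1 b2 f f0 u0 eps M C ->
    forall n, connected_component (Omega u0 eps M : set (R[i] : numFieldType))
      (u0 n) (u n).

End zeros.

(* Main.v *)
(* The zeros of [Delta_Q] are located by comparing it with [Delta_0].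

   In the variables [z_j t = e^(- i c1 lam t) y_j t], where [{c1, c2} = {b1, b2}]
   is ordered so that [(c2 - c1) Im lam >= 0], the Dirac system only involves the
   bounded exponentials [e^(i (c2 - c1) lam t)].  The Riemann-Lebesgue lemma and
   Gronwall's inequality then give
   [|Delta_Q - Delta_0| = o(e^(- b1 Im lam) + e^(- b2 Im lam))], locally uniformly
   in [Q], hence uniformly on a compact set of potentials.

   On the other side, among the Taylor coefficients of [Delta_0] of degree 1, 2
   and 3 at a point of a horizontal strip, one is bounded below by a constant
   depending on the strip only.  Hence a small disc contains at most three
   distinct zeros, each of order at most 3, and a point where [Delta_0] is small
   is close to a zero.  So [|Delta_0|] dominates the perturbation outside small
   discs around the [lam0 n] and a large disc around 0.  As the density of the
   zeros is bounded, vertical lines and small circles avoiding all these discs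
   can be found by the pigeonhole principle; they enclose the connected component
   which contains both [lam0 n] and [lamQ n]. *)

Require Import Defs.
From HB Require Import structures.
From mathcomp Require Import all_boot all_order all_algebra.
From mathcomp Require Import complex.
From mathcomp Require Import all_classical all_reals all_analysis.
From mathcomp Require Import measurable_realfun ring lra.

Set Implicit Arguments.
Unset Strict Implicit.
Unset Printing Implicit Defensive.

Import Order.TTheory GRing.Theory Num.Theory.
Import numFieldNormedType.Exports.
Import complex.

Local Open Scope classical_set_scope.
Local Open Scope ring_scope.
Local Open Scope complex_scope.

(** * Primitives of integrable functions on [0, 1] *)

Section real_primitive.
Context {R : realType}.
Notation mu := (@lebesgue_measure R).
Implicit Types (f g h : R -> R) (x : R).

(** The order of the quantifiers shapes the proof. The lower bounds must depend on [B] and [A] only,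
    so [Delta_0] is bounded below first, and the potentials enter solely through the radius [M] of
    the disc around 0; compactness serves to choose that radius. The Gronwall constant is likewise
    fixed from a bound on the L1 norms, before the potential and the spectral parameter.

    Each [lamQ n] is tied to [lam0 n] by a connected component, so the displacement and the density
    are transferred from [lam0] index by index, without counting zeros of [Delta_Q]. A component is
    confined by a level of a 1-Lipschitz function (a real part up to sign, or the distance to
    [lam0 n]) which none of the discs meets.

    The minor J_34 multiplies a product of two entries of the fundamental matrix. Entrywise
    estimates would leave there an error of the order of the square of the admissible growth; that
    term is computed exactly by Liouville's formula instead.

    No contour integral is used for [Delta_0]. Its zeros are found and counted from Taylor
    expansions whose remainders are uniform on a strip, by algebra on the Taylor polynomials. *)

Definition prim f x : R := \int[mu]_(t in `[0, x]) f t.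

Definition integrableR01 f : Prop := mu.-integrable `[0, 1] (EFin \o f).

Definition cont01 f : Prop := {within `[0, 1], continuous f}.

Lemma integrableR01_sub f x : integrableR01 f -> x <= 1 -> mu.-integrable `[0, x] (EFin \o f).
Proof.
move=> fi x1; apply: integrableS fi => //.
by apply: subset_itvl; rewrite bnd_simp.
Qed.

Lemma integrableR01_eq f g : (forall t, 0 <= t <= 1 -> f t =
  g t) -> integrableR01 f -> integrableR01 g.
Proof.
move=> fg; apply: eq_integrable => // t; rewrite inE/= in_itv/= => t01.
by rewrite fg.
Qed.

Lemma prim_eq f g x : x <= 1 -> (forall t, 0 <= t <= 1 -> f t = g t) ->
  prim f x = prim g x.
Proof.
move=> x1 fg; apply: eq_Rintegral => t; rewrite inE/= in_itv/= => /andP[t0 tx].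
by apply: fg; rewrite t0 (le_trans tx).
Qed.

Lemma integrableR01D f g : integrableR01 f -> integrableR01 g -> integrableR01 (fun t =>
  f t + g t).
Proof. by move=> fi gi; exact: (integrableD _ fi gi). Qed.

Lemma integrableR01Z k f : integrableR01 f -> integrableR01 (fun t => k * f t).
Proof. by move=> fi; exact: (integrableZl _ k fi). Qed.

Lemma integrableR01N f : integrableR01 f -> integrableR01 (fun t => - f t).
Proof. by move=> fi; apply: integrableR01_eq (integrableR01Z (-1) fi) => t _;
  rewrite mulN1r. Qed.

Lemma integrableR01B f g : integrableR01 f -> integrableR01 g -> integrableR01 (fun t =>
  f t - g t).
Proof. by move=> fi gi; apply: integrableR01D => //; exact: integrableR01N. Qed.

Lemma integrableR01_norm f : integrableR01 f -> integrableR01 (fun t => `|f t|).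
Proof. exact: integrable_norm. Qed.

Lemma primD f g x : x <= 1 -> integrableR01 f -> integrableR01 g ->
  prim (fun t => f t + g t) x = prim f x + prim g x.
Proof. by move=> x1 fi gi; apply: RintegralD => //; exact: integrableR01_sub. Qed.

Lemma primZ k f x : x <= 1 -> integrableR01 f -> prim (fun t => k * f t) x = k * prim f x.
Proof. by move=> x1 fi; apply: RintegralZl => //; exact: integrableR01_sub. Qed.

Lemma primB f g x : x <= 1 -> integrableR01 f -> integrableR01 g ->
  prim (fun t => f t - g t) x = prim f x - prim g x.
Proof. by move=> x1 fi gi; apply: RintegralB => //; exact: integrableR01_sub. Qed.

Lemma le_prim f g x : x <= 1 -> integrableR01 f -> integrableR01 g ->
  (forall t, 0 <= t <= x -> f t <= g t) -> prim f x <= prim g x.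
Proof.
by move=> x1 fi gi fg; apply: le_Rintegral (integrableR01_sub fi x1) (integrableR01_sub gi
  x1) _ => //.
Qed.

Lemma prim_ge0 f x : (forall t, 0 <= t <= x -> 0 <= f t) -> 0 <= prim f x.
Proof. by move=> f0; apply: Rintegral_ge0. Qed.

Lemma norm_prim f x : x <= 1 -> integrableR01 f -> `|prim f x| <= prim (fun t => `|f t|) x.
Proof. by move=> x1 fi; apply: le_normr_Rintegral => //; exact: integrableR01_sub. Qed.

Lemma prim0 f : prim f 0 = 0.
Proof. by rewrite /prim set_itv1 Rintegral_set1. Qed.

Lemma prim_le f x y : integrableR01 f -> (forall t, 0 <= t <= 1 -> 0 <= f t) ->
  0 <= x -> x <= y -> y <= 1 -> prim f x <= prim f y.
Proof.
move=> fi f0 x0 xy y1; rewrite -subr_ge0 /prim Rintegral_itvB ?bnd_simp//.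
  apply: Rintegral_ge0 => t /=; rewrite in_itv/= => /andP[xt ty].
  by apply: f0; rewrite (le_trans _ (ltW xt))// (le_trans ty).
exact: integrableR01_sub.
Qed.

Lemma prim_cont f : integrableR01 f -> cont01 (prim f).
Proof. by move=> fi; exact: parameterized_integral_continuous. Qed.

Lemma cont01_meas f : cont01 f -> measurable_fun (`[0, 1] : set (measurableTypeR R)) f.
Proof. by move=> fc; apply: subspace_continuous_measurable_fun. Qed.

Lemma cont01_bounded f : cont01 f ->
  exists2 M, 0 < M & forall t, 0 <= t <= 1 -> `|f t| <= M.
Proof.
move=> fc.
have := continuous_compact fc (@segment_compact _ 0 1).
move=> /compact_bounded/ex_strict_bound_gt0[M M0 fM].
exists M => // t t01; by apply/ltW/fM; exists t.
Qed.

Lemma cont01_intR f : cont01 f -> integrableR01 f.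
Proof.
by move=> fc; apply: continuous_compact_integrable => //; exact: segment_compact.
Qed.

Lemma continuous_cont01 f : continuous f -> cont01 f.
Proof. exact: continuous_subspaceT. Qed.

Lemma cont01_cst k : cont01 (fun=> k).
Proof. by apply: continuous_cont01 => t; exact: cvg_cst. Qed.

Lemma cont01D f g : cont01 f -> cont01 g -> cont01 (fun t => f t + g t).
Proof. by move=> fc gc t; apply: (@cvgD _ R^o); [exact: fc|exact: gc]. Qed.

Lemma cont01M f g : cont01 f -> cont01 g -> cont01 (fun t => f t * g t).
Proof. by move=> fc gc t; apply: (@cvgM R); [exact: fc|exact: gc]. Qed.

Lemma cont01N f : cont01 f -> cont01 (fun t => - f t).
Proof. by move=> fc t; apply: (@cvgN _ R^o); exact: fc. Qed.

Lemma cont01B f g : cont01 f -> cont01 g -> cont01 (fun t => f t - g t).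
Proof. by move=> fc gc; apply: cont01D => //; exact: cont01N. Qed.

Lemma cont01_comp f h : continuous h -> cont01 f -> cont01 (fun t => h (f t)).
Proof. by move=> hc fc t; apply: continuous_comp; [exact: fc|exact: hc]. Qed.

Lemma cont01_eq f g : (forall t, 0 <= t <= 1 -> f t = g t) -> cont01 f -> cont01 g.
Proof.
move=> fg; apply: subspace_eq_continuous => t; rewrite inE/= in_itv/=.
exact: fg.
Qed.

Lemma integrableR01M f g : integrableR01 f -> cont01 g -> integrableR01 (fun t => f t * g t).
Proof.
move=> fi gc; have [M M0 gM] := cont01_bounded gc.
have := @integrableMl _ _ R mu `[0, 1] (measurable_itv _) (EFin \o f) g fi (cont01_meas gc).
apply.
exists M; split; first exact: num_real.
by move=> k Mk t /=; rewrite in_itv/= => /gM/le_trans; apply; exact: ltW.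
Qed.

End real_primitive.

(** * Product rule for primitives of L1 functions *)

Section real_product.
Context {R : realType}.
Notation mu := (@lebesgue_measure R).
Implicit Types (f g h : R -> R) (x : R).

Lemma prim_derivable f x : continuous f -> 0 < x < 1 ->
  derivable (prim f) x 1 /\ derive1 (prim f) x = f x.
Proof.
move=> fc /andP[x0 x1]; apply: (@continuous_FTC1_closed R f 0 x 1) => //.
  exact: (cont01_intR (continuous_cont01 fc)).
exact: fc.
Qed.

Lemma prim_LR f x : continuous f -> 0 < x -> x <= 1 ->
  derivable_oo_LRcontinuous (prim f) 0 x.
Proof.
move=> fc x0 x1.
have /(prim_cont (R := R)) : integrableR01 f by apply/cont01_intR/continuous_cont01.
move=> pc.
have pcx : {within `[0, x], continuous (prim f)}.
  by apply: continuous_subspaceW pc; apply: subset_itvl; rewrite bnd_simp.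
move/(continuous_within_itvP _ x0) : pcx => [_ c0 cx].
split => //.
move=> t; rewrite in_itv/= => /andP[t0 tx].
by apply: (proj1 (prim_derivable fc _)); rewrite t0 (lt_le_trans tx).
Qed.

Lemma prim_prod_cont f g x : continuous f -> continuous g -> 0 <= x <= 1 ->
  prim (fun t => f t * prim g t + prim f t * g t) x = prim f x * prim g x.
Proof.
move=> fc gc /andP[]; rewrite le_eqVlt => /predU1P[<- _|x0 x1].
  by rewrite !prim0 mul0r.
have fC := continuous_cont01 fc; have gC := continuous_cont01 gc.
have fi := cont01_intR fC; have gi := cont01_intR gC.
have pf := prim_cont fi; have pg := prim_cont gi.
rewrite primD//; last 2 first.
  exact: integrableR01M.
  by apply: cont01_intR; exact: cont01M.
rewrite addrC {1}/prim (@Rintegration_by_parts R (prim f) (prim g) f g 0 x)//.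
- by rewrite !prim0 mul0r subr0 subrK.
- by apply: continuous_subspaceT.
- exact: prim_LR.
- move=> t; rewrite in_itv/= => /andP[t0 tx].
  by apply: (proj2 (prim_derivable fc _)); rewrite t0 (lt_le_trans tx).
- by apply: continuous_subspaceT.
- exact: prim_LR.
- move=> t; rewrite in_itv/= => /andP[t0 tx].
  by apply: (proj2 (prim_derivable gc _)); rewrite t0 (lt_le_trans tx).
Qed.

Lemma integrableR01_approx f (e : R) : integrableR01 f -> 0 < e ->
  exists2 h, continuous h & prim (fun t => `|f t - h t|) 1 <= e.
Proof.
move=> fi e0.
have m01 : (mu `[0%R, 1%R] < +oo)%E.
  by rewrite lebesgue_measure_itv/= lte_fin ltr01 -EFinB ltry.
have [g_ [gc gi gcv]] := approximation_continuous_integrable (measurable_itv _) m01 fi.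
have /fine_cvgP[_ /cvgrPdist_lt/(_ e e0)[n _ /(_ n (leqnn n))]] := gcv.
rewrite /= sub0r normrN => h; exists (g_ n); first exact: gc.
exact/ltW/(le_lt_trans (ler_norm _) h).
Qed.

Lemma norm_prim_le f x : integrableR01 f -> 0 <= x <= 1 ->
  `|prim f x| <= prim (fun t => `|f t|) 1.
Proof.
move=> fi /andP[x0 x1]; apply: le_trans (norm_prim x1 fi) _.
by apply: prim_le => //; exact: integrableR01_norm.
Qed.

Let defect f g x :=
  prim (fun t => f t * prim g t + prim f t * g t) x - prim f x * prim g x.

Let N f := prim (fun t => `|f t|) 1.

Let integrableR01_prod f g : integrableR01 f -> integrableR01 g ->
  integrableR01 (fun t => f t * prim g t + prim f t * g t).
Proof.
move=> fi gi; apply: integrableR01D; first exact/integrableR01M/prim_cont.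
apply: (@integrableR01_eq _ (fun t => g t * prim f t)) => [t _|]; first by rewrite mulrC.
exact/integrableR01M/prim_cont.
Qed.

(** A primitive is bounded by the L1 norm of its density, so the two summands under the integral and
    the product of the primitives each contribute at most [N f * N g]. *)
Let defect_bound f g x : integrableR01 f -> integrableR01 g -> 0 <= x <= 1 ->
  `|defect f g x| <= 3 * (N f * N g).
Proof.
move=> fi gi x01; have pi := integrableR01_prod fi gi; case/andP: (x01) => x0 x1.
rewrite /defect (le_trans (ler_normB _ _))//.
have N0 h : 0 <= N h by apply: prim_ge0.
have -> : 3 * (N f * N g) = 2 * (N f * N g) + N f * N g by ring.
apply: lerD; last first.
  by rewrite normrM ler_pM ?normr_ge0//; exact: norm_prim_le.
apply: le_trans (norm_prim_le pi x01) _.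
have -> : 2 * (N f * N g) = prim (fun t => N g * `|f t| + N f * `|g t|) 1.
  rewrite primD//; [|exact/integrableR01Z/integrableR01_norm..].
  by rewrite !primZ//; [rewrite -/(N f) -/(N g); ring|exact: integrableR01_norm..].
apply: le_prim => //; first exact: integrableR01_norm.
  by apply: integrableR01D; exact/integrableR01Z/integrableR01_norm.
move=> t t01; rewrite (le_trans (ler_normD _ _))// !normrM.
by apply: lerD; [rewrite mulrC|]; apply: ler_wpM2r => //; exact: norm_prim_le.
Qed.

Let defectDl f f' g x : integrableR01 f -> integrableR01 f' -> integrableR01 g -> 0 <= x <= 1 ->
  defect f g x = defect (fun t => f t - f' t) g x + defect f' g x.
Proof.
move=> fi f'i gi /andP[x0 x1]; rewrite /defect primB//.
rewrite [in RHS]addrACA -primD//; last 2 first.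
  by apply: integrableR01_prod => //; exact: integrableR01B.
  exact: integrableR01_prod.
rewrite -opprD -mulrDl subrK; congr (_ - _).
apply: prim_eq => // t /andP[t0 t1]; rewrite primB//.
ring.
Qed.

Let defectC f g x : x <= 1 -> defect f g x = defect g f x.
Proof.
move=> x1; rewrite /defect [prim f x * _]mulrC; congr (_ - _).
by apply: prim_eq => // t _; rewrite addrC [f t * _]mulrC [g t * _]mulrC.
Qed.

(* The identity is bilinear and L1-continuous in [(f, g)], so it extends from
   continuous functions by density. *)
Lemma prim_prod f g x : integrableR01 f -> integrableR01 g -> 0 <= x <= 1 ->
  prim (fun t => f t * prim g t + prim f t * g t) x = prim f x * prim g x.
Proof.
move=> fi gi x01; apply/eqP; rewrite -subr_eq0 -/(defect f g x).
have x1 : x <= 1 by case/andP: x01.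
rewrite -normr_le0; apply/ler_addgt0Pr => e e0; rewrite add0r.
have N0 h : 0 <= N h by apply: prim_ge0.
pose c := 3 * (N f + N g + 1); have c0 : 0 < c.
  by rewrite mulr_gt0// ltr_wpDl// addr_ge0.
pose d := Num.min 1 (e / c); have d0 : 0 < d by rewrite lt_min ltr01 divr_gt0.
have [f' f'c ff'] := integrableR01_approx fi d0.
have [g' g'c gg'] := integrableR01_approx gi d0.
have f'i := cont01_intR (continuous_cont01 f'c).
have g'i := cont01_intR (continuous_cont01 g'c).
have f'N : N f' <= N f + d.
  apply: le_trans (lerD (lexx (N f)) ff').
  rewrite -primD//; [|exact: integrableR01_norm|by apply: integrableR01_norm;
    exact: integrableR01B].
  apply: le_prim => //; first exact: integrableR01_norm.
    by apply: integrableR01D; apply: integrableR01_norm => //; exact: integrableR01B.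
  move=> t _; rewrite -[X in `|X| <= _](subrK (f t)) addrC.
  by rewrite [`|f t - _|]distrC; exact: ler_normD.
have f'gi : integrableR01 (fun t => g t - g' t) by exact: integrableR01B.
have ffi : integrableR01 (fun t => f t - f' t) by exact: integrableR01B.
(* [f] and then [g] are replaced by continuous approximants; [defectC] brings the second argument
   into the position handled by [defectDl], and the remaining defect vanishes by
   [prim_prod_cont]. *)
rewrite (defectDl fi f'i gi x01) (defectC f' _ x1) (defectDl gi g'i f'i x01).
rewrite (_ : defect g' f' x = 0) ?addr0; last first.
  by rewrite /defect prim_prod_cont// subrr.
apply: le_trans (ler_normD _ _) _.
apply: le_trans (lerD (defect_bound ffi gi x01) (defect_bound f'gi f'i x01)) _.
rewrite -/(N (fun t => f t - f' t)) in ff'; rewrite -/(N (fun t => g t - g' t)) in gg'.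
have d1 : d <= 1 by rewrite ge_min lexx.
apply: (@le_trans _ _ (3 * (d * N g) + 3 * (d * (N f + d)))).
  by apply: lerD; rewrite ler_pM2l ?ltr0n// ler_pM.
apply: (@le_trans _ _ (d * c)).
  rewrite /c; have := N0 f; have := N0 g; nra.
by rewrite -ler_pdivlMr// ge_min lexx orbT.
Qed.

End real_product.

(** * Gronwall's inequality with an integrable coefficient *)

Section gronwall.
Context {R : realType}.
Implicit Types (f g r w : R -> R) (x a : R).

Lemma cont01X f n : cont01 f -> cont01 (fun t => f t ^+ n).
Proof. by move=> fc; apply: (@cont01_comp _ f (fun y => y ^+ n)) => // y;
  exact: exprn_continuous. Qed.

(** Since [prim r] is only absolutely continuous, the chain rule is replaced by induction with
    [prim_prod]: writing P for [prim r], the product of P and P^(n+1)/(n+1) has density (n+2)/(n+1)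
    r P^(n+1). *)
Lemma prim_exp r n x : integrableR01 r -> 0 <= x <= 1 ->
  prim (fun t => r t * prim r t ^+ n) x = prim r x ^+ n.+1 / n.+1%:R.
Proof.
move=> ri; have rc := prim_cont ri.
elim: n x => [|n IH] x /[dup] x01 /andP[x0 x1].
  by rewrite divr1 expr1; apply: prim_eq => // t _; rewrite expr0 mulr1.
have gi : integrableR01 (fun t => r t * prim r t ^+ n) by apply: integrableR01M => //;
  exact: cont01X.
have n0 : n.+1%:R != 0 :> R by rewrite pnatr_eq0.
have n1 : n.+2%:R != 0 :> R by rewrite pnatr_eq0.
have := prim_prod ri gi x01; rewrite IH//.
rewrite (_ : prim (fun t => _) x =
    prim (fun t => (n.+2%:R / n.+1%:R) * (r t * prim r t ^+ n.+1)) x); last first.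
  apply: prim_eq => // t t01; rewrite IH// !exprS; field.
  by rewrite nat1r.
rewrite primZ//; last by apply: integrableR01M => //; exact: cont01X.
rewrite (exprS _ n.+1).
move: (prim (fun t => r t * _) x) (prim r x ^+ _) n0 n1 => u v.
move: (n.+1%:R : R) (n.+2%:R : R) => p q p0 q0 h.
apply: (mulfI (mulf_neq0 q0 (invr_neq0 p0))); rewrite h.
by field; rewrite p0 q0.
Qed.

(** Iterating the inequality [n] times bounds [w] by [a * s n] plus its maximum [C] times rho^n/n!.
    Once the last factor is at most 1/2, half of [C] is absorbed on the left. As [n] depends on
    [rho] only, so does [K]. *)
Lemma gronwall (rho : R) : 0 <= rho -> exists2 K, 0 < K &
  forall r w a, integrableR01 r -> (forall t, 0 <= t <= 1 -> 0 <= r t) ->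
    prim r 1 <= rho -> cont01 w -> 0 <= a ->
    (forall x, 0 <= x <= 1 -> w x <= a + prim (fun t => r t * w t) x) ->
    forall x, 0 <= x <= 1 -> w x <= K * a.
Proof.
move=> rho0.
have [n hn] : exists n, rho ^+ n / n`!%:R <= 2^-1.
  have /cvg_series_cvg_0/cvgrPdist_lt/(_ 2^-1) := is_cvg_series_exp_coeff rho.
  rewrite invr_gt0 ltr0n => /(_ isT)[n _ /(_ n (leqnn n))].
  rewrite /= sub0r normrN => h; exists n.
  by apply/ltW/(le_lt_trans (ler_norm _) h).
pose s k := \sum_(j < k) rho ^+ j.
have sS k : s k.+1 = 1 + rho * s k.
  rewrite /s big_ord_recl expr0; congr (_ + _); rewrite mulr_sumr.
  by apply: eq_bigr => i _; rewrite -exprS.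
have s0 k : 0 <= s k by apply: sumr_ge0 => j _; exact: exprn_ge0.
exists (2 * s n + 1); first by rewrite ltr_wpDl// mulr_ge0.
move=> r w a ri r0 rrho wc a0 hw x x01.
have [x0 /[!inE]/= x0_ wx0] := @EVT_max R w 0 1 ler01 wc.
have x001 : 0 <= x0 <= 1 by [].
pose C := w x0.
have wC t : 0 <= t <= 1 -> w t <= C by move=> t01; exact: wx0.
suff : C <= (2 * s n + 1) * a by apply: le_trans; exact: wC.
have rc := prim_cont ri.
have Rle t : 0 <= t <= 1 -> 0 <= prim r t <= rho.
  move=> /andP[t0 t1]; apply/andP; split; last by rewrite (le_trans _ rrho)// prim_le.
  by apply: prim_ge0 => u /andP[u0 ut]; rewrite r0// u0 (le_trans ut).
have [C0|C0] := leP C 0.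
  by rewrite (le_trans C0)// mulr_ge0// addr_ge0// mulr_ge0.
have claim k t : 0 <= t <= 1 -> w t <= a * s k + C * (prim r t ^+ k / k`!%:R).
  elim: k t => [|k IH] t /[dup] t01 /andP[t0 t1].
    by rewrite /s big_ord0 mulr0 add0r expr0 fact0 divr1 mulr1 wC.
  apply: le_trans (hw t t01) _.
  apply: le_trans (_ : a + prim (fun u => a * s k * r u +
    C / k`!%:R * (r u * prim r u ^+ k)) t <= _).
    rewrite lerD2l; apply: le_prim => //; first exact: integrableR01M.
      by apply: integrableR01D; apply: integrableR01Z => //; apply: integrableR01M => //;
        exact: cont01X.
    move=> u /andP[u0 ut]; have u01 : 0 <= u <= 1 by rewrite u0 (le_trans ut).
    apply: le_trans (ler_wpM2l (r0 _ u01) (IH _ u01)) _.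
    by rewrite le_eqVlt; apply/orP; left; apply/eqP; ring.
  rewrite primD//; last 2 first.
    exact: integrableR01Z.
    by apply: integrableR01Z; apply: integrableR01M => //; exact: cont01X.
  rewrite !primZ//; last by apply: integrableR01M => //; exact: cont01X.
  rewrite prim_exp// sS factS natrM invfM addrA.
  have /andP[R0 R1] := Rle t t01.
  apply: lerD; last by rewrite le_eqVlt; apply/orP; left; apply/eqP; ring.
  by have := ler_wpM2l (mulr_ge0 a0 (s0 k)) R1; lra.
have := claim n x0 x001; rewrite -/C.
have /andP[R0 R1] := Rle _ x001.
have : C * (prim r x0 ^+ n / n`!%:R) <= C * 2^-1.
  rewrite ler_pM2l//; apply: le_trans hn; apply: ler_wpM2r.
    by rewrite invr_ge0.
  by apply: lerXn2r => //; rewrite nnegrE.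
lra.
Qed.

End gronwall.

(** * Absolutely continuous complex functions *)

Section complex_facts.
Context {R : realType}.
Implicit Types (z w : R[i]) (x y : R).

Lemma Re_mul z w : Re (z * w) = Re z * Re w - Im z * Im w.
Proof. by case: z w => [? ?] [? ?]. Qed.

Lemma Im_mul z w : Im (z * w) = Re z * Im w + Im z * Re w.
Proof. by case: z w => [? ?] [? ?]. Qed.

Lemma Re_add z w : Re (z + w) = Re z + Re w.
Proof. by case: z w => [? ?] [? ?]. Qed.

Lemma Im_add z w : Im (z + w) = Im z + Im w.
Proof. by case: z w => [? ?] [? ?]. Qed.

Lemma Re_opp z : Re (- z) = - Re z. Proof. by case: z. Qed.

Lemma Im_opp z : Im (- z) = - Im z. Proof. by case: z. Qed.

Lemma complex_eq z w : Re z = Re w -> Im z = Im w -> z = w.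
Proof. by case: z w => [? ?] [? ?] /= -> ->. Qed.

Lemma normc_ge0 z : 0 <= normc z.
Proof. by case: z => a b; exact: sqrtr_ge0. Qed.

Lemma normc_real x : normc x%:C = `|x|.
Proof. by rewrite /= expr0n/= addr0 sqrtr_sqr. Qed.

Lemma Re_le_normc z : `|Re z| <= normc z.
Proof.
case: z => a b /=; rewrite -[leLHS]ger0_norm// -sqrtr_sqr ler_wsqrtr//.
by rewrite real_normK ?num_real// lerDl sqr_ge0.
Qed.

Lemma Im_le_normc z : `|Im z| <= normc z.
Proof.
case: z => a b /=; rewrite -[leLHS]ger0_norm// -sqrtr_sqr ler_wsqrtr//.
by rewrite real_normK ?num_real// lerDr sqr_ge0.
Qed.

Lemma normc_le_ReIm z : normc z <= `|Re z| + `|Im z|.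
Proof.
case: z => a b /=; rewrite -[leRHS]ger0_norm ?addr_ge0// -sqrtr_sqr ler_wsqrtr//.
rewrite sqrrD !real_normK ?num_real// [leRHS]addrAC lerDl.
by rewrite mulrn_wge0// mulr_ge0.
Qed.

Lemma normcX z n : normc (z ^+ n) = normc z ^+ n.
Proof.
elim: n => [|n IH]; first by rewrite !expr0 -[1]/(1%:C) normc_real normr1.
by rewrite !exprS Normc.normcM IH.
Qed.

Lemma normc_eq0 z : (normc z == 0) = (z == 0).
Proof.
apply/eqP/eqP => [/Normc.eq0_normc //|->].
by rewrite -[0 in LHS]/(0%:C) normc_real normr0.
Qed.

Lemma normc_gt0 z : (0 < normc z) = (z != 0).
Proof. by rewrite lt_def normc_ge0 andbT normc_eq0. Qed.

Lemma normcB z w : normc (z - w) = normc (w - z).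
Proof. by rewrite -[in LHS](opprB w z) normcN. Qed.

Lemma le_normcB z w : normc (z - w) <= normc z + normc w.
Proof. by rewrite -[in leRHS](normcN w); exact: le_normcD. Qed.

Lemma le_normc_sub z w : normc z - normc w <= normc (z - w).
Proof. by rewrite lerBlDr -[in leLHS](subrK w z) le_normcD. Qed.

Lemma cexpD z w : cexp (z + w) = cexp z * cexp w.
Proof.
case: z w => [a b] [c d]; apply: complex_eq; rewrite ?Re_mul ?Im_mul /cexp/=;
  rewrite expRD ?cosD ?sinD; ring.
Qed.

Lemma cexp0 : cexp 0 = 1 :> R[i].
Proof. by rewrite /cexp/= expR0 cos0 sin0 mulr1 mulr0. Qed.

Lemma normc_cexp z : normc (cexp z) = expR (Re z).
Proof.
case: z => a b; rewrite /cexp/= !exprMn -mulrDr cos2Dsin2 mulr1.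
by rewrite sqrtr_sqr ger0_norm// expR_ge0.
Qed.

End complex_facts.

Section complex_primitive.
Context {R : realType}.
Notation mu := (@lebesgue_measure R).
Implicit Types (f g F G : R -> R[i]) (x : R) (k : R[i]).

Definition cprim f x : R[i] := cintegral `[0, x] f.

Definition contC f : Prop :=
  cont01 (fun t => Re (f t)) /\ cont01 (fun t => Im (f t)).

Lemma integrable01_eq f g : (forall t, 0 <= t <= 1 -> f t = g t) ->
  integrable01 f -> integrable01 g.
Proof.
move=> fg [fr fi]; split.
  by apply: integrableR01_eq fr => t t01; rewrite fg.
by apply: integrableR01_eq fi => t t01; rewrite fg.
Qed.

Lemma integrable01D f g : integrable01 f -> integrable01 g ->
  integrable01 (fun t => f t + g t).
Proof.
move=> [fr fi] [gr gi]; split.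
  by apply: integrableR01_eq (integrableR01D fr gr) => t _; rewrite Re_add.
by apply: integrableR01_eq (integrableR01D fi gi) => t _; rewrite Im_add.
Qed.

Lemma integrable01M f g : integrable01 f -> contC g -> integrable01 (fun t => f t * g t).
Proof.
move=> [fr fi] [gr gi]; split.
  apply: integrableR01_eq (integrableR01B (integrableR01M fr gr) (integrableR01M fi gi)) => t _.
  by rewrite Re_mul.
apply: integrableR01_eq (integrableR01D (integrableR01M fr gi) (integrableR01M fi gr)) => t _.
by rewrite Im_mul.
Qed.

Lemma contC_cst k : contC (fun=> k).
Proof. by split; exact: cont01_cst. Qed.

Lemma contCD f g : contC f -> contC g -> contC (fun t => f t + g t).
Proof.
move=> [fr fi] [gr gi]; split.
  by apply: cont01_eq (cont01D fr gr) => t _; rewrite Re_add.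
by apply: cont01_eq (cont01D fi gi) => t _; rewrite Im_add.
Qed.

Lemma contCM f g : contC f -> contC g -> contC (fun t => f t * g t).
Proof.
move=> [fr fi] [gr gi]; split.
  apply: cont01_eq (cont01B (cont01M fr gr) (cont01M fi gi)) => t _.
  by rewrite Re_mul.
apply: cont01_eq (cont01D (cont01M fr gi) (cont01M fi gr)) => t _.
by rewrite Im_mul.
Qed.

Lemma contC_integrable01 f : contC f -> integrable01 f.
Proof. by move=> [fr fi]; split; exact: cont01_intR. Qed.

Lemma integrable01Z k f : integrable01 f -> integrable01 (fun t => k * f t).
Proof.
move=> fi; apply: integrable01_eq (integrable01M fi (contC_cst k)) => t _.
by rewrite mulrC.
Qed.

Lemma cprim_eq f g x : x <= 1 -> (forall t, 0 <= t <= 1 -> f t = g t) ->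
  cprim f x = cprim g x.
Proof.
move=> x1 fg; apply: complex_eq; apply: prim_eq => // t t01; by rewrite fg.
Qed.

Lemma cprim0 f : cprim f 0 = 0.
Proof. by apply: complex_eq; exact: prim0. Qed.

Lemma cprimD f g x : x <= 1 -> integrable01 f -> integrable01 g ->
  cprim (fun t => f t + g t) x = cprim f x + cprim g x.
Proof.
move=> x1 [fr fi] [gr gi]; apply: complex_eq; rewrite ?Re_add ?Im_add/=.
  by rewrite -[RHS](primD x1 fr gr); apply: prim_eq => // t _; rewrite Re_add.
by rewrite -[RHS](primD x1 fi gi); apply: prim_eq => // t _; rewrite Im_add.
Qed.

Lemma cprimZ k f x : x <= 1 -> integrable01 f ->
  cprim (fun t => k * f t) x = k * cprim f x.
Proof.
move=> x1 [fr fi]; apply: complex_eq; rewrite ?Re_mul ?Im_mul/=.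
  rewrite -/(prim _ _) -/(prim _ x) -!primZ// -primB//; try exact: integrableR01Z.
  by apply: prim_eq => // t _; rewrite Re_mul.
rewrite -/(prim _ _) -/(prim _ x) -!primZ// -primD//; try exact: integrableR01Z.
by apply: prim_eq => // t _; rewrite Im_mul.
Qed.

Lemma cprimN f x : x <= 1 -> integrable01 f ->
  cprim (fun t => - f t) x = - cprim f x.
Proof.
move=> x1 fi; rewrite -mulN1r -cprimZ//; apply: cprim_eq => // t _.
by rewrite mulN1r.
Qed.

Lemma cprimB f g x : x <= 1 -> integrable01 f -> integrable01 g ->
  cprim (fun t => f t - g t) x = cprim f x - cprim g x.
Proof.
move=> x1 fi gi; rewrite cprimD// ?cprimN//.
by apply: integrable01_eq (integrable01Z (-1) gi) => t _; rewrite mulN1r.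
Qed.

(** Multiplication by the unimodular [u] makes the integral real and nonnegative, which reduces the
    claim to the pointwise inequality between [Re (u * f t)] and the modulus of [f t]. *)
Lemma normc_cprim f x : integrable01 f -> x <= 1 ->
  normc (cprim f x) <= prim (fun t => normc (f t)) x.
Proof.
move=> fi x1; have [->|I0] := eqVneq (cprim f x) 0.
  rewrite -[0]/(0%:C) normc_real normr0; apply: prim_ge0 => t _; exact: normc_ge0.
pose u := conjc (cprim f x) / (normc (cprim f x))%:C.
have n0 : normc (cprim f x) != 0 by rewrite normc_eq0.
have uI : u * cprim f x = (normc (cprim f x))%:C.
  rewrite /u mulrAC; apply: (canLR (mulfK _)).
    by rewrite -normc_eq0 normc_real normr_eq0.
  rewrite -rmorphM -expr2 mulrC.
  case: (cprim f x) => a b; rewrite sqr_sqrtr ?addr_ge0 ?sqr_ge0//.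
  by simpc; rewrite -!expr2 [b * a]mulrC addNr.
have nu : normc u = 1.
  have := congr1 (@Normc.normc _) uI; rewrite Normc.normcM normc_real.
  rewrite (ger0_norm (normc_ge0 _)) => h.
  by apply: (mulIf n0); rewrite h mul1r.
have -> : normc (cprim f x) = prim (fun t => Re (u * f t)) x.
  have -> : normc (cprim f x) = Re (u * cprim f x) by rewrite uI.
  by rewrite -cprimZ.
apply: le_prim => //; first exact: (proj1 (integrable01Z u fi)).
  exact: integrable01_normc.
move=> t _; apply: le_trans (ler_norm _) (le_trans (Re_le_normc _) _).
by rewrite Normc.normcM nu mul1r.
Qed.

Lemma contC_normc f : contC f -> cont01 (fun t => normc (f t)).
Proof.
move=> [fr fi].
apply: cont01_eq (cont01_comp (@sqrt_continuous R) (cont01D (cont01M fr fr) (cont01M fi fi)))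
  => t _.
by case: (f t) => a b /=; rewrite !expr2.
Qed.

Lemma ac_cont F f : is_ac_derive01 F f -> contC F.
Proof.
move=> [[fr fi] Ff]; split.
  apply: cont01_eq (cont01D (@cont01_cst R (Re (F 0))) (prim_cont fr)) => t t01.
  by rewrite (Ff t t01) Re_add.
apply: cont01_eq (cont01D (@cont01_cst R (Im (F 0))) (prim_cont fi)) => t t01.
by rewrite (Ff t t01) Im_add.
Qed.

Lemma ac_prim f : integrable01 f -> is_ac_derive01 (cprim f) f.
Proof. by move=> fi; split => // x _; rewrite cprim0 add0r. Qed.

Lemma ac_cst k : is_ac_derive01 (fun=> k) (fun=> 0).
Proof.
split; first exact: contC_integrable01 (contC_cst 0).
move=> x /andP[_ x1].
rewrite -/(cprim _ x) (@cprim_eq _ (fun t => 0 * (fun=>0) t) x x1); last first.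
  by move=> t _; rewrite mul0r.
rewrite cprimZ//; last exact: contC_integrable01 (contC_cst 0).
by rewrite mul0r addr0.
Qed.

Lemma acD F f G g : is_ac_derive01 F f -> is_ac_derive01 G g ->
  is_ac_derive01 (fun t => F t + G t) (fun t => f t + g t).
Proof.
move=> [fi Ff] [gi Gg]; split; first exact: integrable01D.
move=> x x01; rewrite -/(cprim _ x) cprimD//; last by case/andP: x01.
by rewrite addrACA -(Ff x x01) -(Gg x x01).
Qed.

Lemma cprim_prod f g x : integrable01 f -> integrable01 g -> 0 <= x <= 1 ->
  cprim (fun t => f t * cprim g t + cprim f t * g t) x = cprim f x * cprim g x.
Proof.
move=> [fr fi] [gr gi] /[dup] x01 /andP[_ x1].
have cr h : integrableR01 h -> cont01 (prim h) by exact: prim_cont.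
have pi (h h' : R -> R) : integrableR01 h -> integrableR01 h' -> integrableR01 (fun t =>
  h t * prim h' t + prim h t * h' t).
  move=> hi h'i; apply: integrableR01D; first by apply: integrableR01M => //; exact: cr.
  apply: (@integrableR01_eq _ (fun t => h' t * prim h t)) => [t _|]; first by rewrite mulrC.
  by apply: integrableR01M => //; exact: cr.
apply: complex_eq; rewrite ?Re_mul ?Im_mul/=.
  rewrite -!/(prim _ x) -!prim_prod// -primB//; try exact: pi.
  apply: prim_eq => // t _; rewrite Re_add !Re_mul /=; rewrite -!/(prim _ t); ring.
rewrite -!/(prim _ x) -!prim_prod// -primD//; try exact: pi.
apply: prim_eq => // t _; rewrite Im_add !Im_mul /=; rewrite -!/(prim _ t); ring.
Qed.

Lemma acM F f G g : is_ac_derive01 F f -> is_ac_derive01 G g ->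
  is_ac_derive01 (fun t => F t * G t) (fun t => f t * G t + F t * g t).
Proof.
move=> aF aG; have [fi Ff] := aF; have [gi Gg] := aG.
have cF := ac_cont aF; have cG := ac_cont aG.
have i1 : integrable01 (fun t => f t * G t) by exact: integrable01M.
have i2 : integrable01 (fun t => F t * g t).
  by apply: integrable01_eq (integrable01M gi cF) => t _; rewrite mulrC.
split; first exact: integrable01D.
move=> x /[dup] x01 /andP[_ x1]; rewrite -/(cprim _ x).
rewrite (Ff x x01) (Gg x x01) -!/(cprim _ x).
have pf := ac_cont (ac_prim fi); have pg := ac_cont (ac_prim gi).
have j1 : integrable01 (fun t => f t * cprim g t + cprim f t * g t).
  apply: integrable01D; first exact: integrable01M.
  by apply: integrable01_eq (integrable01M gi pf) => t _; rewrite mulrC.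
rewrite (@cprim_eq (fun t => f t * G t + F t * g t) (fun t => (G 0 * f t + F 0 * g t) +
    (f t * cprim g t + cprim f t * g t)) x x1); last first.
  move=> t t01; rewrite (Ff t t01) (Gg t t01) -!/(cprim _ t); ring.
rewrite cprimD//; last by apply: integrable01D; exact: integrable01Z.
rewrite cprim_prod// cprimD//; try exact: integrable01Z.
rewrite !cprimZ//; ring.
Qed.

Lemma ac_eq F G f : (forall t, 0 <= t <= 1 -> F t = G t) ->
  is_ac_derive01 F f -> is_ac_derive01 G f.
Proof.
move=> FG [fi Ff]; split => // x x01.
by rewrite -FG// (Ff x x01) FG// lexx ler01.
Qed.

Lemma ac_deriv_eq F f g : (forall t, 0 <= t <= 1 -> f t = g t) ->
  is_ac_derive01 F f -> is_ac_derive01 F g.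
Proof.
move=> fg [fi Ff]; split => [|x /[dup] x01 /andP[_ x1]]; first exact: integrable01_eq fi.
by rewrite (Ff x x01) -!/(cprim _ x) (cprim_eq x1 fg).
Qed.

Lemma acZ k F f : is_ac_derive01 F f ->
  is_ac_derive01 (fun t => k * F t) (fun t => k * f t).
Proof.
move=> aF; apply: ac_deriv_eq (acM (ac_cst k) aF) => t _.
by rewrite mul0r add0r.
Qed.

End complex_primitive.

(** * The Riemann-Lebesgue lemma with complex frequencies *)

Section riemann_lebesgue.
Context {R : realType}.
Notation mu := (@lebesgue_measure R).
Implicit Types (f g F G q : R -> R[i]) (h H : R -> R) (x : R) (k : R[i]).

Lemma is_derive_mull (a t : R) : is_derive t 1 (fun u : R => a * u) a.
Proof.
rewrite -[X in is_derive _ _ _ X]mulr1.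
exact: (@is_deriveZ R R R id a t 1 1 (is_derive_id t 1)).
Qed.

Lemma prim_deriv H h : (forall t : R, 0 <= t <= 1 -> is_derive t 1 H (h t)) ->
  cont01 h -> forall x, 0 <= x <= 1 -> H x = H 0 + prim h x.
Proof.
move=> dH ch x /andP[]; rewrite le_eqVlt => /predU1P[<- _|x0 x1].
  by rewrite prim0 addr0.
have cH : {in `[0, x], forall t, derivable H t 1}.
  move=> t; rewrite in_itv/= => /andP[t0 tx].
  by have := dH t; rewrite t0 (le_trans tx)// => /(_ isT)/@ex_derive.
rewrite /prim /Rintegral (@continuous_FTC2 _ h H)//.
- by rewrite -EFinB/= addrC subrK.
- by apply: continuous_subspaceW ch; apply: subset_itvl; rewrite bnd_simp.
- have /(continuous_within_itvP _ x0)[_ c0 cx] := derivable_within_continuous cH.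
  split => // t t0x; apply: cH; move: t0x; rewrite !in_itv/= => /andP[/ltW-> /ltW->].
  by [].
- move=> t; rewrite in_itv/= => /andP[t0 tx]; rewrite derive1E.
  have tt : 0 <= t <= 1 by rewrite (ltW t0)/= (le_trans (ltW tx)).
  by have := dH t tt; move=> d; rewrite derive_val.
Qed.

Lemma prim_cst (a x : R) : 0 <= x <= 1 -> prim (fun=> a) x = a * x.
Proof.
move=> x01; rewrite -[LHS]add0r -(mulr0 a); apply/esym.
apply: (@prim_deriv (fun u => a * u)) x01 => [t _|]; first exact: is_derive_mull.
exact: cont01_cst.
Qed.

Lemma Re_cexp k : Re (cexp k) = expR (Re k) * cos (Im k). Proof. by []. Qed.

Lemma Im_cexp k : Im (cexp k) = expR (Re k) * sin (Im k). Proof. by []. Qed.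

Lemma ac_cexp k : is_ac_derive01 (fun t => cexp (k * t%:C)) (fun t => k * cexp (k * t%:C)).
Proof.
case: k => a b.
have Rek t : Re ((a +i* b) * t%:C) = a * t by rewrite Re_mul/= mulr0 subr0.
have Imk t : Im ((a +i* b) * t%:C) = b * t by rewrite Im_mul/= mulr0 add0r.
have dexp (t : R) : is_derive t 1 (fun t : R => expR (a * t)) (a * expR (a * t)).
  have d1 := is_derive_mull a t.
  by rewrite mulrC; exact: (is_derive1_comp (f := expR) (g := fun t => a * t)).
have d1 (t : R) := is_derive_mull b t.
have dcos (t : R) : is_derive t 1 (fun t : R => cos (b * t)) (- sin (b * t) * b).
  exact: (is_derive1_comp (f := cos) (g := fun t => b * t)).
have dsin (t : R) : is_derive t 1 (fun t : R => sin (b * t)) (cos (b * t) * b).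
  exact: (is_derive1_comp (f := sin) (g := fun t => b * t)).
have cont_of (H h : R -> R) : (forall t : R, is_derive t 1 H (h t)) -> cont01 H.
  move=> dH; apply: continuous_cont01 => t.
  by have d := dH t; apply/differentiable_continuous/derivable1_diffP.
have cexpR := cont_of _ _ dexp; have ccos := cont_of _ _ dcos.
have csin := cont_of _ _ dsin.
have cc : contC (fun t => cexp ((a +i* b) * t%:C)).
  split.
    by apply: cont01_eq (cont01M cexpR ccos) => t _; rewrite Re_cexp Rek Imk.
  by apply: cont01_eq (cont01M cexpR csin) => t _; rewrite Im_cexp Rek Imk.
have ck : contC (fun t => (a +i* b) * cexp ((a +i* b) * t%:C)).
  by apply: contCM => //; exact: contC_cst.
split; first exact: contC_integrable01.
move=> x x01; apply: complex_eq; rewrite ?Re_add ?Im_add.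
  apply: (@prim_deriv (fun t => Re (cexp ((a +i* b) * t%:C)))
    (fun t => Re ((a +i* b) * cexp ((a +i* b) * t%:C)))) x01 => [t _|]; last exact: (proj1 ck).
  rewrite Re_mul Re_cexp Im_cexp Rek Imk.
  rewrite (_ : (fun t => _) = (fun t => expR (a * t)) * (fun t => cos (b * t))); last first.
    by apply/funext => u; rewrite Re_cexp Rek Imk.
  by apply: is_derive_eq; rewrite /GRing.scale /=; ring.
apply: (@prim_deriv (fun t => Im (cexp ((a +i* b) * t%:C)))
    (fun t => Im ((a +i* b) * cexp ((a +i* b) * t%:C)))) x01 => [t _|]; last exact: (proj2 ck).
rewrite Im_mul Re_cexp Im_cexp Rek Imk.
rewrite (_ : (fun t => _) = (fun t => expR (a * t)) * (fun t => sin (b * t))); last first.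
  by apply/funext => u; rewrite Im_cexp Rek Imk.
by apply: is_derive_eq; rewrite /GRing.scale /=; ring.
Qed.

(** Uniform continuity in a one-sided form, where [u] may exceed 1: this is what averages over
    [t, t + d] with t in [0, 1] require. *)
Lemma continuous_unif h (e : R) : continuous h -> 0 < e ->
  exists2 d : R, 0 < d < 1 & forall t u, 0 <= t <= 1 -> t <= u <= t + d -> `|h t - h u| <= e.
Proof.
move=> hc e0.
have /compact_near_coveringP := @segment_compact R 0 1.
move=> /(_ R (0^'+) (fun d t => forall u, t <= u <= t + d -> `|h t - h u| <= e)).
case.
  move=> t _; have e20 : 0 < e / 2 by rewrite divr_gt0.
  have /cvgrPdist_le/(_ _ e20)/nbhs_ballP[r /= r0 hr] := hc t.
  near=> t' d => u /= /andP[t'u ud].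
  have d0 : 0 < d by near: d; exact: nbhs_right_gt.
  have dr : d < r / 2 by near: d; apply: nbhs_right_lt; rewrite divr_gt0.
  have t'r : ball t (r / 2) t' by near: t'; apply: nbhsx_ballx; rewrite divr_gt0.
  move: t'r; rewrite /ball/= => t'r.
  rewrite -(subrKA (h t)) (le_trans (ler_normD _ _))// (splitr e) lerD//.
    rewrite distrC; apply: hr; rewrite /ball/=; lra.
  apply: hr; rewrite /ball/=; move: t'r; rewrite !ltr_distl => /andP[? ?].
  by apply/andP; split; lra.
move=> r /= r0 hr.
pose d := Num.min (r / 2) 2^-1.
have d0 : 0 < d by rewrite lt_min divr_gt0//= invr_gt0.
have dr : d < r by rewrite gt_min; apply/orP; left; lra.
exists d; first by rewrite d0 gt_min; apply/orP; right; lra.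
move=> t u t01 tu; apply: hr tu => //.
by rewrite /= sub0r normrN gtr0_norm.
Unshelve. all: by end_near. Qed.

(* Steklov averages [(G (t + d) - G t) / d] of a primitive [G] of [h]. *)
Lemma cont_approx_ac h (e : R) : continuous h -> 0 < e ->
  exists H dH : R -> R, [/\ integrableR01 dH, forall x, 0 <= x <= 1 -> H x = H 0 + prim dH x &
    forall t, 0 <= t <= 1 -> `|h t - H t| <= e].
Proof.
move=> hc e0; have [d /andP[d0 d1] hd] := continuous_unif hc e0.
(* The end points -1 and 3 keep [0, 1] and its translate by [d < 1] in the interior, so that [G] is
   differentiable on a neighbourhood of both. *)
pose G x := \int[mu]_(t in `[-1, x]) h t.
have dG (t : R) : -1 < t -> t < 3 -> is_derive t 1 G (h t).
  move=> t1 t3.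
  have [] := @continuous_FTC1_closed R h (-1) t 3 t3 _ t1 (hc t).
    apply: continuous_compact_integrable; first exact: segment_compact.
    exact: continuous_subspaceT.
  by move=> D E; apply: DeriveDef => //; rewrite -derive1E.
pose H t := d^-1 * (G (t + d) - G t).
pose dH t := d^-1 * (h (t + d) - h t).
have dHc : cont01 dH.
  apply: continuous_cont01 => t; apply: (@cvgM R); first exact: cvg_cst.
  apply: (@cvgB _ R^o); last exact: hc.
  apply: (@continuous_comp _ _ _ (fun t => t + d) h); last exact: hc.
  by apply: (@cvgD _ R^o); [exact: cvg_id|exact: cvg_cst].
exists H, dH; split; first exact: cont01_intR.
  apply: prim_deriv => // t /andP[t0 t1].
  have shift : is_derive t 1 (fun u : R => u + d) 1.
    by apply: is_derive_eq; rewrite addr0.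
  have dG1 := dG (t + d); have {dG1}dG1 : is_derive (t + d) 1 G (h (t + d)) by apply: dG1; lra.
  have dG2 : is_derive t 1 G (h t) by apply: dG; lra.
  have dG3 := is_derive1_comp (f := G) (g := fun u => u + d) dG1 shift.
  rewrite mulr1 in dG3.
  have := is_derive_mull d^-1 (G (t + d) - G t).
  move=> /(@is_derive1_comp _ _ (fun u : R => G (u + d) - G u) t)/(_ (is_deriveB dG3 dG2)).
  by [].
move=> t t01; have /andP[t0 t1] := t01.
(* By the mean value theorem [H t] is a value [h c] with c between t and t + d. *)
have [|||c] := @MVT R G h t (t + d).
- by rewrite ltrDl.
- by move=> u; rewrite in_itv/= => /andP[? ?]; apply: dG; lra.
- apply: derivable_within_continuous => u; rewrite in_itv/= => /andP[? ?].
  by apply: (@ex_derive _ _ _ _ _ _ (h u)); apply: dG; lra.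
rewrite in_itv/= => /andP[tc cd]; rewrite [t + d - t]addrC addKr => E.
rewrite /H E [h c * d]mulrC mulKf ?gt_eqF//.
by apply: hd => //; rewrite (ltW tc) (ltW cd).
Qed.

Lemma integrableR01_approx_ac h (e : R) : integrableR01 h -> 0 < e ->
  exists H dH : R -> R, [/\ integrableR01 dH, forall x, 0 <= x <= 1 -> H x = H 0 + prim dH x &
    prim (fun t => `|h t - H t|) 1 <= e].
Proof.
move=> hi e0; have e20 : 0 < e / 2 by rewrite divr_gt0.
have [g gc hg] := integrableR01_approx hi e20.
have [H [dH [dHi HE gH]]] := cont_approx_ac gc e20.
exists H, dH; split => //.
have gi := cont01_intR (continuous_cont01 gc).
have Hi : integrableR01 H.
  apply: cont01_intR; apply: cont01_eq (cont01D (@cont01_cst R (H 0)) (prim_cont dHi)) => t t01.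
  by rewrite [in RHS](HE t t01).
have ci : integrableR01 (fun=> e / 2 : R) by apply: cont01_intR; exact: cont01_cst.
have hgi : integrableR01 (fun t => `|h t - g t|) by apply: integrableR01_norm;
  exact: integrableR01B.
apply: le_trans (_ : prim (fun t => `|h t - g t| + e / 2) 1 <= _).
  apply: le_prim => //; first by apply: integrableR01_norm; exact: integrableR01B.
    exact: integrableR01D.
  move=> t t01; rewrite -(subrKA (g t)); apply: le_trans (ler_normD _ _) _.
  by rewrite lerD2l gH.
rewrite primD// [leRHS]splitr lerD//.
by rewrite prim_cst ?mulr1 ?ler01 ?lexx.
Qed.

Lemma integrable01_approx_ac q (e : R) : integrable01 q -> 0 < e ->
  exists F f, is_ac_derive01 F f /\ prim (fun t => normc (q t - F t)) 1 <= e.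
Proof.
move=> [qr qi] e0; have e20 : 0 < e / 2 by rewrite divr_gt0.
have [H1 [h1 [h1i H1E d1]]] := integrableR01_approx_ac qr e20.
have [H2 [h2 [h2i H2E d2]]] := integrableR01_approx_ac qi e20.
pose F t := H1 t +i* H2 t; pose f t := h1 t +i* h2 t.
have aF : is_ac_derive01 F f.
  split; first by split.
  by move=> x x01; apply: complex_eq; rewrite ?Re_add ?Im_add; [exact: H1E|exact: H2E].
exists F, f; split => //.
have [Fr Fi] : integrable01 F by apply: contC_integrable01; exact: ac_cont aF.
have i1 : integrableR01 (fun t => `|Re (q t) - H1 t|) by apply: integrableR01_norm;
  exact: integrableR01B.
have i2 : integrableR01 (fun t => `|Im (q t) - H2 t|) by apply: integrableR01_norm;
  exact: integrableR01B.
apply: le_trans (_ : prim (fun t => `|Re (q t) - H1 t| + `|Im (q t) - H2 t|) 1 <= _).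
  apply: le_prim => //; last first.
  - move=> t _; apply: le_trans (normc_le_ReIm _) _.
    by rewrite Re_add Im_add Re_opp Im_opp.
  - exact: integrableR01D.
  - by apply/integrable01_normc/integrable01B.
by rewrite primD// [leRHS]splitr lerD.
Qed.

(** Integration by parts against the exponential. Only its bound by 1 on [0, x] enters, so [M]
    serves all complex frequencies [k], whether they oscillate or decay. The offset [k0] may depend
    on [x], as needed for the kernel e^(i mu (x - t)). *)
Lemma RL_ac F f : is_ac_derive01 F f -> exists2 M, 0 < M & forall k k0 x, 0 <= x <= 1 ->
  (forall t, 0 <= t <= x -> normc (cexp (k0 + k * t%:C)) <= 1) ->
  normc k * normc (cprim (fun t => F t * cexp (k0 + k * t%:C)) x) <= M.
Proof.
move=> aF; have [fi _] := aF; have cF := ac_cont aF.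
have [M M0 FM] := cont01_bounded (contC_normc cF).
have nfi := integrable01_normc fi.
have nf0 : 0 <= prim (fun t => normc (f t)) 1 by apply: prim_ge0 => t _; exact: normc_ge0.
exists (M + M + prim (fun t => normc (f t)) 1).
  by rewrite ltr_wpDr// addr_gt0.
move=> k k0 x /[dup] x01 /andP[x0 x1] e1; pose E t := cexp (k0 + k * t%:C).
have aE : is_ac_derive01 E (fun t => k * E t).
  have EE t : cexp k0 * cexp (k * t%:C) = E t by rewrite -cexpD.
  have := acZ (cexp k0) (ac_cexp k).
  move/(ac_eq (fun t _ => EE t)); apply: ac_deriv_eq => t _.
  by rewrite mulrCA EE.
have cE := ac_cont aE.
have [_ h] := acM aF aE.
have fEi : integrable01 (fun t => f t * E t) by exact: integrable01M.
have FEi : integrable01 (fun t => F t * E t) by apply: contC_integrable01; exact: contCM.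
have := h x x01; rewrite -/(cprim _ x).
rewrite (@cprim_eq _ _ (fun t => f t * E t + k * (F t * E t)) x x1); last first.
  by move=> t _; rewrite [F t * _]mulrCA.
rewrite cprimD//; last exact: integrable01Z.
rewrite cprimZ// => {}h.
have -> : cprim (fun t => F t * cexp (k0 + k * t%:C)) x = cprim (fun t => F t * E t) x by [].
rewrite -Normc.normcM.
have -> : k * cprim (fun t => F t * E t) x =
    F x * E x - F 0 * E 0 - cprim (fun t => f t * E t) x by rewrite h; ring.
have FE t : 0 <= t <= x -> normc (F t * E t) <= M.
  move=> /andP[t0 tx]; rewrite Normc.normcM -[leRHS]mulr1.
  have := FM t; rewrite (ger0_norm (normc_ge0 _)) t0 (le_trans tx)// => /(_ isT) FMt.
  by apply: ler_pM => //; [exact: normc_ge0..|apply: e1; rewrite t0].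
apply: le_trans (le_normcB _ _) _; apply: lerD.
  apply: le_trans (le_normcB _ _) _; apply: lerD; apply: FE.
    by rewrite x0 lexx.
  by rewrite lexx x0.
apply: le_trans (normc_cprim fEi x1) _.
apply: le_trans (_ : prim (fun t => normc (f t)) x <= _).
  apply: le_prim => //; first exact: integrable01_normc.
  move=> t tx; rewrite Normc.normcM -[leRHS]mulr1.
  by apply: ler_wpM2l; [exact: normc_ge0|exact: e1].
by apply: prim_le => // t _; exact: normc_ge0.
Qed.

Lemma riemann_lebesgue q (e : R) : integrable01 q -> 0 < e ->
  exists2 M, 0 < M & forall k k0 x, 0 <= x <= 1 ->
    (forall t, 0 <= t <= x -> normc (cexp (k0 + k * t%:C)) <= 1) ->
    M <= normc k ->
    normc (cprim (fun t => q t * cexp (k0 + k * t%:C)) x) <= e.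
Proof.
move=> qi e0; have e20 : 0 < e / 2 by rewrite divr_gt0.
have [F [f [aF qF]]] := integrable01_approx_ac qi e20.
have [M M0 FM] := RL_ac aF.
exists (M / (e / 2)); first by rewrite divr_gt0.
move=> k k0 x /[dup] x01 /andP[x0 x1] e1 Mk.
pose E t := cexp (k0 + k * t%:C).
have cE : contC E.
  have EE t : cexp k0 * cexp (k * t%:C) = E t by rewrite -cexpD.
  have := acZ (cexp k0) (ac_cexp k).
  by move/(ac_eq (fun t _ => EE t))/ac_cont.
have Fi : integrable01 F by apply: contC_integrable01; exact: ac_cont aF.
have FEi : integrable01 (fun t => F t * E t) by exact: integrable01M.
have dEi : integrable01 (fun t => (q t - F t) * E t).
  by apply: integrable01M => //; exact: integrable01B.
rewrite (@cprim_eq _ _ (fun t => (q t - F t) * E t + F t * E t) x x1); last first.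
  by move=> t _; rewrite -mulrDl subrK.
rewrite cprimD// [leRHS]splitr; apply: le_trans (le_normcD _ _) _; apply: lerD.
  apply: le_trans (normc_cprim dEi x1) _; apply: le_trans qF.
  have ni : integrableR01 (fun t => normc (q t - F t))
    by apply/integrable01_normc/integrable01B.
  apply: le_trans (_ : prim (fun t => normc (q t - F t)) x <= _).
    apply: le_prim => //; first exact: integrable01_normc.
    move=> t tx; rewrite Normc.normcM -[leRHS]mulr1.
    by apply: ler_wpM2l; [exact: normc_ge0|exact: e1].
  by apply: prim_le => // t _; exact: normc_ge0.
have k0' : 0 < normc k by apply: lt_le_trans Mk; rewrite divr_gt0.
rewrite -(ler_pM2l k0'); apply: le_trans (FM k k0 x x01 e1) _.
by rewrite -ler_pdivrMr.
Qed.

End riemann_lebesgue.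

(** * Asymptotics of the Dirac system *)

Section linear_system.
Context {R : realType}.
Implicit Types (p q y z D : R -> R[i]) (x : R) (k mu lam : R[i]).

Lemma Re_iM k x : Re ('i * k * x%:C) = - (Im k * x).
Proof. by case: k => a b /=; ring. Qed.

Lemma normc_i : normc ('i : R[i]) = 1.
Proof. by rewrite /= expr0n/= expr1n add0r sqrtr1. Qed.

Lemma normc_cexp_le1 k : Re k <= 0 -> normc (cexp k) <= 1.
Proof. by move=> k0; rewrite normc_cexp -(expR0 R) ler_expR. Qed.

Lemma ac_exp_lin k0 k :
  is_ac_derive01 (fun t => cexp (k0 + k * t%:C)) (fun t => k * cexp (k0 + k * t%:C)).
Proof.
have EE (t : R) : cexp k0 * cexp (k * t%:C) = cexp (k0 + k * t%:C) by rewrite -cexpD.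
have := acZ (cexp k0) (ac_cexp k).
move/(ac_eq (fun t _ => EE t)); apply: ac_deriv_eq => t _.
by rewrite mulrCA EE.
Qed.

Lemma ac_integrating_factor k y (g : R -> R[i]) :
  is_ac_derive01 y (fun t => k * y t + g t) ->
  is_ac_derive01 (fun t => cexp (- k * t%:C) * y t) (fun t => cexp (- k * t%:C) * g t).
Proof.
by move=> ay; apply: ac_deriv_eq (acM (ac_cexp (- k)) ay) => t _; ring.
Qed.

Lemma ac_linear k D : is_ac_derive01 D (fun t => k * D t) ->
  forall x, 0 <= x <= 1 -> D x = cexp (k * x%:C) * D 0.
Proof.
move=> aD x x01.
have /ac_integrating_factor[_ /(_ x x01)] : is_ac_derive01 D (fun t => k * D t + (fun=> 0) t).
  by apply: ac_deriv_eq aD => t _; rewrite addr0.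
have [_ /(_ x x01)/esym] := ac_cst (0 : R[i]).
rewrite add0r => h.
have -> : cintegral `[0, x] (fun t => cexp (- k * t%:C) * 0) = 0.
  by rewrite -[RHS]h; congr cintegral; apply/funext => t; rewrite mulr0.
rewrite mulr0 cexp0 mul1r addr0 => <-.
by rewrite mulrA -cexpD -mulrDl subrr mul0r cexp0 mul1r.
Qed.

(** The quantities estimated are the deviations from the solution of the system with p = q = 0. By
    variation of constants each deviation is an oscillating integral, of size at most [e], plus an
    integral of the other deviation against |p| or |q|. Gronwall's inequality is applied to the sum
    of their moduli, whence the bound 2e for the free term. *)
Lemma system_estimate (rho : R) : 0 <= rho -> exists2 K, 0 < K &
  forall mu p q z1 z2 (e : R), 0 <= Im mu -> 0 <= e ->
    integrable01 p -> integrable01 q ->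
    prim (fun t => normc (p t) + normc (q t)) 1 <= rho ->
    is_ac_derive01 z1 (fun t => p t * z2 t) ->
    is_ac_derive01 z2 (fun t => 'i * mu * z2 t + q t * z1 t) ->
    normc (z1 0) <= 1 -> normc (z2 0) <= 1 ->
    (forall x, 0 <= x <= 1 ->
      normc (cprim (fun t => p t * cexp (0 + 'i * mu * t%:C)) x) <= e /\
      normc (cprim (fun t => q t * cexp ('i * mu * x%:C + - ('i * mu) * t%:C)) x) <= e) ->
    forall x, 0 <= x <= 1 ->
      normc (z1 x - z1 0) + normc (z2 x - cexp ('i * mu * x%:C) * z2 0) <= K * e.
Proof.
move=> rho0; have [K K0 HK] := gronwall rho0.
exists (K * 2); first by rewrite mulr_gt0.
move=> mu p q z1 z2 e mu0 e0 pi qi pq a1 a2 n1 n2 He.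
pose v t := z1 t - z1 0; pose w t := z2 t - cexp ('i * mu * t%:C) * z2 0.
have cz1 := ac_cont a1; have cz2 := ac_cont a2.
have av : is_ac_derive01 v (fun t => p t * z2 t).
  by apply: ac_deriv_eq (acD a1 (ac_cst (- z1 0))) => t _; rewrite addr0.
have cv := ac_cont av.
have aw : is_ac_derive01 w (fun t => 'i * mu * w t + q t * z1 t).
  have := acD a2 (acZ (- z2 0) (ac_cexp ('i * mu))).
  have E0 t : z2 t + - z2 0 * cexp ('i * mu * t%:C) = w t.
    by rewrite /w mulNr mulrC.
  move/(ac_eq (fun t _ => E0 t)); apply: ac_deriv_eq => t _.
  by rewrite /w; ring.
have cw := ac_cont aw.
pose r t := normc (p t) + normc (q t).
have np := integrable01_normc pi; have nq := integrable01_normc qi.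
have ri : integrableR01 r by exact: integrableR01D.
pose W t := normc (v t) + normc (w t).
have cnv := contC_normc cv; have cnw := contC_normc cw.
have cW : cont01 W by exact: cont01D.
move=> x x01; rewrite -/(v x) -/(w x) -/(W x) -mulrA.
apply: (HK r W (2 * e)) => //.
- by move=> t _; rewrite addr_ge0// normc_ge0.
- by rewrite mulr_ge0.
move=> {x01}x /[dup] x01 /andP[x0 x1]; have [He1 He2] := He x x01.
have cE : contC (fun t => cexp (0 + 'i * mu * t%:C)) by exact: ac_cont (ac_exp_lin _ _).
pose ex t := cexp ('i * mu * x%:C + - ('i * mu) * t%:C).
have cex : contC ex by exact: ac_cont (ac_exp_lin _ _).
have vE : v x = cprim (fun t => p t * w t) x + z2 0 * cprim (fun t =>
  p t * cexp (0 + 'i * mu * t%:C)) x.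
  have [_ /(_ x x01)] := a1; rewrite -/(cprim _ x) /v => ->.
  rewrite addrC addKr -cprimZ//; last exact: integrable01M.
  rewrite -cprimD//; [|exact: integrable01M|by apply: integrable01Z; exact: integrable01M].
  by apply: cprim_eq => // t _; rewrite /w add0r; ring.
have wE : w x = cprim (fun t => q t * v t * ex t) x + z1 0 * cprim (fun t => q t * ex t) x.
  have [_ /(_ x x01)] := ac_integrating_factor aw; rewrite -/(cprim _ x).
  have -> : w 0 = 0 by rewrite /w mulr0 cexp0 mul1r subrr.
  rewrite mulr0 add0r => /(congr1 (fun u => cexp ('i * mu * x%:C) * u)).
  rewrite mulrA -cexpD mulNr subrr cexp0 mul1r => ->.
  rewrite -!cprimZ//; [|by apply: integrable01M|]; last first.
    apply: (@integrable01_eq _ (fun t => q t * (z1 t * cexp (- ('i * mu) * t%:C)))).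
      by move=> t _; ring.
    apply: integrable01M => //; apply: contCM => //; exact: ac_cont (ac_cexp _).
  rewrite -cprimD//; [|by apply: integrable01M => //;
    exact: integrable01M|by apply: integrable01Z; exact: integrable01M].
  by apply: cprim_eq => // t _; rewrite /v /ex cexpD; ring.
have ex1 t : 0 <= t <= x -> normc (ex t) <= 1.
  move=> /andP[t0 tx]; apply: normc_cexp_le1.
  rewrite mulNr Re_add Re_opp !Re_iM; nra.
have i1 : integrable01 (fun t => p t * w t) by exact: integrable01M.
have i2 : integrable01 (fun t => q t * v t * ex t) by apply: integrable01M => //;
  exact: integrable01M.
have m1 : normc (v x) <= e + prim (fun t => normc (p t) * normc (w t)) x.
  rewrite vE addrC; apply: le_trans (le_normcD _ _) _; apply: lerD.
    rewrite Normc.normcM -[leRHS]mul1r; apply: ler_pM => //; exact: normc_ge0.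
  apply: le_trans (normc_cprim i1 x1) _; apply: le_prim => //.
  - exact: integrable01_normc.
  - exact: integrableR01M.
  - by move=> t _; rewrite Normc.normcM.
have m2 : normc (w x) <= e + prim (fun t => normc (q t) * normc (v t)) x.
  rewrite wE addrC; apply: le_trans (le_normcD _ _) _; apply: lerD.
    rewrite Normc.normcM -[leRHS]mul1r; apply: ler_pM => //; exact: normc_ge0.
  apply: le_trans (normc_cprim i2 x1) _; apply: le_prim => //.
  - exact: integrable01_normc.
  - exact: integrableR01M.
  - move=> t tx; rewrite !Normc.normcM -[leRHS]mulr1; apply: ler_wpM2l; last exact: ex1.
    by rewrite mulr_ge0// normc_ge0.
apply: le_trans (lerD m1 m2) _.
rewrite addrACA -primD//; [|exact: integrableR01M..].
have -> : e + e = 2 * e by ring.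
rewrite lerD2l; apply: le_prim => //.
- by apply: integrableR01D; exact: integrableR01M.
- exact: integrableR01M.
move=> t _; rewrite /r /W.
have := normc_ge0 (p t); have := normc_ge0 (q t).
have := normc_ge0 (v t); have := normc_ge0 (w t); nra.
Qed.

(** Liouville's formula: the matrix of the system has constant trace [mu]. *)
Lemma system_wronskian mu p q y1 y2 z1 z2 :
  is_ac_derive01 y1 (fun t => p t * y2 t) ->
  is_ac_derive01 y2 (fun t => mu * y2 t + q t * y1 t) ->
  is_ac_derive01 z1 (fun t => p t * z2 t) ->
  is_ac_derive01 z2 (fun t => mu * z2 t + q t * z1 t) ->
  forall x, 0 <= x <= 1 ->
    y1 x * z2 x - y2 x * z1 x = cexp (mu * x%:C) * (y1 0 * z2 0 - y2 0 * z1 0).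
Proof.
move=> ay1 ay2 az1 az2.
apply: (ac_linear (D := fun t => y1 t * z2 t - y2 t * z1 t)).
have := acD (acM ay1 az2) (acZ (-1) (acM ay2 az1)).
have E0 t : y1 t * z2 t + -1 * (y2 t * z1 t) = y1 t * z2 t - y2 t * z1 t.
  by rewrite mulN1r.
move/(ac_eq (fun t _ => E0 t)); apply: ac_deriv_eq => t _.
by ring.
Qed.

End linear_system.

Section dirac.
Context {R : realType}.
Notation mu := (@lebesgue_measure R).
Implicit Types (Q : potential R) (lam : R[i]) (b c : R).

(** The derivative supplied by [dirac_solution] satisfies the equation only almost everywhere; this
    replaces it by the right-hand side of the system, after which all identities hold pointwise. *)
Lemma ac_ae (F f g : R -> R[i]) : is_ac_derive01 F f -> integrable01 g ->
  {ae mu, forall t, 0 <= t <= 1 -> f t = g t} -> is_ac_derive01 F g.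
Proof.
move=> [[fr fi] Ff] /[dup] ig [gr gi] fg; split => // x /[dup] x01 /andP[x0 x1].
have ae_prim (h h' : R -> R) : integrableR01 h -> integrableR01 h' ->
    {ae mu, forall t, 0 <= t <= 1 -> h t = h' t} -> prim h x = prim h' x.
  move=> hi h'i hh'; congr fine; apply: ae_eq_integral => //.
  - exact: measurable_int (integrableR01_sub hi x1).
  - exact: measurable_int (integrableR01_sub h'i x1).
  - apply: (@filterS _ _ (ae_filter_ringOfSetsType mu) _ _ _ hh') => t ht /=;
    rewrite in_itv/= => /andP[t0 tx].
    by rewrite ht// t0 (le_trans tx).
rewrite (Ff x x01); congr (_ + _); apply: complex_eq.
  apply: (ae_prim (fun t => Re (f t)) (fun t => Re (g t))) => //.
  by apply: (@filterS _ _ (ae_filter_ringOfSetsType mu) _ _ _ fg) => t ht t01; rewrite ht.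
apply: (ae_prim (fun t => Im (f t)) (fun t => Im (g t))) => //.
by apply: (@filterS _ _ (ae_filter_ringOfSetsType mu) _ _ _ fg) => t ht t01; rewrite ht.
Qed.

Lemma Bmx_unit (b1 b2 : R) : b1 != 0 -> b2 != 0 -> Bmx b1 b2 \in unitmx.
Proof.
move=> b10 b20; rewrite unitmxE det_diag big_ord_recl big_ord1 !mxE/= unitfE.
by rewrite -rmorphM fmorph_eq0 mulf_neq0.
Qed.

Lemma dirac_pointwise (b1 b2 : R) Q lam (y y' : 'cV[R[i]]_2) t :
  b1 != 0 -> b2 != 0 ->
  - 'i *: (invmx (Bmx b1 b2) *m y') + potmx Q t *m y = lam *: y ->
  y' 0 0 = 'i * lam * b1%:C * y 0 0 + - ('i * b1%:C * pot12 Q t) * y 1 0 /\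
  y' 1 0 = 'i * lam * b2%:C * y 1 0 + - ('i * b2%:C * pot21 Q t) * y 0 0.
Proof.
move=> b10 b20 h; have uB := Bmx_unit b10 b20.
have ii : ('i * 'i : R[i]) = -1 by rewrite -expr2 sqr_i.
have : y' = 'i *: (Bmx b1 b2 *m (lam *: y - potmx Q t *m y)).
  rewrite -h addrK -scalemxAr scalerA mulrN ii opprK scale1r.
  by rewrite mulmxA mulmxV// mul1mx.
rewrite /Bmx mul_diag_mx => /matrixP E; split; rewrite E !mxE big_ord_recl big_ord1 !mxE/=.
  rewrite (_ : lift ord0 ord0 = 1)/=; last exact/val_inj.
  by rewrite mul0r add0r; ring.
rewrite (_ : lift ord0 ord0 = 1)/=; last exact/val_inj.
by rewrite mul0r addr0; ring.
Qed.

Lemma dirac_system (b1 b2 : R) Q lam (y : R -> 'cV[R[i]]_2) :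
  b1 != 0 -> b2 != 0 -> dirac_solution b1 b2 Q lam y ->
  is_ac_derive01 (fun t => y t 0 0)
    (fun t => 'i * lam * b1%:C * y t 0 0 + - ('i * b1%:C * pot12 Q t) * y t 1 0) /\
  is_ac_derive01 (fun t => y t 1 0)
    (fun t => 'i * lam * b2%:C * y t 1 0 + - ('i * b2%:C * pot21 Q t) * y t 0 0).
Proof.
move=> b10 b20 [y' [ay ae]].
have c0 := ac_cont (ay 0); have c1 := ac_cont (ay 1).
have i12 := pot12_L1 Q; have i21 := pot21_L1 Q.
split; [apply: (ac_ae (ay 0))|apply: (ac_ae (ay 1))].
- apply: integrable01D; first by apply: integrable01Z; exact: contC_integrable01.
  apply: integrable01M => //; apply: integrable01_eq (integrable01Z (- ('i * b1%:C)) i12) =>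
    t _.
  by rewrite mulNr.
- by apply: (@filterS _ _ (ae_filter_ringOfSetsType mu) _ _ _ ae) =>
  t ht /ht /(dirac_pointwise b10 b20)[].
- apply: integrable01D; first by apply: integrable01Z; exact: contC_integrable01.
  apply: integrable01M => //; apply: integrable01_eq (integrable01Z (- ('i * b2%:C)) i21) =>
    t _.
  by rewrite mulNr.
- by apply: (@filterS _ _ (ae_filter_ringOfSetsType mu) _ _ _ ae) =>
  t ht /ht /(dirac_pointwise b10 b20)[].
Qed.

(* After the substitution [z_j t = e^(- i c1 lam t) y_j t] the system has only
   the bounded exponentials [e^(i (c2 - c1) lam t)]. *)
Lemma gauge c1 c2 lam (p q y1 y2 : R -> R[i]) :
  is_ac_derive01 y1 (fun t => 'i * lam * c1%:C * y1 t + p t * y2 t) ->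
  is_ac_derive01 y2 (fun t => 'i * lam * c2%:C * y2 t + q t * y1 t) ->
  let g t := cexp (- ('i * lam * c1%:C) * t%:C) in
  is_ac_derive01 (fun t => g t * y1 t) (fun t => p t * (g t * y2 t)) /\
  is_ac_derive01 (fun t => g t * y2 t)
    (fun t => 'i * ((c2 - c1)%:C * lam) * (g t * y2 t) + q t * (g t * y1 t)).
Proof.
move=> a1 a2 g; split.
  apply: ac_deriv_eq (acM (ac_cexp (- ('i * lam * c1%:C))) a1) => t _.
  by rewrite -/(g t); ring.
apply: ac_deriv_eq (acM (ac_cexp (- ('i * lam * c1%:C))) a2) => t _.
by rewrite -/(g t) rmorphB/=; ring.
Qed.

End dirac.

Section determinant_estimate.
Context {R : realType}.
Notation mu := (@lebesgue_measure R).
Implicit Types (Q : potential R) (lam : R[i]).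

(** Undoing the gauge multiplies the error by e^(- c1 Im lam), which is the larger of the two
    exponentials because [(c2 - c1) * Im lam] is nonnegative. The hypothesis on oscillating
    integrals mentions only the modulus of [k], so it covers the frequencies i mu and - i mu at
    once. *)
Lemma system_estimate1 (rho : R) : 0 <= rho -> exists2 K, 0 < K &
  forall (c1 c2 : R) lam (p q y1 y2 : R -> R[i]) (e : R),
    0 <= (c2 - c1) * Im lam -> 0 <= e ->
    integrable01 p -> integrable01 q ->
    prim (fun t => normc (p t) + normc (q t)) 1 <= rho ->
    is_ac_derive01 y1 (fun t => 'i * lam * c1%:C * y1 t + p t * y2 t) ->
    is_ac_derive01 y2 (fun t => 'i * lam * c2%:C * y2 t + q t * y1 t) ->
    normc (y1 0) <= 1 -> normc (y2 0) <= 1 ->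
    (forall k k0 x, 0 <= x <= 1 ->
      (forall t, 0 <= t <= x -> normc (cexp (k0 + k * t%:C)) <= 1) ->
      normc k = normc ((c2 - c1)%:C * lam) ->
      normc (cprim (fun t => p t * cexp (k0 + k * t%:C)) x) <= e /\
      normc (cprim (fun t => q t * cexp (k0 + k * t%:C)) x) <= e) ->
    normc (y1 1 - cexp ('i * lam * c1%:C) * y1 0) <= K * e * expR (- c1 * Im lam) /\
    normc (y2 1 - cexp ('i * lam * c2%:C) * y2 0) <= K * e * expR (- c1 * Im lam).
Proof.
move=> rho0; have [K K0 HK] := system_estimate rho0.
exists K => // c1 c2 lam p q y1 y2 e m0 e0 pi qi pq a1 a2 n1 n2 RL.
have [z1 z2] := gauge a1 a2.
pose g (t : R) := cexp (- ('i * lam * c1%:C) * t%:C).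
have g0 : g 0 = 1 by rewrite /g mulr0 cexp0.
have ik (k : R[i]) : normc ('i * k) = normc k by rewrite Normc.normcM normc_i mul1r.
have ImM : Im ((c2 - c1)%:C * lam) = (c2 - c1) * Im lam.
  by rewrite Im_mul/= mul0r addr0.
have := HK ((c2 - c1)%:C * lam) p q _ _ e _ e0 pi qi pq z1 z2.
rewrite -/(g 0) g0 !mul1r ImM => /(_ m0 n1 n2) H.
have {H} : normc (g 1 * y1 1 - y1 0) + normc (g 1 * y2 1 - cexp ('i * ((c2 - c1)%:C * lam)) *
  y2 0) <= K * e.
  rewrite -[X in cexp X * y2 0]mulr1; apply: (H _ 1); last by rewrite lexx ler01.
  move=> x /[dup] x01 /andP[x0 x1]; split.
    apply: (proj1 (RL _ _ x x01 _ _)); last by rewrite ik.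
    move=> t /andP[t0 _]; apply: normc_cexp_le1.
    rewrite add0r Re_iM ImM; nra.
  apply: (proj2 (RL _ _ x x01 _ _)); last by rewrite normcN ik.
  move=> t /andP[t0 tx]; apply: normc_cexp_le1.
  rewrite mulNr Re_add Re_opp !Re_iM ImM; nra.
have gE : cexp ('i * lam * c1%:C) * g 1 = 1.
  by rewrite /g -cexpD mulr1 subrr cexp0.
have nE : normc (cexp ('i * lam * c1%:C)) = expR (- c1 * Im lam).
  by rewrite normc_cexp Re_iM mulNr [c1 * _]mulrC.
move=> H; split.
  have -> : y1 1 - cexp ('i * lam * c1%:C) * y1 0 =
      cexp ('i * lam * c1%:C) * (g 1 * y1 1 - y1 0).
    by rewrite mulrBr mulrA gE mul1r.
  rewrite Normc.normcM nE mulrC ler_wpM2r ?expR_ge0//.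
  by apply: le_trans H; rewrite lerDl normc_ge0.
have -> : y2 1 - cexp ('i * lam * c2%:C) * y2 0 =
    cexp ('i * lam * c1%:C) * (g 1 * y2 1 - cexp ('i * ((c2 - c1)%:C * lam)) * y2 0).
  rewrite mulrBr mulrA gE mul1r mulrA -cexpD; congr (_ - cexp _ * _).
  by rewrite rmorphB/=; ring.
rewrite Normc.normcM nE mulrC ler_wpM2r ?expR_ge0//.
by apply: le_trans H; rewrite lerDr normc_ge0.
Qed.

(** An exact value is required for the term of the determinant with J_34: bounds on the separate
    entries would only control it up to the square of [growth]. *)
Lemma fundamental_det (c1 c2 : R) lam (p q y1 y2 z1 z2 : R -> R[i]) :
  is_ac_derive01 y1 (fun t => 'i * lam * c1%:C * y1 t + p t * y2 t) ->
  is_ac_derive01 y2 (fun t => 'i * lam * c2%:C * y2 t + q t * y1 t) ->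
  is_ac_derive01 z1 (fun t => 'i * lam * c1%:C * z1 t + p t * z2 t) ->
  is_ac_derive01 z2 (fun t => 'i * lam * c2%:C * z2 t + q t * z1 t) ->
  y1 1 * z2 1 - y2 1 * z1 1 =
  cexp ('i * lam * (c1 + c2)%:C) * (y1 0 * z2 0 - y2 0 * z1 0).
Proof.
move=> a1 a2 a3 a4.
have [b1 b2] := gauge a1 a2; have [b3 b4] := gauge a3 a4.
have /= := system_wronskian b1 b2 b3 b4 (x := 1).
rewrite ler01 lexx => /(_ isT).
set g1 := cexp (- ('i * lam * c1%:C) * 1); rewrite mulr0 cexp0 !mul1r.
have gE : cexp ('i * lam * c1%:C) * g1 = 1.
  by rewrite /g1 -cexpD mulr1 subrr cexp0.
move=> h.
have -> : y1 1 * z2 1 - y2 1 * z1 1 = cexp ('i * lam * c1%:C) * cexp ('i * lam * c1%:C) *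
   (g1 * y1 1 * (g1 * z2 1) - g1 * y2 1 * (g1 * z1 1)).
  transitivity ((cexp ('i * lam * c1%:C) * g1) * (cexp ('i * lam * c1%:C) * g1) * (y1 1 * z2
    1 - y2 1 * z1 1)).
    by rewrite gE !mul1r.
  by ring.
rewrite h mulrA -!cexpD; congr (cexp _ * _).
by rewrite rmorphB rmorphD/=; ring.
Qed.

Lemma det2E (M : 'M[R[i]]_2) : \det M = M 0 0 * M 1 1 - M 0 1 * M 1 0.
Proof.
rewrite (expand_det_row _ 0) big_ord_recl big_ord1 /cofactor !det_mx11 !mxE/=.
have l1 : lift ord0 (ord0 : 'I_1) = 1 :> 'I_2 by exact/val_inj.
have l0 : lift (1 : 'I_2) (ord0 : 'I_1) = 0 by exact/val_inj.
have -> : lift (0 : 'I_2) (0 : 'I_1) = 1 by exact: l1.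
have -> : lift (1 : 'I_2) (0 : 'I_1) = 0 by exact: l0.
by rewrite -[ord0]/(0 : 'I_2) /bump/= expr0 expr1; ring.
Qed.

Lemma bc_minorE (A : 'M[R[i]]_(2, 4)) j k : bc_minor A j k = A 0 j * A 1 k - A 0 k * A 1 j.
Proof. by rewrite /bc_minor det2E !mxE. Qed.

Lemma char_detE (A : 'M[R[i]]_(2, 4)) Phi lam : Phi lam 0 = 1%:M ->
  let F := Phi lam 1 in
  char_det A Phi lam = bc_minor A 0 1
    + bc_minor A 2%:R 3%:R * (F 0 0 * F 1 1 - F 1 0 * F 0 1)
    + bc_minor A 2%:R 1 * F 0 0 + bc_minor A 0 3%:R * F 1 1
    + bc_minor A 0 2%:R * F 0 1 + bc_minor A 3%:R 1 * F 1 0.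
Proof.
move=> P0 F; rewrite /char_det det2E !mxE /bc_form !mxE P0 !mxE/= -/F !bc_minorE.
ring.
Qed.

End determinant_estimate.

(** * Comparison of the characteristic determinants, uniformly on compact sets *)

Section perturbation.
Context {R : realType}.
Notation mu := (@lebesgue_measure R).
Implicit Types (Q : potential R) (lam : R[i]) (q : R -> R[i]).

(** The exponential has modulus at most 1 on [0, x], so replacing [q] by an L1-close [q'] costs at
    most e/2 at every frequency, and the threshold [M] of [q] remains valid. *)
Lemma riemann_lebesgue_local q (e : R) : integrable01 q -> 0 < e ->
  exists2 M, 0 < M & forall q', integrable01 q' ->
    prim (fun t => normc (q t - q' t)) 1 <= e / 2 ->
    forall k k0 x, 0 <= x <= 1 ->
    (forall t, 0 <= t <= x -> normc (cexp (k0 + k * t%:C)) <= 1) ->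
    M <= normc k ->
    normc (cprim (fun t => q' t * cexp (k0 + k * t%:C)) x) <= e.
Proof.
move=> qi e0; have e20 : 0 < e / 2 by rewrite divr_gt0.
have [M M0 HM] := riemann_lebesgue qi e20.
exists M => // q' q'i qq' k k0 x /[dup] x01 /andP[x0 x1] e1 Mk.
have cE : contC (fun t => cexp (k0 + k * t%:C)) by exact: ac_cont (ac_exp_lin _ _).
have dEi : integrable01 (fun t => (q t - q' t) * cexp (k0 + k * t%:C)).
  by apply: integrable01M => //; exact: integrable01B.
have qEi : integrable01 (fun t => q t * cexp (k0 + k * t%:C)) by exact: integrable01M.
rewrite (@cprim_eq _ _ (fun t => q t * cexp (k0 + k * t%:C) - (q t - q' t) * cexp (k0 +
  k * t%:C)) x x1); last first.
  by move=> t _; rewrite -mulrBl subKr.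
rewrite cprimB// [leRHS]splitr; apply: le_trans (le_normcB _ _) _; apply: lerD.
  exact: HM.
apply: le_trans (normc_cprim dEi x1) _; apply: le_trans qq'.
have ni : integrableR01 (fun t => normc (q t - q' t)) by apply/integrable01_normc/integrable01B.
apply: le_trans (_ : prim (fun t => normc (q t - q' t)) x <= _).
  apply: le_prim => //; first exact: integrable01_normc.
  move=> t tx; rewrite Normc.normcM -[leRHS]mulr1.
  by apply: ler_wpM2l; [exact: normc_ge0|exact: e1].
by apply: prim_le => // t _; exact: normc_ge0.
Qed.

Definition growth (b1 b2 : R) lam : R :=
  expR (- b1 * Im lam) + expR (- b2 * Im lam).

Variables (b1 b2 : R) (A : 'M[R[i]]_(2, 4)).
Hypotheses (b10 : b1 < 0) (b20 : 0 < b2).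

Lemma potential_local Q0 (e : R) : 0 < e -> exists2 d, 0 < d & forall Q,
  L1dist Q0 Q < d ->
    prim (fun t => normc (pot12 Q0 t - pot12 Q t)) 1 <= e /\
    prim (fun t => normc (pot21 Q0 t - pot21 Q t)) 1 <= e.
Proof.
move=> e0; exists e => // Q /ltW QQ.
have i12 := integrable01_normc (integrable01B (pot12_L1 Q0) (pot12_L1 Q)).
have i21 := integrable01_normc (integrable01B (pot21_L1 Q0) (pot21_L1 Q)).
split; apply: le_trans QQ; apply: le_prim => //; try exact: integrableR01D.
  by move=> t _; rewrite lerDl normc_ge0.
by move=> t _; rewrite lerDr normc_ge0.
Qed.

Lemma prim_normcZ (k : R[i]) q : integrable01 q ->
  prim (fun t => normc (k * q t)) 1 = normc k * prim (fun t => normc (q t)) 1.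
Proof.
move=> qi; rewrite -primZ//; last exact: integrable01_normc.
by apply: prim_eq => // t _; rewrite Normc.normcM.
Qed.

Lemma fundamental_estimate Q0 (eta : R) : 0 < eta ->
  exists2 d, 0 < d & exists2 M, 0 < M & forall Q Phi lam,
    L1dist Q0 Q < d -> is_fundamental b1 b2 Q Phi -> M <= normc lam ->
    [/\ normc (Phi lam 1 0 0 - cexp ('i * lam * b1%:C)) <= eta * growth b1 b2 lam,
        normc (Phi lam 1 1 1 - cexp ('i * lam * b2%:C)) <= eta * growth b1 b2 lam,
        normc (Phi lam 1 0 1) <= eta * growth b1 b2 lam,
        normc (Phi lam 1 1 0) <= eta * growth b1 b2 lam &
        Phi lam 1 0 0 * Phi lam 1 1 1 - Phi lam 1 1 0 * Phi lam 1 0 1 =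
          cexp ('i * lam * (b1 + b2)%:C)].
Proof.
move=> eta0.
have nb10 : b1 != 0 by rewrite lt_eqF.
have nb20 : b2 != 0 by rewrite gt_eqF.
pose k1 : R[i] := - ('i * b1%:C); pose k2 : R[i] := - ('i * b2%:C).
have n1 : normc k1 = `|b1| by rewrite normcN Normc.normcM normc_i mul1r normc_real.
have n2 : normc k2 = `|b2| by rewrite normcN Normc.normcM normc_i mul1r normc_real.
pose P Q t := k1 * pot12 Q t; pose P' Q t := k2 * pot21 Q t.
have Pi Q : integrable01 (P Q) by apply: integrable01Z; exact: pot12_L1.
have P'i Q : integrable01 (P' Q) by apply: integrable01Z; exact: pot21_L1.
pose N0 := prim (fun t => normc (P Q0 t)) 1 + prim (fun t => normc (P' Q0 t)) 1.
have N00 : 0 <= N0 by rewrite addr_ge0// prim_ge0// => t _; exact: normc_ge0.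
have rho0 : 0 <= N0 + 2 by rewrite addr_ge0.
have [K K0 HK] := system_estimate1 rho0.
pose e := eta / K; have e0 : 0 < e by rewrite divr_gt0.
have [M1 M10 HM1] := riemann_lebesgue_local (Pi Q0) e0.
have [M2 M20 HM2] := riemann_lebesgue_local (P'i Q0) e0.
pose B := `|b1| + `|b2|.
have B0 : 0 < B by rewrite ltr_pwDr// normr_gt0.
(* The bound 1 keeps the L1 norms below [N0 + 2], for which [K] was chosen; the bound e/2 preserves
   the thresholds [M1] and [M2]; division by [B] offsets the factors b1 and b2 in front of the
   entries of the potential. *)
pose e' := Num.min 1 (e / 2) / B.
have e'0 : 0 < e' by rewrite divr_gt0// lt_min ltr01 divr_gt0.
have [d d0 Hd] := potential_local Q0 e'0.
exists d => //.
have b21 : 0 < b2 - b1 by rewrite subr_gt0 (lt_trans b10).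
exists ((M1 + M2) / (b2 - b1)); first by rewrite divr_gt0// addr_gt0.
move=> Q Phi lam /Hd[dQ1 dQ2] /(_ lam)[Phi0 sol] Mlam.
have scale (b : R) (k : R[i]) (q0 q1 : R -> R[i]) : integrable01 q0 -> integrable01 q1 ->
    normc k = `|b| -> `|b| <= B ->
    prim (fun t => normc (q0 t - q1 t)) 1 <= e' ->
    prim (fun t => normc (k * q0 t - k * q1 t)) 1 <= Num.min 1 (e / 2).
  move=> i0 i1 nk bB h.
  rewrite (_ : prim _ 1 = prim (fun t => normc (k * (q0 t - q1 t))) 1); last first.
    by apply: prim_eq => // t _; rewrite mulrBr.
  rewrite prim_normcZ; last exact: integrable01B.
  apply: le_trans (_ : B * e' <= _); last by rewrite /e' mulrCA mulfV ?mulr1 ?gt_eqF.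
  rewrite nk; apply: ler_pM => //.
  by apply: prim_ge0 => t _; exact: normc_ge0.
have dP : prim (fun t => normc (P Q0 t - P Q t)) 1 <= Num.min 1 (e / 2).
  by apply: (scale b1) => //; [exact: pot12_L1|exact: pot12_L1|rewrite lerDl].
have dP' : prim (fun t => normc (P' Q0 t - P' Q t)) 1 <= Num.min 1 (e / 2).
  by apply: (scale b2) => //; [exact: pot21_L1|exact: pot21_L1|rewrite lerDr].
have norm_le (f g : R -> R[i]) : integrable01 f -> integrable01 g ->
    prim (fun t => normc (f t - g t)) 1 <= Num.min 1 (e / 2) ->
    prim (fun t => normc (g t)) 1 <= prim (fun t => normc (f t)) 1 + 1.
  move=> fi gi; rewrite le_min => /andP[h _].
  apply: le_trans (_ : prim (fun t => normc (f t) + normc (f t - g t)) 1 <= _).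
    have ni := integrable01_normc (integrable01B fi gi).
    apply: le_prim => //; [exact: integrable01_normc|..].
      by apply: integrableR01D => //; exact: integrable01_normc.
    move=> t _; rewrite -[X in normc X <= _](subKr (f t)); exact: le_normcB.
  rewrite primD ?lerD2l//; [exact: integrable01_normc|].
  by apply/integrable01_normc/integrable01B.
have ni1 := integrable01_normc (Pi Q); have ni2 := integrable01_normc (P'i Q).
have bound : prim (fun t => normc (P Q t)) 1 + prim (fun t => normc (P' Q t)) 1 <= N0 + 2.
  apply: le_trans (lerD (norm_le _ _ (Pi Q0) (Pi Q) dP) (norm_le _ _ (P'i Q0) (P'i Q) dP')) _.
  by rewrite /N0; lra.
have bound1 : prim (fun t => normc (P Q t) + normc (P' Q t)) 1 <= N0 + 2.
  by rewrite primD.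
have bound2 : prim (fun t => normc (P' Q t) + normc (P Q t)) 1 <= N0 + 2.
  by rewrite primD// addrC.
have le2 (z : R) : z <= Num.min 1 (e / 2) -> z <= e / 2 by rewrite le_min => /andP[].
have nk (k : R[i]) (c : R) : `|c| = b2 - b1 -> normc k = normc (c%:C * lam) ->
    M1 <= normc k /\ M2 <= normc k.
  move=> hc ->; rewrite Normc.normcM normc_real hc.
  have : M1 + M2 <= (b2 - b1) * normc lam by rewrite mulrC -ler_pdivrMr.
  by move=> h; split; apply: le_trans h; [rewrite lerDl ltW|rewrite lerDr ltW].
have RL1 (c : R) : `|c| = b2 - b1 -> forall k k0 x, 0 <= x <= 1 ->
      (forall t, 0 <= t <= x -> normc (cexp (k0 + k * t%:C)) <= 1) ->
      normc k = normc (c%:C * lam) ->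
      normc (cprim (fun t => P Q t * cexp (k0 + k * t%:C)) x) <= e /\
      normc (cprim (fun t => P' Q t * cexp (k0 + k * t%:C)) x) <= e.
  move=> hc k k0 x x01 h1 /(nk k c hc)[Mk1 Mk2].
  by split; [apply: HM1|apply: HM2] => //; exact: le2.
have sys k : is_ac_derive01 (fun t => Phi lam t 0 k)
      (fun t => 'i * lam * b1%:C * Phi lam t 0 k + P Q t * Phi lam t 1 k) /\
    is_ac_derive01 (fun t => Phi lam t 1 k)
      (fun t => 'i * lam * b2%:C * Phi lam t 1 k + P' Q t * Phi lam t 0 k).
  have [u v] := dirac_system nb10 nb20 (sol k).
  split; [move: u|move: v].
    have E t : col k (Phi lam t) 0 0 = Phi lam t 0 k by rewrite mxE.
    move=> /(ac_eq (fun t _ => E t)); apply: ac_deriv_eq => t _.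
    by rewrite !mxE /P /k1 !mulNr.
  have E t : col k (Phi lam t) 1 0 = Phi lam t 1 k by rewrite mxE.
  move=> /(ac_eq (fun t _ => E t)); apply: ac_deriv_eq => t _.
  by rewrite !mxE /P' /k2 !mulNr.
have Ke : K * e = eta by rewrite /e mulrCA mulfV ?mulr1// gt_eqF.
have Phi01 i j : normc (Phi lam 0 i j) <= 1.
  rewrite Phi0 mxE; case: (i == j); rewrite /= ?mulr1n ?mulr0n.
    by rewrite expr1n expr0n/= addr0 sqrtr1.
  by rewrite !expr0n/= addr0 sqrtr0.
have main k :
    normc (Phi lam 1 0 k - cexp ('i * lam * b1%:C) * Phi lam 0 0 k) <= eta * growth b1 b2 lam /\
    normc (Phi lam 1 1 k - cexp ('i * lam * b2%:C) * Phi lam 0 1 k) <= eta * growth b1 b2 lam.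
  have [s1 s2] := sys k.
  have g1 : eta * expR (- b1 * Im lam) <= eta * growth b1 b2 lam.
    by rewrite ler_pM2l// lerDl expR_ge0.
  have g2 : eta * expR (- b2 * Im lam) <= eta * growth b1 b2 lam.
    by rewrite ler_pM2l// lerDr expR_ge0.
  (* For Im lam < 0 the roles of b1 and b2, and with them those of the two components, are
     exchanged. *)
  have [I0|I0] := leP 0 (Im lam).
    have m0 : 0 <= (b2 - b1) * Im lam by rewrite mulr_ge0// ltW.
    have hc : `|b2 - b1| = b2 - b1 by rewrite gtr0_norm.
    have [] := HK b1 b2 lam (P Q) (P' Q) _ _ e m0 (ltW e0) (Pi Q) (P'i Q) bound1 s1 s2 (Phi01
      _ _) (Phi01 _ _) (RL1 _ hc).
    by rewrite Ke => h1 h2; split; [exact: le_trans h1 g1|exact: le_trans h2 g1].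
  have m0 : 0 <= (b1 - b2) * Im lam by rewrite -opprB mulNr -mulrN mulr_ge0 ?oppr_ge0 ?ltW.
  have hc : `|b1 - b2| = b2 - b1 by rewrite distrC gtr0_norm.
  have [] := HK b2 b1 lam (P' Q) (P Q) _ _ e m0 (ltW e0) (P'i Q) (Pi Q) bound2 s2 s1 (Phi01 _
    _) (Phi01 _ _).
    by move=> k' k0 x h1 h2 /(RL1 _ hc k' k0 x h1 h2)[].
  by rewrite Ke => h1 h2; split; [exact: le_trans h2 g2|exact: le_trans h1 g2].
have [A1 A2] := main 0; have [B1 B2] := main 1.
have [s1 s2] := sys 0; have [s3 s4] := sys 1.
split.
- by move: A1; rewrite Phi0 mxE mulr1.
- by move: B2; rewrite Phi0 mxE mulr1.
- by move: B1; rewrite Phi0 mxE mulr0 subr0.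
- by move: A2; rewrite Phi0 mxE mulr0 subr0.
- by rewrite (fundamental_det s1 s2 s3 s4) !Phi0 !mxE/= mulr1n mulr0n mulr1 mulr0 subr0 mulr1.
Qed.

Lemma char_det_local Q0 (eta : R) : 0 < eta ->
  exists2 d, 0 < d & exists2 M, 0 < M & forall Q Delta lam,
    L1dist Q0 Q < d -> is_char_det b1 b2 A Q Delta -> M <= normc lam ->
    normc (Delta lam - Delta0 b1 b2 A lam) <= eta * growth b1 b2 lam.
Proof.
move=> eta0.
pose J := normc (bc_minor A 2%:R 1) + normc (bc_minor A 0 3%:R)
        + normc (bc_minor A 0 2%:R) + normc (bc_minor A 3%:R 1) + 1.
have J0 : 0 < J by rewrite ltr_wpDl// !addr_ge0// normc_ge0.
have eJ : 0 < eta / J by rewrite divr_gt0.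
have [d d0 [M M0 H]] := fundamental_estimate Q0 eJ.
exists d => //; exists M => // Q Delta lam Qd [Phi fPhi ->] Mlam.
have [h1 h2 h3 h4 h5] := H Q Phi lam Qd fPhi Mlam.
have [Phi0 _] := fPhi lam.
rewrite (char_detE A Phi0)/= h5 /Delta0.
rewrite ['i * (b1 + b2)%:C * lam]mulrAC ['i * b1%:C * lam]mulrAC ['i * b2%:C * lam]mulrAC.
set F := Phi lam 1; set g := growth b1 b2 lam.
set e1 := cexp ('i * lam * b1%:C); set e2 := cexp ('i * lam * b2%:C).
set e3 := cexp _.
have -> : bc_minor A 0 1 + bc_minor A 2%:R 3%:R * e3 + bc_minor A 2%:R 1 * F 0 0 +
  bc_minor A 0 3%:R * F 1 1 + bc_minor A 0 2%:R * F 0 1 + bc_minor A 3%:R 1 * F 1 0 -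
  (bc_minor A 0 1 + bc_minor A 2%:R 3%:R * e3 + bc_minor A 2%:R 1 * e1 +
   bc_minor A 0 3%:R * e2) =
  bc_minor A 2%:R 1 * (F 0 0 - e1) + bc_minor A 0 3%:R * (F 1 1 - e2) +
  bc_minor A 0 2%:R * F 0 1 + bc_minor A 3%:R 1 * F 1 0 by ring.
have g0 : 0 <= g by rewrite addr_ge0// expR_ge0.
have tri (c z : R[i]) : normc z <= eta / J * g -> normc (c * z) <= normc c * (eta / J * g).
  by move=> h; rewrite Normc.normcM ler_wpM2l// normc_ge0.
apply: le_trans (le_normcD _ _) _.
apply: le_trans (lerD (le_trans (le_normcD _ _) (lerD (le_normcD _ _) (lexx _))) (lexx _)) _.
apply: le_trans (lerD (lerD (lerD (tri _ _ h1) (tri _ _ h2)) (tri _ _ h3)) (tri _ _ h4)) _.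
rewrite -!mulrDl.
apply: le_trans (_ : J * (eta / J * g) <= _).
  apply: ler_wpM2r; first by rewrite mulr_ge0// ltW.
  by rewrite /J lerDl.
by rewrite mulrA mulrCA mulfV ?mulr1 ?gt_eqF.
Qed.

(** The local statement provides a neighbourhood of [Q0] together with a half-line of thresholds,
    which is a product neighbourhood for the near-covering form of compactness with [M] tending to
    infinity. *)
Lemma char_det_compact (K : set (potential R)) (eta : R) : compact K -> 0 < eta ->
  exists2 M, 0 < M & forall Q Delta lam, K Q -> is_char_det b1 b2 A Q Delta ->
    M <= normc lam ->
    normc (Delta lam - Delta0 b1 b2 A lam) <= eta * growth b1 b2 lam.
Proof.
move=> /compact_near_coveringP Kc eta0.
have := Kc R +oo (fun M Q => forall Delta lam, is_char_det b1 b2 A Q Delta ->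
    M <= normc lam ->
    normc (Delta lam - Delta0 b1 b2 A lam) <= eta * growth b1 b2 lam) _ _.
case.
  move=> Q0 KQ0; have [d d0 [M M0 H]] := char_det_local Q0 eta0.
  exists (ball Q0 d, [set M' | M <= M']); first split => /=.
  - exact: nbhsx_ballx.
  - by apply: nbhs_pinfty_ge; exact: num_real.
  - move=> [Q M'] /= [Qd MM'] Delta lam cd Ml.
    apply: H cd _ => //; exact: le_trans Ml.
move=> M [Mr HM].
exists (Num.max 1 (M + 1)); first by rewrite lt_max ltr01.
move=> Q Delta lam KQ cd Ml; apply: (HM (Num.max 1 (M + 1)) _ Q KQ) => //.
by rewrite lt_max ltrDl ltr01 orbT.
Qed.

End perturbation.

(** * Exponential sums and their zeros *)

Section taylor.
Context {R : realType}.
Implicit Types (z w : R[i]) (t : R).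

Lemma ac_id : is_ac_derive01 (fun t : R => t%:C) (fun=> 1).
Proof.
split; first exact/contC_integrable01/contC_cst.
move=> x x01; apply: complex_eq; rewrite ?Re_add ?Im_add.
  rewrite -[RHS]/(0 + prim (fun=> 1 : R) x) prim_cst// mul1r add0r//.
by rewrite -[RHS]/(0 + prim (fun=> 0 : R) x) prim_cst// mul0r add0r.
Qed.

Lemma ac_exp n : is_ac_derive01 (fun t : R => t%:C ^+ n.+1) (fun t => n.+1%:R * t%:C ^+ n).
Proof.
elim: n => [|n IH].
  have E (t : R) : t%:C = t%:C ^+ 1 by rewrite expr1.
  by move: ac_id => /(ac_eq (fun t _ => E t)); apply: ac_deriv_eq => t _; rewrite expr0 mulr1.
have E (t : R) : t%:C * t%:C ^+ n.+1 = t%:C ^+ n.+2 by rewrite (exprS _ n.+1).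
move: (acM ac_id IH) => /(ac_eq (fun t _ => E t)); apply: ac_deriv_eq => t _.
rewrite mul1r mulrCA -exprS -[n.+2%:R]nat1r; ring.
Qed.

Definition exp_partial n z : R[i] := \sum_(k < n) z ^+ k / k`!%:R.

Lemma exp_partialS n z : exp_partial n.+1 z = exp_partial n z + z ^+ n / n`!%:R.
Proof. by rewrite /exp_partial big_ord_recr. Qed.

Lemma ac_exp_partial z n :
  is_ac_derive01 (fun t => exp_partial n.+1 (z * t%:C)) (fun t => z * exp_partial n (z * t%:C)).
Proof.
elim: n => [|n IH].
  have E (t : R) : (1 : R[i]) = exp_partial 1 (z * t%:C).
    by rewrite /exp_partial big_ord_recl big_ord0 addr0 expr0 fact0 divr1.
  move: (ac_cst (1 : R[i])) => /(ac_eq (fun t _ => E t)); apply: ac_deriv_eq => t _.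
  by rewrite /exp_partial big_ord0 mulr0.
have E (t : R) : exp_partial n.+1 (z * t%:C) + z ^+ n.+1 / n.+1`!%:R * t%:C ^+ n.+1 =
    exp_partial n.+2 (z * t%:C).
  by rewrite [RHS]exp_partialS exprMn; congr (_ + _); rewrite mulrAC.
move: (acD IH (acZ (z ^+ n.+1 / n.+1`!%:R) (ac_exp n))).
move=> /(ac_eq (fun t _ => E t)); apply: ac_deriv_eq => t _.
rewrite exp_partialS mulrDr; congr (_ + _).
rewrite factS natrM invfM exprMn exprS.
have n0 : (n.+1%:R : R[i]) != 0 by rewrite pnatr_eq0.
transitivity ((n.+1%:R^-1 * n.+1%:R) * (z * z ^+ n * n`!%:R^-1 * t%:C ^+ n)); first by ring.
by rewrite mulVf// mul1r; ring.
Qed.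

(** Induction along the segment from 0 to z: the derivative in t of the remainder of order n + 1 at
    [z * t] is z times the remainder of order n. The factor 1/n! is given up, geometric decay being
    sufficient later. *)
Lemma cexp_taylor n z : normc (cexp z - exp_partial n z) <= normc z ^+ n * expR (normc z).
Proof.
suff H t : 0 <= t <= 1 ->
    normc (cexp (z * t%:C) - exp_partial n (z * t%:C)) <= normc z ^+ n * expR (normc z).
  by have := H 1; rewrite mulr1; apply; rewrite lexx ler01.
elim: n t => [|n IH] t /[dup] t01 /andP[t0 t1].
  rewrite /exp_partial big_ord0 subr0 expr0 mul1r normc_cexp ler_expR.
  apply: le_trans (ler_norm _) _; apply: le_trans (Re_le_normc _) _.
  rewrite Normc.normcM normc_real ger0_norm// -[leRHS]mulr1.
  by rewrite ler_wpM2l// normc_ge0.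
have E (u : R) : cexp (z * u%:C) + -1 * exp_partial n.+1 (z * u%:C) =
  cexp (z * u%:C) - exp_partial n.+1 (z * u%:C) by rewrite mulN1r.
have := acD (ac_cexp z) (acZ (-1) (ac_exp_partial z n)).
move=> /(ac_eq (fun t _ => E t)) [_ /(_ t t01)].
rewrite mulr0 cexp0 -/(cprim _ t).
have -> : exp_partial n.+1 0 = 1 :> R[i].
  rewrite /exp_partial big_ord_recl expr0 fact0 divr1 big1 ?addr0// => i _.
  by rewrite exprS mul0r mul0r.
rewrite subrr add0r => ->.
have cc : contC (fun t => z * cexp (z * t%:C) + -1 * (z * exp_partial n (z * t%:C))).
  apply: contCD; first by apply: contCM; [exact: contC_cst|exact: ac_cont (ac_cexp z)].
  apply: contCM; first exact: contC_cst.
  apply: contCM; first exact: contC_cst.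
  case: n {E IH} => [|n]; last exact: ac_cont (ac_exp_partial z n).
  rewrite (_ : (fun=> _) = fun=> 0); first exact: contC_cst.
  by apply/funext => u; rewrite /exp_partial big_ord0.
apply: le_trans (normc_cprim (contC_integrable01 cc) t1) _.
apply: le_trans (_ : prim (fun=> normc z ^+ n.+1 * expR (normc z)) t <= _).
  apply: le_prim => //.
  - exact/integrable01_normc/contC_integrable01.
  - exact/cont01_intR/cont01_cst.
  - move=> u /andP[u0 ut].
    rewrite (_ : _ + _ = z * (cexp (z * u%:C) - exp_partial n (z * u%:C))); last by ring.
    rewrite Normc.normcM exprS -mulrA ler_wpM2l ?normc_ge0//.
    by apply: IH; rewrite u0 (le_trans ut).
rewrite prim_cst// -[leRHS]mulr1 ler_wpM2l// mulr_ge0 ?expR_ge0// exprn_ge0//.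
exact: normc_ge0.
Qed.

End taylor.

(** * Roots and coefficients of complex polynomials *)

Section polynomials.
Context {R : realType}.
Implicit Types (z w : R[i]) (p : {poly R[i]}) (r S eta rho : R).

Lemma coef_XsubC_mul z p k : (('X - z%:P) * p)`_k =
  (if k is k'.+1 then p`_k' else 0) - z * p`_k.
Proof. by rewrite mulrBl coefB coefXM coefCM; case: k. Qed.

(** If m bounds the weighted coefficients of the product so far, a further factor X - z yields at
    most r m + |z| m, hence at most 2 |z| m, while the constant coefficient is multiplied by exactly
    |z| in modulus. *)
Lemma vieta_bound (s : seq R[i]) r k : 0 < r -> {in s, forall z, r <= normc z} ->
  normc (\prod_(z <- s) ('X - z%:P))`_k * r ^+ k
    <= 2 ^+ size s * normc (\prod_(z <- s) ('X - z%:P))`_0.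
Proof.
move=> r0; elim: s k => [|z s IH] k zs.
  rewrite big_nil !coef1 expr0 mul1r; case: k => [|k]/=; rewrite ?mulr1 ?expr0 ?mulr1//.
  by rewrite ?expr0n/= addr0 sqrtr0 mul0r sqrtr_ge0.
have {}IH k' := IH k' (fun u us => zs u (mem_behead (s := z :: s) us)).
have rz : r <= normc z by apply: zs; rewrite inE eqxx.
rewrite !big_cons; set p := \prod_(_ <- _) _ in IH *.
rewrite !coef_XsubC_mul sub0r normcN Normc.normcM /= exprS.
set m := 2 ^+ size s * normc p`_0 in IH *.
have -> : 2 * 2 ^+ size s * (normc z * normc p`_0) = normc z * m + normc z * m by rewrite /m;
  ring.
apply: le_trans (ler_wpM2r (exprn_ge0 _ (ltW r0)) (le_normcB _ _)) _.
rewrite mulrDl; apply: lerD; last first.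
  by rewrite Normc.normcM -mulrA ler_wpM2l ?normc_ge0.
have m0 : 0 <= m by rewrite mulr_ge0 ?exprn_ge0 ?normc_ge0.
case: k => [|k]; first by rewrite -[0]/(0%:C) normc_real normr0 mul0r mulr_ge0// normc_ge0.
rewrite exprS mulrCA; apply: ler_pM => //; first exact: ltW.
by rewrite mulr_ge0 ?normc_ge0// exprn_ge0// ltW.
Qed.

(** Contrapositive of [vieta_bound]: size at most 8 means at most 7 roots, and 128 = 2^7. *)
Lemma poly_root_near p r k : 0 < r -> (size p <= 8)%N ->
  128 * normc p`_0 < normc p`_k * r ^+ k -> exists2 w, root p w & normc w < r.
Proof.
move=> r0 sp h; apply: contrapT => nw.
have [s ps] := closed_field_poly_normal p.
have p0 : p != 0.
  apply: contraTneq h => ->; rewrite !coef0 -[0]/(0%:C) normc_real normr0.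
  by rewrite mul0r mulr0 ltxx.
have ss : (size s <= 7)%N.
  by move: sp; rewrite ps size_scale ?lead_coef_eq0// size_prod_XsubC.
have rs : {in s, forall z, r <= normc z}.
  move=> z zs; rewrite leNgt; apply/negP => zr; apply: nw; exists z => //.
  by rewrite ps rootZ ?lead_coef_eq0// root_prod_XsubC.
have := vieta_bound k r0 rs; move: h; rewrite ps !coefZ !Normc.normcM.
set q := \prod_(_ <- _) _; move=> h1 h2.
have l0 : 0 < normc (lead_coef p) by rewrite normc_gt0 lead_coef_eq0.
move: h1; rewrite -mulrA mulrCA ltr_pM2l// => /lt_le_trans/(_ h2).
rewrite ltNge => /negP; apply; apply: ler_wpM2r; first exact: normc_ge0.
have -> : 128 = 2 ^+ 7 :> R by rewrite -natrX.
by rewrite ler_eXn2l// ltr1n.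
Qed.

(** The coefficients satisfy q_j = p_(j+1) + w q_(j+1), solved downwards from the top degree; since
    |w| is at most 1/2, the resulting geometric sum is at most 2S. *)
Lemma quotient_bound p w S rho : 0 <= S -> normc w <= rho -> rho <= 2^-1 ->
  (forall k, normc p`_k <= S) ->
  exists q, [/\ p = p.[w]%:P + ('X - w%:P) * q & forall k, normc q`_k <= 2 * S].
Proof.
move=> S0 wr r2 pS; pose q := p %/ ('X - w%:P).
have pq : p = p.[w]%:P + ('X - w%:P) * q.
  by rewrite addrC mulrC -modp_XsubC; exact: divp_eq.
exists q; split => // k.
have qE j : q`_j = p`_j.+1 + w * q`_j.+1.
  have := congr1 (fun u : {poly R[i]} => u`_j.+1) pq.
  by rewrite /= coefD coefC coef_XsubC_mul/= add0r => ->; rewrite subrK.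
have [m] : exists m, (size q <= k + m)%N by exists (size q); rewrite leq_addl.
elim: m k => [|m IH] k.
  rewrite addn0 => sk; rewrite nth_default// -[0]/(0%:C) normc_real normr0.
  by rewrite mulr_ge0.
rewrite addnS -addSn => /IH h; rewrite qE.
apply: le_trans (le_normcD _ _) _; rewrite Normc.normcM.
have := pS k.+1; have := normc_ge0 w; have := normc_ge0 q`_k.+1; nra.
Qed.

(* By successive division by the [X - w], as in Newton interpolation. *)
Lemma small_coef (ws : seq R[i]) rho : rho <= 2^-1 -> uniq ws ->
  {in ws, forall w, normc w <= rho} ->
  exists2 K, 0 <= K & forall p S eta, 0 <= S -> 0 <= eta ->
    (forall k, normc p`_k <= S) -> {in ws, forall w, normc p.[w] <= eta} ->
    forall k, (k < size ws)%N -> normc p`_k <= K * eta + 4 ^+ size ws * rho * S.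
Proof.
move=> rho2; elim: ws => [|w ws IH]; first by exists 0.
move=> /= /andP[wws uws] hws.
have wr : normc w <= rho by apply: hws; rewrite inE eqxx.
have rho0 : 0 <= rho by apply: le_trans wr; exact: normc_ge0.
have [|K K0 HK] := IH uws; first by move=> u us; apply: hws; rewrite inE us orbT.
pose D := \sum_(u <- ws) 2 / normc (u - w).
have D0 : 0 <= D by apply: sumr_ge0 => u _; rewrite divr_ge0// normc_ge0.
(* [1] accounts for [p.[w]] and [K * D] for the values of the quotient [q] at the other nodes. The
   quotient has coefficients up to 2S and is also multiplied by [w], which gives (2 4^n + 2) rho S,
   at most 4^(n+1) rho S. *)
exists (1 + K * D); first by rewrite addr_ge0// mulr_ge0.
move=> p S eta S0 eta0 pS pe k ks.
have [q [pq qS]] := quotient_bound S0 wr rho2 pS.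
have pwe : normc p.[w] <= eta by apply: pe; rewrite inE eqxx.
have qe : {in ws, forall u, normc q.[u] <= D * eta}.
  move=> u us; have uw : 0 < normc (u - w).
    by rewrite normc_gt0 subr_eq0; apply: contraNneq wws => <-.
  have qu : (u - w) * q.[u] = p.[u] - p.[w].
    have := congr1 (fun v : {poly R[i]} => v.[u]) pq.
    by rewrite /= hornerD hornerC hornerM hornerXsubC => ->; rewrite addrAC subrr add0r.
  have : normc (u - w) * normc q.[u] <= 2 * eta.
    rewrite -Normc.normcM qu; apply: le_trans (le_normcB _ _) _.
    have -> : 2 * eta = eta + eta by ring.
    by apply: lerD => //; apply: pe; rewrite inE us orbT.
  rewrite mulrC -ler_pdivlMr// => /le_trans; apply.
  rewrite mulrAC; apply: ler_wpM2r => //.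
  rewrite /D (big_rem u)//= lerDl; apply: sumr_ge0 => v _.
  by rewrite divr_ge0// normc_ge0.
have q41 : 1 <= 4 ^+ size ws :> R by rewrite exprn_ege1// ler1n.
have rS : 0 <= rho * S by rewrite mulr_ge0.
rewrite exprS.
have wq j : normc (w * q`_j) <= rho * (2 * S).
  by rewrite Normc.normcM; apply: ler_pM => //; exact: normc_ge0.
have KD : 0 <= K * D * eta by rewrite !mulr_ge0.
have pk : p`_k = (if k == 0 then p.[w] else 0) + ((if k is k'.+1 then q`_k' else 0) - w * q`_k).
  by rewrite {1}pq coefD coefC coef_XsubC_mul.
case: k ks pk => [_|k ks] -> /=.
  rewrite sub0r; apply: le_trans (le_normcB _ _) _.
  apply: le_trans (lerD pwe (wq 0)) _; nra.
rewrite add0r; apply: le_trans (le_normcB _ _) _.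
have := HK q (2 * S) (D * eta) _ _ qS qe k ks.
rewrite !mulr_ge0// => /(_ isT isT) h.
apply: le_trans (lerD h (wq _)) _; nra.
Qed.

End polynomials.

(** * Zeros of functions with uniform Taylor expansions on a strip *)

Section tame_function.
Context {R : realType}.
Implicit Types (z w lam : R[i]).

Lemma exists_pow2_gt (x : R) : exists n : nat, x < 2 ^+ n.
Proof.
have [x0|x0] := ltP x 0; first by exists 0%N; rewrite expr0 (lt_trans x0).
exists (Num.bound x); apply: lt_le_trans (archi_boundP x0) _.
by rewrite -natrX ler_nat ltnW// ltn_expl.
Qed.

Variables (f : R[i] -> R[i]) (a : nat -> R[i] -> R[i]) (H S Om sig : R).
Hypotheses (S0 : 0 < S) (Om1 : 1 <= Om) (sig0 : 0 < sig).
Hypothesis taylor : forall z n w, `|Im z| <= H -> normc w <= 1 ->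
  normc (f (z + w) - \sum_(k < n) a k z * w ^+ k) <= S * (Om * normc w) ^+ n.
Hypothesis coef_le : forall z k, `|Im z| <= H -> normc (a k z) <= S.
Hypothesis coef_ge : forall z, `|Im z| <= H ->
  exists k, (0 < k < 4)%N /\ sig <= normc (a k z).

Lemma normc0 : normc (0 : R[i]) = 0.
Proof. by rewrite -[0 in LHS]/(0%:C) normc_real normr0. Qed.

Lemma tame_coef0 z : `|Im z| <= H -> a 0 z = f z.
Proof.
move=> zH; have := taylor 1 zH (w := 0).
rewrite normc0 ler01 mulr0 expr0n mulr0 addr0 big_ord_recl big_ord0 addr0 expr0 mulr1.
move=> /(_ isT) h; apply/eqP; rewrite eq_sym -subr_eq0 -normc_eq0 eq_le h.
exact: normc_ge0.
Qed.

Let P n z : {poly R[i]} := \poly_(k < n) a k z.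

Lemma tame_taylor_poly n z w : `|Im z| <= H -> normc w <= 1 ->
  normc (f (z + w) - (P n z).[w]) <= S * (Om * normc w) ^+ n.
Proof. by move=> zH w1; rewrite horner_poly; exact: taylor. Qed.

(** Four distinct zeros near [z0] would make the Taylor coefficients of degree up to 3 small,
    against [coef_ge]. The constant [K] of [small_coef] depends on the zeros, but it multiplies only
    the remainder, which tends to 0 with the degree [n + 4] of truncation. The other term is 4^4 rho
    S, so [rho] can be chosen in advance: this is the origin of 256. *)
Lemma few_zeros : exists2 rho, 0 < rho & forall z0 (ws : seq R[i]), `|Im z0| <= H ->
  uniq ws -> {in ws, forall w, f w = 0 /\ normc (w - z0) <= rho} -> (size ws <= 3)%N.
Proof.
have Om0 : 0 < Om by apply: lt_le_trans Om1.
pose rho := Num.min (2 * Om)^-1 (sig / (2 * 256 * S)).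
have rho0 : 0 < rho by rewrite lt_min invr_gt0 !divr_gt0 ?mulr_gt0.
exists rho => // z0 ws z0H uws zws; rewrite leqNgt; apply/negP => ws4.
pose us := [seq w - z0 | w <- take 4 ws].
have sus : size us = 4%N by rewrite size_map size_takel.
have uus : uniq us.
  rewrite map_inj_in_uniq ?take_uniq// => u v _ _; exact: addIr.
have rho_Om : Om * rho <= 2^-1.
  apply: le_trans (_ : Om * (2 * Om)^-1 <= _); first by rewrite ler_pM2l// ge_min lexx.
  by rewrite invfM mulrCA mulfV ?mulr1 ?gt_eqF.
have rho2 : rho <= 2^-1 by apply: le_trans rho_Om; rewrite ler_peMl// ltW.
have hus u : u \in us -> f (z0 + u) = 0 /\ normc u <= rho.
  by move=> /mapP[w /mem_take/zws[fw wr] ->]; rewrite addrC subrK.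
have [K K0 HK] := small_coef rho2 uus (fun u us => proj2 (hus u us)).
have [k [/andP[k0 k4] sk]] := coef_ge z0H.
have [n hn] := exists_pow2_gt (2 * K * S / sig).
have := HK (P (n + 4) z0) S (S * 2^-1 ^+ (n + 4)) (ltW S0).
rewrite mulr_ge0 ?exprn_ge0 ?invr_ge0 ?ltW// => /(_ isT) h.
have {}h : normc (P (n + 4) z0)`_k <= K * (S * 2^-1 ^+ (n + 4)) + 4 ^+ size us * rho * S.
  apply: h; last by rewrite sus.
    move=> j; rewrite coef_poly; case: ifP => _; first exact: coef_le.
    by rewrite normc0 ltW.
  move=> u /hus[fu ur]; have u1 : normc u <= 1.
    by apply: le_trans ur _; apply: le_trans rho2 _; rewrite invf_le1// ler1n.
  have := tame_taylor_poly (n + 4) z0H u1.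
  rewrite fu sub0r normcN => /le_trans; apply; rewrite ler_pM2l//.
  apply: lerXn2r; rewrite ?nnegrE ?invr_ge0//.
    by rewrite mulr_ge0 ?normc_ge0// ltW.
  by apply: le_trans rho_Om; rewrite ler_pM2l.
rewrite coef_poly (leq_trans k4) ?leq_addl// sus in h.
have h1 : 4 ^+ 4 * rho * S <= sig / 2.
  have : rho <= sig / (2 * 256 * S) by rewrite ge_min lexx orbT.
  rewrite ler_pdivlMr ?mulr_gt0// => hr.
  have -> : 4 ^+ 4 = 256 :> R by rewrite -natrX.
  by rewrite ler_pdivlMr//; apply: le_trans hr; rewrite le_eqVlt; apply/orP; left; apply/eqP;
    ring.
have h2 : K * (S * 2^-1 ^+ (n + 4)) < sig / 2.
  move: hn; rewrite ltr_pdivrMr// exprD.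
  have yp : 2^-1 ^+ n * 2 ^+ n = 1 :> R by rewrite -exprMn mulVf ?expr1n.
  have y0 : 0 < 2^-1 ^+ n :> R by rewrite exprn_gt0// invr_gt0.
  have x1 : 2^-1 ^+ 4 <= 1 :> R by rewrite exprn_ile1 ?invr_ge0// invf_le1// ler1n.
  move=> hn; have : 2^-1 ^+ n * (2 * K * S) < 2^-1 ^+ n * (2 ^+ n * sig) by rewrite ltr_pM2l.
  rewrite [X in _ < X]mulrA yp mul1r.
  have KSy := mulr_ge0 (mulr_ge0 K0 (ltW S0)) (ltW y0).
  have := ler_wpM2l KSy x1; lra.
by have := le_lt_trans sk (le_lt_trans h (ltr_leD h2 h1)); rewrite -splitr ltxx.
Qed.

(** The scale s = |f z|^(1/4) is matched to coefficients of degree at most 3: at radius s < 1 such a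
    coefficient contributes at least sig s^3, which dominates s^4 = |f z|, whereas a remainder of
    order s^8 has fourth root of order s^2. *)
Let s4 (x : R) : R := Num.sqrt (Num.sqrt x).

Let s4_mono x y : x <= y -> s4 x <= s4 y.
Proof. by move=> xy; rewrite /s4 ler_wsqrtr// ler_wsqrtr. Qed.

Let s4_ge0 x : 0 <= s4 x. Proof. exact: sqrtr_ge0. Qed.

Let s4X x : 0 <= x -> s4 x ^+ 4 = x.
Proof. by move=> x0; rewrite (exprM _ 2 2) !sqr_sqrtr// sqrtr_ge0. Qed.

Let s4M x y : 0 <= x -> s4 (x * y) = s4 x * s4 y.
Proof. by move=> x0; rewrite /s4 !sqrtrM// sqrtr_ge0. Qed.

Let s4X4 x : 0 <= x -> s4 (x ^+ 4) = x.
Proof. by move=> x0; rewrite /s4 (exprM _ 2 2) sqrtr_sqr ger0_norm ?sqr_ge0// sqrtr_sqr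
  ger0_norm. Qed.

Let s4_gt0 x : 0 < x -> 0 < s4 x. Proof. by move=> x0; rewrite !sqrtr_gt0. Qed.

(** [kap] is the fourth root of the constant in the remainder of order 8. In [s0], the bound sig/256
    gives 128 s^4 < sig s^3, the bound 1/(2 kap + 1) gives kap s^2 <= s/2, and 1/5 keeps a step
    inside the unit box used in [zero_finder], since 4/5 + 1/5 = 1. *)
Let kap := s4 (S * Om ^+ 8).
Let s0 := Num.min (5^-1) (Num.min (sig / 256) (2 * kap + 1)^-1).

(* Where [f] is small but nonzero, the Taylor polynomial of degree 7 has a root
   [w] with [|w| < s4 |f|], and the remainder there is of order [|w|^8]. *)
Let step z : `|Im z| <= H -> f z != 0 -> s4 (normc (f z)) <= s0 ->
  exists2 w, normc w < s4 (normc (f z)) & s4 (normc (f (z + w))) <= s4 (normc (f z)) / 2.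
Proof.
move=> zH fz; set s := s4 (normc (f z)) => ss0.
have Om0 : 0 < Om by apply: lt_le_trans Om1.
have s_gt0 : 0 < s by rewrite s4_gt0// normc_gt0.
have kap0 : 0 <= kap by exact: s4_ge0.
have k0 : 0 < 2 * kap + 1 by rewrite ltr_wpDl// mulr_ge0.
move: ss0; rewrite /s0 !le_min => /and3P[s5 ssig skap].
have s1 : s <= 1 by apply: le_trans s5 _; rewrite invf_le1// ler1n.
have [k [/andP[k_gt0 k4] sk]] := coef_ge zH.
have [w] : exists2 w, root (P 8 z) w & normc w < s.
  apply: (poly_root_near (k := k) s_gt0 (size_poly _ _)).
  rewrite (_ : (P 8 z)`_0 = f z); last by rewrite coef_poly/= tame_coef0.
  rewrite coef_poly (leq_trans k4)//.
  have -> : normc (f z) = s ^+ 4 by rewrite s4X// normc_ge0.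
  apply: lt_le_trans (_ : sig * s ^+ 3 <= _).
    rewrite exprS mulrA ltr_pM2r ?exprn_gt0//.
    by move: ssig; rewrite ler_pdivlMr//; lra.
  apply: ler_pM => //; first exact: ltW.
    by rewrite exprn_ge0 ?ltW.
  by apply: ler_wiXn2l => //; exact: ltW.
move=> /rootP Pw ws; exists w => //.
have w1 : normc w <= 1 by apply: le_trans (ltW ws) s1.
have := tame_taylor_poly 8 zH w1; rewrite Pw subr0 => h.
have h2 : normc (f (z + w)) <= S * Om ^+ 8 * (s ^+ 2) ^+ 4.
  apply: le_trans h _; rewrite exprMn -exprM mulrA ler_pM2l ?mulr_gt0 ?exprn_gt0//.
  by apply: lerXn2r; rewrite ?nnegrE ?normc_ge0 ?ltW.
apply: le_trans (s4_mono h2) _.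
rewrite s4M ?(mulr_ge0 (ltW S0) (exprn_ge0 _ (ltW Om0)))// s4X4 ?exprn_ge0 ?(ltW s_gt0)// -/kap.
rewrite expr2 mulrA [leRHS]mulrC ler_pM2r//.
have : kap * s <= kap / (2 * kap + 1) by rewrite ler_wpM2l.
move=> /le_trans; apply; rewrite ler_pdivrMr//; lra.
Qed.

(** The Taylor estimate of order 1 is a local Lipschitz bound. Real coordinates are used because the
    minimum below is taken over a product of two segments. *)
Let normc_f_cont (z : R * R) : `|z.2| <= H ->
  {for z, continuous (fun u : R * R => normc (f (u.1 +i* u.2)))}.
Proof.
move=> zH; apply/cvgrPdist_le => /= e e0.
have Om0 : 0 < Om by apply: lt_le_trans Om1.
pose d := Num.min (2^-1) (e / (2 * (S * Om))).
have SO : 0 < 2 * (S * Om) by rewrite !mulr_gt0.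
have d0 : 0 < d by rewrite lt_min invr_gt0 divr_gt0//= ltr0n.
near=> u.
have u1 : `|z.1 - u.1| < d.
  by near: u; apply: (@cvgr_dist_lt _ _ _ (nbhs z) _ fst) => //; exact: cvg_fst.
have u2 : `|z.2 - u.2| < d.
  by near: u; apply: (@cvgr_dist_lt _ _ _ (nbhs z) _ snd) => //; exact: cvg_snd.
pose zz : R[i] := z.1 +i* z.2; pose w : R[i] := (u.1 - z.1) +i* (u.2 - z.2).
have wd : normc w <= 2 * d.
  apply: le_trans (normc_le_ReIm _) _; rewrite /= [`|u.1 - _|]distrC [`|u.2 - _|]distrC.
  lra.
have uE : u.1 +i* u.2 = zz + w by apply: complex_eq; rewrite ?Re_add ?Im_add/= addrC subrK.
have dle2 : d <= 2^-1 by rewrite ge_min lexx.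
have dle : d <= e / (2 * (S * Om)) by rewrite ge_min lexx orbT.
have w1 : normc w <= 1 by apply: le_trans wd _; lra.
have := taylor 1 (z := zz) (w := w) zH w1.
rewrite big_ord_recl big_ord0 addr0 expr0 mulr1 tame_coef0// expr1 -uE => h.
apply: le_trans (_ : normc (f (u.1 +i* u.2) - f zz) <= e).
  rewrite ler_norml; apply/andP; split; last first.
    by rewrite [leRHS]normcB; exact: le_normc_sub.
  by rewrite lerNl opprB; exact: le_normc_sub.
apply: le_trans h _; rewrite mulrA.
have SO0 : 0 < S * Om by rewrite mulr_gt0.
apply: le_trans (_ : S * Om * (2 * (e / (2 * (S * Om)))) <= _).
  by rewrite ler_pM2l//; apply: le_trans wd _; rewrite ler_pM2l.
rewrite le_eqVlt; apply/orP; left; apply/eqP.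
by field; rewrite !gt_eqF// (lt_le_trans _ Om1).
Unshelve. all: by end_near. Qed.

(* Ekeland-type argument: [step] is incompatible with a nonzero minimum of
   [s4 |f z| + |z - lam| / 4]. *)
Lemma zero_finder (eps : R) : 0 < eps -> exists2 c, 0 < c &
  forall lam, `|Im lam| <= H - 1 -> normc (f lam) < c ->
    exists2 z, f z = 0 & normc (z - lam) < eps.
Proof.
move=> eps0.
have kap0 : 0 <= kap by exact: s4_ge0.
have s00 : 0 < s0.
  by rewrite !lt_min invr_gt0 ltr0n divr_gt0//= invr_gt0 ltr_wpDl// mulr_ge0.
(* At a minimiser |z - lam|/4 is at most [s4 |f lam|], hence the threshold eps/4. *)
pose m := Num.min s0 (eps / 4).
have m0 : 0 < m by rewrite lt_min s00 divr_gt0.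
exists (m ^+ 4); first exact: exprn_gt0.
move=> lam lamH flam.
have slam : s4 (normc (f lam)) < m.
  rewrite ltNge; apply/negP => h; move: flam; apply/negP; rewrite -leNgt.
  rewrite -(s4X (normc_ge0 (f lam))).
  by apply: lerXn2r; rewrite ?nnegrE// ltW.
have [slam0 slame] : s4 (normc (f lam)) < s0 /\ s4 (normc (f lam)) < eps / 4.
  by move: slam; rewrite lt_min => /andP[].
pose A : set (R * R) := `[Re lam - 1, Re lam + 1] `*` `[Im lam - 1, Im lam + 1].
pose phi (u : R * R) := s4 (normc (f (u.1 +i* u.2))) + normc ((u.1 +i* u.2) - lam) / 4.
have cA : compact A by apply: compact_setX; exact: segment_compact.
have AH u : A u -> `|u.2| <= H.
  move=> [_ /=]; rewrite in_itv/= => /andP[h1 h2].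
  by move: lamH; rewrite !ler_norml => /andP[h3 h4]; apply/andP; split; lra.
have phic : {within A, continuous phi}.
  apply: continuous_in_subspaceT => u /set_mem Au.
  apply: (@cvgD _ R^o).
    apply: (@continuous_comp _ _ _ (fun v : R * R =>
      Num.sqrt (normc (f (v.1 +i* v.2)))) (@Num.sqrt R)); last exact: sqrt_continuous.
    apply: (@continuous_comp _ _ _ (fun v : R * R => normc (f (v.1 +i* v.2))) (@Num.sqrt R));
      last exact: sqrt_continuous.
    exact: normc_f_cont (AH _ Au).
  apply: (@cvgM R); last exact: cvg_cst.
  apply/cvgrPdist_le => /= e e0; have e20 : 0 < e / 2 by rewrite divr_gt0.
  near=> v.
  have u1 : `|u.1 - v.1| < e / 2.
    by near: v; apply: (@cvgr_dist_lt _ _ _ (nbhs u) _ fst) => //; exact: cvg_fst.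
  have u2 : `|u.2 - v.2| < e / 2.
    by near: v; apply: (@cvgr_dist_lt _ _ _ (nbhs u) _ snd) => //; exact: cvg_snd.
  pose z1 : R[i] := u.1 +i* u.2; pose z2 : R[i] := v.1 +i* v.2.
  have zz : normc (z1 - z2) <= e.
    apply: le_trans (normc_le_ReIm _) _; rewrite /z1 /z2 Re_add Im_add Re_opp Im_opp/=.
    by rewrite [leRHS]splitr lerD// ltW.
  apply: le_trans (_ : normc (z1 - z2) <= _) => //.
  have -> : z1 - z2 = (z1 - lam) - (z2 - lam) by ring.
  rewrite ler_norml le_normc_sub andbT lerNl opprB [leRHS]normcB.
  exact: le_normc_sub.
have lamE : Re lam +i* Im lam = lam by case: (lam).
have Alam : A (Re lam, Im lam) by split; rewrite /= in_itv/=; apply/andP; split; lra.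
have [zs /set_mem Azs hmin] := compact_EVT_min (ex_intro _ _ Alam) cA phic.
pose z : R[i] := zs.1 +i* zs.2.
have phile : phi zs <= s4 (normc (f lam)).
  apply: le_trans (hmin _ (mem_set Alam)) _.
  by rewrite /phi lamE subrr normc0 mul0r addr0.
have d0 := normc_ge0 (z - lam); have sz0 := s4_ge0 (normc (f z)).
rewrite /phi -/z in phile.
have [fz|fz] := eqVneq (f z) 0.
  exists z => //; lra.
have zsle : s4 (normc (f z)) <= s0 by lra.
have zH : `|Im z| <= H := AH _ Azs.
have [w ws hw] := step zH fz zsle.
have s05 : s0 <= 5^-1 by rewrite ge_min lexx.
have Azw : A (zs.1 + Re w, zs.2 + Im w).
  have n1 : normc (z + w - lam) <= 1.
    have -> : z + w - lam = (z - lam) + w by ring.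
    apply: le_trans (le_normcD _ _) _; lra.
  have h1 := le_trans (Re_le_normc _) n1; have h2 := le_trans (Im_le_normc _) n1.
  move: h1 h2; rewrite !Re_add !Im_add Re_opp Im_opp /z/= !ler_norml.
  move=> /andP[h1 h2] /andP[h3 h4].
  by split; rewrite /= in_itv/=; apply/andP; split; lra.
(* Moving to z + w lowers the first term of [phi] by at least half of [s4 |f z|] and raises the
   second by less than a quarter of it. *)
have := hmin _ (mem_set Azw); rewrite /phi/= -/z.
have -> : (zs.1 + Re w) +i* (zs.2 + Im w) = z + w.
  by apply: complex_eq; rewrite ?Re_add ?Im_add.
have : normc (z + w - lam) <= normc (z - lam) + normc w.
  have -> : z + w - lam = (z - lam) + w by ring.
  exact: le_normcD.
have : 0 < s4 (normc (f z)) by rewrite s4_gt0// normc_gt0.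
by move=> *; exfalso; lra.
Unshelve. all: by end_near. Qed.
End tame_function.

(** * Taylor expansions of exponential sums *)

Section exponential_sums.
Context {R : realType}.
Implicit Types (z w lam : R[i]) (s : seq (R[i] * R)).

Definition expsum s z : R[i] := \sum_(p <- s) p.1 * cexp ('i * p.2%:C * z).

Definition expsum_coef s (k : nat) z : R[i] :=
  \sum_(p <- s) p.1 * cexp ('i * p.2%:C * z) * ('i * p.2%:C) ^+ k / k`!%:R.

Lemma exp_coeff_le (x : R) k : 0 <= x -> x ^+ k / k`!%:R <= expR x.
Proof.
case: k => [|k] x0.
  by rewrite expr0 fact0 divr1 (le_trans _ (expR_ge1Dx x))// lerDl.
by apply: le_trans (expR_ge1Dxn k x0); rewrite lerDr.
Qed.

Lemma normc_sum (I : Type) (r : seq I) (F : I -> R[i]) :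
  normc (\sum_(i <- r) F i) <= \sum_(i <- r) normc (F i).
Proof.
elim: r => [|i r IH]; first by rewrite !big_nil normc0.
by rewrite !big_cons (le_trans (le_normcD _ _))// lerD2l.
Qed.

Lemma normc_nat n : normc (n%:R : R[i]) = n%:R.
Proof. by rewrite -[n%:R in LHS](rmorph_nat (real_complex R)) normc_real normr_nat. Qed.

Lemma Re_ir (x : R) z : Re ('i * x%:C * z) = - (x * Im z).
Proof. by case: z => a b /=; ring. Qed.

Lemma normc_ir (x : R) : normc ('i * x%:C) = `|x|.
Proof. by rewrite Normc.normcM normc_i mul1r normc_real. Qed.

Section bounds.
Variables (s : seq (R[i] * R)) (H Om : R).
Hypotheses (H0 : 0 <= H) (Om0 : 0 <= Om) (sOm : {in s, forall p, `|p.2| <= Om}).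

(** [expR (Om * H)] bounds the exponentials on the strip and [expR Om] the Taylor coefficients and
    remainders of the factor in [w]; the summand 1 ensures positivity. *)
Definition expsum_bound : R :=
  (\sum_(p <- s) normc p.1) * expR (Om * H) * expR Om + 1.

Lemma expsum_bound_gt0 : 0 < expsum_bound.
Proof.
rewrite ltr_wpDl// !mulr_ge0 ?expR_ge0//; apply: sumr_ge0 => p _; exact: normc_ge0.
Qed.

Lemma cexp_strip p z : p \in s -> `|Im z| <= H ->
  normc (cexp ('i * p.2%:C * z)) <= expR (Om * H).
Proof.
move=> ps zH; rewrite normc_cexp ler_expR Re_ir -mulNr.
apply: le_trans (ler_norm _) _; rewrite normrM normrN.
by apply: ler_pM => //; exact: sOm.
Qed.

Lemma expsum_term_bound (F : R[i] * R -> R[i]) (x : R) : 0 <= x ->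
  {in s, forall p, normc (F p) <= normc p.1 * expR (Om * H) * expR Om * x} ->
  normc (\sum_(p <- s) F p) <= expsum_bound * x.
Proof.
move=> x0 hF; apply: le_trans (normc_sum _ _) _.
apply: le_trans (_ : \sum_(p <- s) normc p.1 * expR (Om * H) * expR Om * x <= _).
  by rewrite big_seq [leRHS]big_seq; apply: ler_sum.
by rewrite -!mulr_suml /expsum_bound mulrDl lerDl mul1r.
Qed.

Lemma expsum_taylor z n w : `|Im z| <= H -> normc w <= 1 ->
  normc (expsum s (z + w) - \sum_(k < n) expsum_coef s k z * w ^+ k)
    <= expsum_bound * (Om * normc w) ^+ n.
Proof.
move=> zH w1.
have -> : expsum s (z + w) - \sum_(k < n) expsum_coef s k z * w ^+ k =
    \sum_(p <- s) p.1 * cexp ('i * p.2%:C * z) *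
      (cexp ('i * p.2%:C * w) - exp_partial n ('i * p.2%:C * w)).
  have -> : \sum_(k < n) expsum_coef s k z * w ^+ k =
      \sum_(p <- s) p.1 * cexp ('i * p.2%:C * z) * exp_partial n ('i * p.2%:C * w).
    under eq_bigr do rewrite /expsum_coef mulr_suml.
    rewrite exchange_big/=; apply: eq_bigr => p _.
    rewrite /exp_partial mulr_sumr; apply: eq_bigr => k _.
    by rewrite [(_ * w) ^+ k]exprMn; ring.
  rewrite /expsum -sumrB; apply: eq_bigr => p _.
  by rewrite mulrDr cexpD; ring.
apply: expsum_term_bound => [|p ps].
  by rewrite exprn_ge0// mulr_ge0// normc_ge0.
have pOm := sOm ps.
have h1 := cexp_strip ps zH.
have hw : normc ('i * p.2%:C * w) <= Om * normc w.
  by rewrite Normc.normcM normc_ir ler_wpM2r// normc_ge0.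
have h2 : normc (cexp ('i * p.2%:C * w) - exp_partial n ('i * p.2%:C * w)) <=
    expR Om * (Om * normc w) ^+ n.
  apply: le_trans (cexp_taylor _ _) _.
  rewrite mulrC; apply: ler_pM; rewrite ?expR_ge0 ?exprn_ge0 ?normc_ge0//.
    rewrite ler_expR; apply: le_trans hw _.
    by rewrite -[leRHS]mulr1 ler_wpM2l.
  by apply: lerXn2r; rewrite ?nnegrE ?normc_ge0// mulr_ge0 ?normc_ge0.
have := ler_wpM2l (normc_ge0 p.1) (ler_pM (normc_ge0 _) (normc_ge0 _) h1 h2).
by rewrite (Normc.normcM (_ * _)) (Normc.normcM p.1) !mulrA.
Qed.

Lemma expsum_coef_le z k : `|Im z| <= H -> normc (expsum_coef s k z) <= expsum_bound.
Proof.
move=> zH; rewrite -[leRHS]mulr1; apply: expsum_term_bound => // p ps.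
have h1 := cexp_strip ps zH.
have h2 : normc (('i * p.2%:C) ^+ k / k`!%:R) <= expR Om.
  rewrite Normc.normcM Normc.normcV normc_nat normcX normc_ir.
  apply: le_trans (exp_coeff_le k Om0); apply: ler_wpM2r; first by rewrite invr_ge0.
  by apply: lerXn2r; rewrite ?nnegrE// sOm.
have := ler_wpM2l (normc_ge0 p.1) (ler_pM (normc_ge0 _) (normc_ge0 _) h1 h2).
rewrite mulr1 -(mulrA (p.1 * _)) (Normc.normcM (p.1 * _)) (Normc.normcM p.1).
by rewrite -[in X in X -> _]mulrA !mulrA.
Qed.

End bounds.

Variables (b1 b2 : R) (A : 'M[R[i]]_(2, 4)).
Hypotheses (b10 : b1 < 0) (b20 : 0 < b2).

Definition delta_terms : seq (R[i] * R) :=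
  [:: (bc_minor A 0 1, 0); (bc_minor A 2%:R 3%:R, b1 + b2);
      (bc_minor A 2%:R 1, b1); (bc_minor A 0 3%:R, b2)].

Lemma Delta0E lam : Delta0 b1 b2 A lam = expsum delta_terms lam.
Proof.
rewrite /expsum /delta_terms !big_cons big_nil/= /Delta0 addr0.
by rewrite mulr0 mul0r cexp0 mulr1 !addrA.
Qed.

Let Om : R := 1 + `|b1| + `|b2|.

Lemma delta_freq : {in delta_terms, forall p, `|p.2| <= Om}.
Proof.
move=> p; rewrite !inE => /or4P[] /eqP -> /=; rewrite /Om.
- by rewrite normr0 !addr_ge0.
- by apply: le_trans (ler_normD _ _) _; rewrite lerD2r lerDr.
- by rewrite [1 + _]addrC -addrA lerDl addr_ge0.
- by rewrite lerDr addr_ge0.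
Qed.

(* [x (x - i b2) (x - i (b1 + b2))] vanishes at all exponents but [i b1]. *)
Lemma delta_coef_identity z :
  6 * expsum_coef delta_terms 3 z
  - 2 * ('i * b2%:C + 'i * (b1 + b2)%:C) * expsum_coef delta_terms 2 z
  + ('i * b2%:C) * ('i * (b1 + b2)%:C) * expsum_coef delta_terms 1 z =
  bc_minor A 2%:R 1 * cexp ('i * b1%:C * z) *
    (('i * b1%:C) * ('i * (b1 - b2)%:C) * - ('i * b2%:C)).
Proof.
rewrite /expsum_coef /delta_terms !big_cons !big_nil/= !addr0.
rewrite (_ : 3`! = 6%N)// (_ : 2`! = 2%N)// (_ : 1`! = 1%N)//.
rewrite !rmorphD rmorphN/= -[0%:C]/(0 : R[i]).
set e0 := cexp _; set e1 := cexp _; set e2 := cexp _; set e3 := cexp _.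
by field.
Qed.

(** In [delta_coef_identity] the right-hand side has modulus at least [N] on the strip, because J_32
    is nonzero, and the moduli of the factors on the left add up to at most [D]; the three
    coefficients cannot all be below N/D. *)
Lemma delta_coef_ge (H : R) : bc_minor A 2%:R 1 != 0 -> 0 <= H -> exists2 sig, 0 < sig &
  forall z, `|Im z| <= H ->
    exists k, (0 < k < 4)%N /\ sig <= normc (expsum_coef delta_terms k z).
Proof.
move=> J0 H0.
pose D : R := 6 + 2 * (`|b2| + `|b1 + b2|) + `|b2| * `|b1 + b2|.
have D0 : 0 < D by rewrite ltr_pwDl// ltr_pwDl// mulr_ge0// addr_ge0.
pose N : R := normc (bc_minor A 2%:R 1) * expR (- (`|b1| * H)) * (`|b1| * `|b1 - b2| * `|b2|).
have N0 : 0 < N.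
  have d0 : b1 - b2 != 0 by rewrite lt_eqF// subr_lt0 (lt_trans b10).
  have d1 : b1 != 0 by rewrite lt_eqF.
  have d2 : b2 != 0 by rewrite gt_eqF.
  by rewrite !mulr_gt0 ?normc_gt0 ?expR_gt0 ?normr_gt0.
exists (N / D); first by rewrite divr_gt0.
move=> z zH; apply: contrapT => nk.
have lt k : (0 < k < 4)%N -> normc (expsum_coef delta_terms k z) < N / D.
  by move=> k03; rewrite ltNge; apply/negP => h; apply: nk; exists k.
have := lt 1%N isT; have := lt 2%N isT; have := lt 3%N isT.
have := delta_coef_identity z.
set a1 := expsum_coef _ 1 z; set a2 := expsum_coef _ 2 z; set a3 := expsum_coef _ 3 z.
move=> /(congr1 (@Normc.normc _)) E h3 h2 h1.
have lower : N <= normc (bc_minor A 2%:R 1 * cexp ('i * b1%:C * z) *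
    (('i * b1%:C) * ('i * (b1 - b2)%:C) * - ('i * b2%:C))).
  rewrite (Normc.normcM (_ * _)) (Normc.normcM (bc_minor _ _ _)).
  rewrite (Normc.normcM (_ * _)) (Normc.normcM ('i * b1%:C)) normcN !normc_ir.
  rewrite ler_wpM2r ?mulr_ge0// ler_wpM2l ?normc_ge0//.
  rewrite normc_cexp ler_expR Re_ir lerN2 (le_trans (ler_norm _))// normrM.
  by rewrite ler_wpM2l.
have upper : normc (6 * a3 - 2 * ('i * b2%:C + 'i * (b1 + b2)%:C) * a2 +
    ('i * b2%:C) * ('i * (b1 + b2)%:C) * a1) < N.
  have -> : N = 6 * (N / D) + 2 * (`|b2| + `|b1 + b2|) * (N / D) + `|b2| * `|b1 + b2| * (N / D).
    by rewrite -2!mulrDl -/D mulrCA mulfV ?mulr1// gt_eqF.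
  apply: le_lt_trans (le_normcD _ _) _.
  apply: ltr_leD.
    apply: le_lt_trans (le_normcB _ _) _; apply: ltr_leD.
      by rewrite Normc.normcM normc_nat ltr_pM2l.
    rewrite (Normc.normcM (_ * _)) (Normc.normcM 2) normc_nat.
    apply: ler_pM; rewrite ?mulr_ge0 ?normc_ge0//; last exact: ltW.
    rewrite ler_pM2l//; apply: le_trans (le_normcD _ _) _.
    by rewrite !normc_ir.
  rewrite (Normc.normcM _ a1) (Normc.normcM ('i * b2%:C)) !normc_ir ler_wpM2l ?mulr_ge0//.
  exact: ltW.
by move: upper; rewrite E => /(le_lt_trans lower); rewrite ltxx.
Qed.

End exponential_sums.

(** * Derivatives and orders of vanishing of exponential sums *)

Section complex_derivative.
Context {R : realType}.
Local Notation C := (R[i] : numFieldType).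
Implicit Types (z w : R[i]) (s : seq (R[i] * R)).

Lemma norm_normc z : `|z| = (normc z)%:C.
Proof. by rewrite complex.normc_def; case: z. Qed.

Lemma derive1_quadratic (f : C -> C) z (a : R[i]) (K : R) :
  (forall w, normc w <= 1 -> normc (f (z + w) - (f z + a * w)) <= K * normc w ^+ 2) ->
  derive1 f z = a.
Proof.
move=> fa; rewrite /derive1; apply: cvg_lim => //.
apply/cvgrPdist_le => /= e; rewrite ltcE/= => /andP[/eqP Ie Re0].
have K0 : 0 < `|K| + 1 by rewrite ltr_wpDl.
pose d := Num.min 1 (Re e / (`|K| + 1)).
have d0 : 0 < d by rewrite lt_min ltr01 divr_gt0.
have dC : (0 : R[i]) < d%:C by rewrite ltcR.
near=> h.
have h0 : (h : C) != 0 by near: h; exact: (@nbhs_dnbhs_neq C 0).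
have : `|h| < d%:C by near: h; exact: (@dnbhs0_lt C C).
rewrite norm_normc ltcR lt_min => /andP[h1 hd].
rewrite norm_normc lecE/= Ie eqxx/=.
have nh : 0 < normc h by rewrite normc_gt0.
rewrite -(ler_pM2l nh) -Normc.normcM.
have -> : h * (a - h^-1 *: (f (h + z) - f z)) = - (f (z + h) - (f z + a * h)).
  by rewrite /GRing.scale/= mulrBr mulrA mulfV// mul1r [h + z]addrC; ring.
rewrite normcN; apply: le_trans (fa h (ltW h1)) _.
apply: le_trans (_ : (`|K| + 1) * normc h ^+ 2 <= _).
  apply: ler_wpM2r; first by rewrite exprn_ge0// ltW.
  by rewrite (le_trans (ler_norm _))// lerDl.
rewrite expr2 mulrCA ler_pM2l// mulrC -ler_pdivlMr//.
exact: ltW.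
Unshelve. all: by end_near. Qed.

Let dterms s : seq (R[i] * R) := [seq (p.1 * ('i * p.2%:C), p.2) | p <- s].

Lemma derive1_expsum s : derive1 (expsum s : C -> C) = expsum (dterms s).
Proof.
apply/funext => z.
pose Om := \sum_(p <- s) `|p.2|; pose H := `|Im z|.
have sOm : {in s, forall p, `|p.2| <= Om}.
  move=> p ps; rewrite /Om (big_rem p)//= lerDl.
  by apply: sumr_ge0 => q _.
have Om0 : 0 <= Om by apply: sumr_ge0.
have -> : expsum (dterms s) z = expsum_coef s 1 z.
  rewrite /expsum /dterms big_map; apply: eq_bigr => p _ /=.
  by rewrite expr1 divr1 mulrAC.
apply: (derive1_quadratic (K := expsum_bound s H Om * Om ^+ 2)) => w w1.
have := expsum_taylor Om0 sOm (z := z) 2 (lexx _) w1.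
rewrite exprMn mulrA; apply: le_trans; rewrite le_eqVlt; apply/orP; left; apply/eqP.
congr (normc (_ - _)); rewrite !big_ord_recl big_ord0 addr0 expr0 mulr1 expr1.
congr (_ + _); apply: eq_bigr => p _.
by rewrite expr0 mulr1 divr1.
Qed.

Lemma derive1n_expsum s k : derive1n k (expsum s : C -> C) =
  expsum (iter k dterms s).
Proof.
elim: k => [//|k IH].
by rewrite derive1nS IH derive1_expsum.
Qed.

Lemma derive1n_expsum_coef s k z :
  derive1n k (expsum s : C -> C) z = k`!%:R * expsum_coef s k z.
Proof.
rewrite derive1n_expsum.
have k0 : (k`!%:R : R[i]) != 0 by rewrite pnatr_eq0 -lt0n fact_gt0.
rewrite /expsum_coef mulr_sumr.
transitivity (\sum_(p <- s) p.1 * cexp ('i * p.2%:C * z) * ('i * p.2%:C) ^+ k); last first.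
  by apply: eq_bigr => p _; rewrite mulrCA mulfV// mulr1.
elim: k s {k0} => [|k IH] s.
  by apply: eq_bigr => p _; rewrite expr0 mulr1.
rewrite iterSr IH /dterms big_map; apply: eq_bigr => p _ /=.
by rewrite exprS; ring.
Qed.

(** Derivatives of order below [m] vanish, so any nonzero Taylor coefficient caps [m]; with
    [delta_coef_ge] this limits the multiplicities of the zeros of [Delta_0] to 3. *)
Lemma vanishing_order_expsum s z m : vanishing_order (expsum s) z m ->
  (expsum s z == 0) = (0 < m)%N /\
  forall k, expsum_coef s k z != 0 -> (m <= k)%N.
Proof.
move=> [h1 h2]; split.
  case: m h1 h2 => [|m] h1 h2; first exact/negbTE.
  by apply/eqP; exact: (h1 0%N).
move=> k; apply: contraNT; rewrite -ltnNge => /h1.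
rewrite derive1n_expsum_coef => /eqP; rewrite mulf_eq0 pnatr_eq0.
by rewrite -leqn0 leqNgt fact_gt0.
Qed.

End complex_derivative.

(** * Lower bounds and zeros of the unperturbed determinant *)

Section delta_zero_set.
Context {R : realType}.
Implicit Types (z w lam : R[i]).
Variables (b1 b2 : R) (A : 'M[R[i]]_(2, 4)).
Hypotheses (b10 : b1 < 0) (b20 : 0 < b2) (reg : regular_bc A).

Let J32 : bc_minor A 2%:R 1 != 0.
Proof. by move: reg; rewrite /regular_bc mulf_eq0 negb_or => /andP[]. Qed.

Let J14 : bc_minor A 0 3%:R != 0.
Proof. by move: reg; rewrite /regular_bc mulf_eq0 negb_or => /andP[]. Qed.

(** With |e1| large and |e2| small, all terms except p1 e1 together are at most th M |e1|, hence at
    most |p1| |e1|/2. The other half of |p1| |e1| pays for the sum |e1| + |e2|, as |e2| does not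
    exceed |e1|. *)
Lemma dominant_term (p0 p12 p1 p2 : R[i]) : p1 != 0 -> exists2 th, 0 < th &
  forall e1 e2 : R[i], 1 <= th * normc e1 -> normc e2 <= th ->
    normc p1 / 4 * (normc e1 + normc e2) <= normc (p0 + p12 * (e1 * e2) + p1 * e1 + p2 * e2).
Proof.
move=> p10; pose M := normc p0 + normc p12 + normc p2.
have np0 := normc_ge0 p0; have np12 := normc_ge0 p12; have np2 := normc_ge0 p2.
have M0 : 0 <= M by rewrite !addr_ge0.
have np1 : 0 < normc p1 by rewrite normc_gt0.
pose th := Num.min 1 (normc p1 / (2 * (M + 1))).
have th0 : 0 < th by rewrite lt_min ltr01 divr_gt0// mulr_gt0// ltr_wpDl.
have th1 : th <= 1 by rewrite ge_min lexx.
have thM : th * (M + 1) <= normc p1 / 2.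
  apply: le_trans (_ : normc p1 / (2 * (M + 1)) * (M + 1) <= _).
    by rewrite ler_wpM2r ?addr_ge0// ge_min lexx orbT.
  rewrite le_eqVlt; apply/orP; left; apply/eqP; field.
  by rewrite gt_eqF// ltr_wpDl.
exists th => // e1 e2; set X := normc e1; set Y := normc e2 => hX hY.
have X0 : 0 <= X by exact: normc_ge0.
have Y0 : 0 <= Y by exact: normc_ge0.
have low : normc p1 * X - (normc p0 + normc p12 * (X * Y) + normc p2 * Y) <=
    normc (p0 + p12 * (e1 * e2) + p1 * e1 + p2 * e2).
  have -> : p0 + p12 * (e1 * e2) + p1 * e1 + p2 * e2 =
    p1 * e1 - (- (p0 + p12 * (e1 * e2) + p2 * e2)) by ring.
  apply: le_trans (le_normc_sub _ _); rewrite normcN Normc.normcM lerD2l lerN2.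
  apply: le_trans (le_normcD _ _) _; rewrite Normc.normcM; apply: lerD => //.
  by apply: le_trans (le_normcD _ _) _; rewrite !Normc.normcM.
apply: le_trans low.
have hY1 : Y <= th * X := le_trans hY (le_trans th1 hX).
have hXY : X * Y <= th * X by rewrite mulrC ler_wpM2r.
have s1 : normc p0 <= normc p0 * (th * X) by rewrite ler_peMr.
have s2 : normc p12 * (X * Y) <= normc p12 * (th * X) by rewrite ler_wpM2l.
have s3 : normc p2 * Y <= normc p2 * (th * X) by rewrite ler_wpM2l.
have YX : Y <= X by apply: le_trans hY1 _; rewrite ler_piMl.
have thX : 0 <= th * X by rewrite mulr_ge0// ltW.
have := ler_wpM2r X0 thM.
have s4 : normc p0 * (th * X) + normc p12 * (th * X) + normc p2 * (th * X) = M * (th * X).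
  by rewrite -!mulrDl.
have := ler_wpM2l (ltW np1) YX; lra.
Qed.

Lemma exp_large (b th : R) : 0 < b -> 0 < th -> exists2 H, 0 < H &
  forall y, H <= y -> 1 <= th * expR (b * y).
Proof.
move=> b0 th0; exists (th^-1 / b); first by rewrite divr_gt0// invr_gt0.
move=> y; rewrite ler_pdivrMr// => h.
rewrite -(mulfV (lt0r_neq0 th0)) ler_pM2l//.
apply: le_trans h _; rewrite mulrC; apply: le_trans (expR_ge1Dx _).
by rewrite lerDr.
Qed.

Lemma growth_ge1 lam : 1 <= growth b1 b2 lam.
Proof.
rewrite /growth; have [I0|I0] := leP 0 (Im lam).
  apply: le_trans (_ : expR (- b1 * Im lam) <= _); last by rewrite lerDl expR_ge0.
  by rewrite -(expR0 R) ler_expR mulr_ge0// oppr_ge0 ltW.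
apply: le_trans (_ : expR (- b2 * Im lam) <= _); last by rewrite lerDr expR_ge0.
by rewrite -(expR0 R) ler_expR mulNr oppr_ge0 mulr_ge0_le0 ?ltW.
Qed.

Lemma growth_gt0 lam : 0 < growth b1 b2 lam.
Proof. exact: lt_le_trans ltr01 (growth_ge1 lam). Qed.

Lemma normc_cexp_ir (b : R) lam : normc (cexp ('i * b%:C * lam)) = expR (- b * Im lam).
Proof. by rewrite normc_cexp Re_ir mulNr. Qed.

(** The term with J_32 dominates high in the upper half-plane and the term with J_14 deep in the
    lower one; both minors are nonzero by regularity. *)
Lemma delta_dominance : exists H, exists2 c, 0 < c & 0 < H /\
  forall lam, H <= `|Im lam| -> c * growth b1 b2 lam <= normc (Delta0 b1 b2 A lam).
Proof.
have [t1 t10 h1] := dominant_term (bc_minor A 0 1) (bc_minor A 2%:R 3%:R) (bc_minor A 0 3%:R)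
  J32.
have [t2 t20 h2] := dominant_term (bc_minor A 0 1) (bc_minor A 2%:R 3%:R) (bc_minor A 2%:R 1)
  J14.
have nb1 : 0 < - b1 by rewrite oppr_gt0.
have [H1 H10 g1] := exp_large nb1 t10; have [H2 H20 g2] := exp_large b20 t10.
have [H3 H30 g3] := exp_large b20 t20; have [H4 H40 g4] := exp_large nb1 t20.
exists (H1 + H2 + H3 + H4).
pose c1 := normc (bc_minor A 2%:R 1) / 4; pose c2 := normc (bc_minor A 0 3%:R) / 4.
have c10 : 0 < c1 by rewrite divr_gt0// normc_gt0.
have c20 : 0 < c2 by rewrite divr_gt0// normc_gt0.
exists (Num.min c1 c2); first by rewrite lt_min c10.
split; first by rewrite !addr_gt0.
have small b t y : 0 < t -> 1 <= t * expR (b * y) -> expR (- (b * y)) <= t.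
  by move=> t0 h; rewrite expRN -div1r ler_pdivrMr ?expR_gt0.
move=> lam; have g0 := growth_gt0 lam.
have exp_add : cexp ('i * (b1 + b2)%:C * lam) =
  cexp ('i * b1%:C * lam) * cexp ('i * b2%:C * lam).
  by rewrite -cexpD rmorphD/=; congr cexp; ring.
have gE : growth b1 b2 lam = normc (cexp ('i * b1%:C * lam)) + normc (cexp ('i * b2%:C * lam)).
  by rewrite !normc_cexp_ir.
have [I0|I0] := leP 0 (Im lam).
  rewrite ger0_norm// => hI; apply: le_trans (_ : c1 * growth b1 b2 lam <= _).
    by rewrite ler_pM2r// ge_min lexx.
  rewrite /Delta0 exp_add gE; apply: h1; rewrite normc_cexp_ir.
    by apply: g1; lra.
  by rewrite mulNr; apply: small => //; apply: g2; lra.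
move=> hI; apply: le_trans (_ : c2 * growth b1 b2 lam <= _).
  by rewrite ler_pM2r// ge_min lexx orbT.
rewrite /Delta0 exp_add gE addrAC [cexp _ * cexp _]mulrC [normc (cexp _) + _]addrC.
have NI : `|Im lam| = - Im lam by rewrite ltr0_norm.
apply: h2; rewrite normc_cexp_ir.
  by rewrite mulNr -mulrN -NI; apply: g3; lra.
have -> : - b1 * Im lam = - (- b1 * `|Im lam|) by rewrite NI; ring.
by apply: small => //; apply: g4; lra.
Qed.

Lemma delta_tame (H : R) : 0 <= H -> exists S Om sig : R, exists a : nat -> R[i] -> R[i],
  [/\ [/\ 0 < S, 1 <= Om & 0 < sig],
   (forall z n w, `|Im z| <= H -> normc w <= 1 ->
     normc (Delta0 b1 b2 A (z + w) - \sum_(k < n) a k z * w ^+ k) <= S * (Om * normc w) ^+ n),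
   (forall z k, `|Im z| <= H -> normc (a k z) <= S) &
   (forall z, `|Im z| <= H -> exists k, (0 < k < 4)%N /\ sig <= normc (a k z))].
Proof.
move=> H0; have [sig sig0 hsig] := delta_coef_ge b10 b20 J32 H0.
have sOm := @delta_freq R b1 b2 A; set Om := 1 + `|b1| + `|b2| in sOm.
have Om1 : 1 <= Om by rewrite /Om -addrA lerDl addr_ge0.
have Om0 : 0 <= Om by apply: le_trans Om1.
exists (expsum_bound (delta_terms b1 b2 A) H Om), Om, sig, (expsum_coef (delta_terms b1 b2 A)).
split => //.
- by split => //; exact: expsum_bound_gt0.
- by move=> z n w zH w1; rewrite Delta0E; exact: expsum_taylor.
- by move=> z k; exact: expsum_coef_le.
Qed.

Lemma delta_lower (eps : R) : 0 < eps -> exists2 C, 0 < C & forall lam,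
  (forall z, Delta0 b1 b2 A z = 0 -> eps <= normc (lam - z)) ->
  C * growth b1 b2 lam <= normc (Delta0 b1 b2 A lam).
Proof.
move=> eps0; have [H [c c0 [H0 dom]]] := delta_dominance.
(* [zero_finder] loses one unit of height, since it searches a unit box around [lam]. *)
have H1 : 0 <= H + 1 by rewrite addr_ge0// ltW.
have [S [Om [sig [a [[S0 Om1 sig0] t1 t2 t3]]]]] := delta_tame H1.
have [d d0 hd] := zero_finder S0 Om1 sig0 t1 t3 eps0.
pose G := expR (- b1 * H) + expR (b2 * H).
have G0 : 0 < G by rewrite addr_gt0 ?expR_gt0.
exists (Num.min c (d / G)); first by rewrite lt_min c0 divr_gt0.
move=> lam far; have g0 := growth_gt0 lam.
have [hH|hH] := leP H `|Im lam|.
  by apply: le_trans (dom _ hH); rewrite ler_pM2r// ge_min lexx.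
have dl : d <= normc (Delta0 b1 b2 A lam).
  rewrite leNgt; apply/negP => h.
  have [|z fz] := hd lam _ h; first by rewrite addrK ltW.
  by rewrite normcB ltNge far.
apply: le_trans dl; apply: le_trans (_ : d / G * growth b1 b2 lam <= _).
  by rewrite ler_pM2r// ge_min lexx orbT.
rewrite -[leRHS]mulr1 -mulrA ler_pM2l// mulrC ler_pdivrMr// mul1r.
move: hH; rewrite ltr_norml => /andP[h1 h2].
rewrite /growth /G; apply: lerD; rewrite ler_expR.
  by apply: ler_wpM2l; [rewrite oppr_ge0 ltW|exact: ltW].
by rewrite mulNr -mulrN; apply: ler_wpM2l; [exact: ltW|lra].
Qed.

Lemma delta_strip : exists2 h, 0 < h & forall z, Delta0 b1 b2 A z = 0 -> `|Im z| <= h.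
Proof.
have [H [c c0 [H0 dom]]] := delta_dominance.
exists H => // z fz; rewrite leNgt; apply/negP => /ltW/dom.
by rewrite fz normc0 leNgt mulr_gt0// growth_gt0.
Qed.

Lemma delta_few_zeros (h : R) : 0 <= h -> exists2 rho, 0 < rho & forall z0 (ws : seq R[i]),
  `|Im z0| <= h -> uniq ws ->
  {in ws, forall w, Delta0 b1 b2 A w = 0 /\ normc (w - z0) <= rho} -> (size ws <= 3)%N.
Proof.
move=> h0; have [S [Om [sig [a [[S0 Om1 sig0] t1 t2 t3]]]]] := delta_tame h0.
exact: few_zeros S0 Om1 sig0 t1 t2 t3.
Qed.

Lemma delta_vanishing_order z m : vanishing_order (Delta0 b1 b2 A) z m ->
  (Delta0 b1 b2 A z == 0) = (0 < m)%N /\ (m <= 3)%N.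
Proof.
have -> : Delta0 b1 b2 A = expsum (delta_terms b1 b2 A).
  by apply/funext => w; rewrite Delta0E.
move=> /vanishing_order_expsum[-> hm]; split => //.
have [sig sig0 /(_ z (lexx _))] := delta_coef_ge b10 b20 J32 (normr_ge0 (Im z)).
move=> [k [/andP[_ k4] hk]]; apply: leq_trans (hm k _) _; last by rewrite -ltnS.
by rewrite -normc_gt0 (lt_le_trans sig0).
Qed.

End delta_zero_set.

(** * Cardinality bounds *)

Section counting.

(** Duplicate-free lists allow pigeonhole arguments without first proving that the set is finite;
    finiteness is recovered in [count_bound_card]. *)
Definition count_bound (T : eqType) (S : set T) (d : nat) : Prop :=
  forall s : seq T, uniq s -> {in s, forall x, S x} -> (size s <= d)%N.

Lemma count_bound_sub (T : eqType) (S S' : set T) d :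
  (forall x, S x -> S' x) -> count_bound S' d -> count_bound S d.
Proof. by move=> SS' h s us hs; apply: h => // x /hs/SS'. Qed.

Lemma count_bound_fiber (T : eqType) (g : T -> nat) (N c : nat) (S : set T) :
  (forall x, S x -> (g x < N)%N) ->
  (forall i, (i < N)%N -> count_bound [set x | S x /\ g x = i] c) ->
  count_bound S (N * c).
Proof.
elim: N S => [|N IH] S gN hc s us hs.
  by case: s us hs => [//|x s] _ /(_ x (mem_head x s))/gN.
rewrite -(count_predC (fun x => g x < N)%N s) mulSn addnC -!size_filter leq_add//.
  apply: (hc N) => //; first exact: filter_uniq.
  move=> x; rewrite mem_filter /= -leqNgt => /andP[Nx /hs Sx]; split => //.
  by apply/eqP; rewrite eqn_leq Nx andbT -ltnS gN.
apply: (IH [set x | S x /\ (g x < N)%N]); [by move=> x []|..].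
- move=> i iN; apply: count_bound_sub (hc i (leqW iN)) => x [[Sx _] gx].
  by split.
- exact: filter_uniq.
- by move=> x; rewrite mem_filter => /andP[gx /hs Sx].
Qed.

Lemma card_le_count_bound (T : eqType) (S : set T) d :
  (S #<= `I_d)%card -> count_bound S d.
Proof.
move=> Sd [//|x0 s] us hs; rewrite -card_le_II; apply: card_le_trans Sd.
have inj : {in `I_(size (x0 :: s)) &, injective (nth x0 (x0 :: s))}.
  move=> i j /set_mem iS /set_mem jS /eqP; rewrite nth_uniq//.
  by move/eqP.
rewrite -(card_le_eql (inj_card_eq inj)).
by apply: subset_card_le => _ [i iS <-]; apply/hs/mem_nth.
Qed.

Lemma count_bound_card (T : choiceType) (S : set T) d :
  count_bound S d -> (S #<= `I_d)%card.
Proof.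
move=> h; have [/finite_seqP[s Ss]|/(@infinite_set_fset _ _ d.+1)[B BS dB]] :=
  pselect (finite_set S).
  have hd : (size (undup s) <= d)%N.
    by apply: h => [|x]; [exact: undup_uniq|rewrite mem_undup Ss].
  case: s Ss hd => [|x0 s] Ss hd; first by rewrite Ss set_nil card_ge0.
  apply: card_le_trans (_ : (`I_(size (undup (x0 :: s))) #<= `I_d)%card);
    last by rewrite card_le_II.
  apply: card_le_trans (card_image_le (nth x0 (undup (x0 :: s))) _).
  apply: subset_card_le => x; rewrite Ss /= -mem_undup => xs.
  by exists (index x (undup (x0 :: s))); [rewrite /= index_mem|rewrite nth_index].
have := h (finmap.enum_fset B) (finmap.fset_uniq B).
move=> /(_ (fun x xB => BS x xB)) /leq_ltn_trans/(_ dB).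
by rewrite ltnn.
Qed.

End counting.

(** * Density of the zeros of the unperturbed determinant *)

Section density.
Context {R : realType}.
Variables (b1 b2 : R) (A : 'M[R[i]]_(2, 4)) (u : int -> R[i]).
Hypotheses (b10 : b1 < 0) (b20 : 0 < b2) (reg : regular_bc A).
Hypothesis hu : zeros_of (Delta0 b1 b2 A) u.

Lemma zeros_of_zero n : Delta0 b1 b2 A (u n) = 0.
Proof.
have [m /(delta_vanishing_order b10 b20 reg)[h _] hm] := hu (u n).
apply/eqP; rewrite h lt0n; apply/eqP => m0; move: hm; rewrite m0 II0 card_eq0.
by move=> /eqP h'; have : [set k | u k = u n] n by []; rewrite h'.
Qed.

Lemma zeros_of_surj z : Delta0 b1 b2 A z = 0 -> exists n, u n = z.
Proof.
move=> fz; have [m /(delta_vanishing_order b10 b20 reg)[h _] hm] := hu z.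
move: h; rewrite fz eqxx => /esym m0.
have [//|n0] := pselect (exists n, u n = z).
have E : [set n | u n = z] = set0.
  by rewrite -subset0 => n un; apply: n0; exists n.
move: hm; rewrite E => /card_esym; rewrite card_eq0 => /eqP Im.
by have : `I_m 0%N by []; rewrite Im.
Qed.

Lemma zeros_of_fiber z : count_bound [set n | u n = z] 3.
Proof.
have [m /(delta_vanishing_order b10 b20 reg)[_ m3] hm] := hu z.
have /card_le_count_bound h : ([set n | u n = z] #<= `I_m)%card by move: hm;
  rewrite card_eq_le => /andP[].
by move=> s us hs; apply: leq_trans m3; exact: h.
Qed.

(* Cells of side [rho / 2] contain at most three distinct zeros. *)
Lemma zeros_density (T : R) : 0 < T -> exists d : nat, forall t : R,
  count_bound [set n | `|Re (u n) - t| <= T] d.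
Proof.
move=> T0; have [h h0 strip] := delta_strip b10 b20 reg.
have [rho rho0 few] := delta_few_zeros b10 b20 reg (ltW h0).
pose step := rho / 2; have st0 : 0 < step by rewrite divr_gt0.
pose cell (c L : R) (x : R) : nat := Num.truncn ((x - c) / step).
have cellN (c L x : R) : 0 <= x - c <= L -> (cell c L x < (Num.truncn (L / step)).+1)%N.
  move=> /andP[x0 xL]; rewrite ltnS; apply: le_truncn.
  by rewrite ler_pM2r// invr_gt0.
have cell_near (c L x y : R) : 0 <= x - c -> 0 <= y - c -> cell c L x =
  cell c L y -> `|x - y| <= step.
  move=> x0 y0; rewrite /cell => E.
  have x1 : 0 <= (x - c) / step by rewrite divr_ge0// ltW.
  have y1 : 0 <= (y - c) / step by rewrite divr_ge0// ltW.
  have /andP[a1 a2] := truncn_itv x1; have /andP[a3 a4] := truncn_itv y1.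
  rewrite E -natr1 in a1 a2; rewrite -natr1 in a4.
  rewrite ler_pdivlMr// in a1; rewrite ltr_pdivrMr// in a2.
  rewrite ler_pdivlMr// in a3; rewrite ltr_pdivrMr// in a4.
  by rewrite ler_norml; apply/andP; split; lra.
(* The factors count the cells in the real direction, those in the imaginary direction, the distinct
   zeros in a cell, and the indices of one zero. *)
exists ((Num.truncn (2 * T / step)).+1 * ((Num.truncn (2 * h / step)).+1 * (3 * 3)))%N => t.
apply: (@count_bound_fiber _ (fun n => cell (t - T) (2 * T) (Re (u n)))).
  move=> n /=; rewrite ler_norml => /andP[? ?]; apply: cellN.
  by apply/andP; split; lra.
move=> i _; apply: (@count_bound_fiber _ (fun n => cell (- h) (2 * h) (Im (u n)))).
  move=> n _; have := strip _ (zeros_of_zero n); rewrite ler_norml => /andP[? ?].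
  by apply: cellN; apply/andP; split; lra.
move=> j _ s us hs.
pose zs := undup [seq u n | n <- s].
have zs3 : (size zs <= 3)%N.
  case: (posnP (size zs)) => [->//|]; case Ezs : zs => [|z0 zs'] // _.
  have z0zs : z0 \in [seq u n | n <- s] by rewrite -mem_undup -/zs Ezs mem_head.
  have /mapP[n0 n0s z0E] := z0zs.
  rewrite -Ezs; apply: (few z0); first by rewrite z0E; apply/strip/zeros_of_zero.
    exact: undup_uniq.
  move=> w; rewrite mem_undup => /mapP[n ns ->]; split; first exact: zeros_of_zero.
  have [[/= n1 n2] n3] := hs n ns; have [[/= m1 m2] m3] := hs n0 n0s.
  apply: le_trans (normc_le_ReIm _) _; rewrite Re_add Im_add Re_opp Im_opp z0E.
  move: n1 m1; rewrite !ler_norml => /andP[? ?] /andP[? ?].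
  have := strip _ (zeros_of_zero n); have := strip _ (zeros_of_zero n0).
  rewrite !ler_norml => /andP[? ?] /andP[? ?].
  rewrite [rho]splitr; apply: lerD.
    by apply: (cell_near (t - T) (2 * T)); rewrite ?n2 ?m2//; lra.
  by apply: (cell_near (- h) (2 * h)); rewrite ?n3 ?m3//; lra.
have cb : count_bound [set n | n \in s] (3 * 3).
  apply: (@count_bound_fiber _ (fun n => index (u n) zs)).
    move=> n ns; apply: leq_trans zs3; rewrite index_mem mem_undup.
    exact: map_f.
  move=> k _; have fib := @zeros_of_fiber (nth 0 zs k).
  apply: (count_bound_sub _ fib) => n [/= ns <-].
  by rewrite nth_index// mem_undup map_f.
exact: cb.
Qed.

End density.

(** * Connected components of unions of discs *)

Section components.
Context {R : realType}.
Implicit Types (z w a b : R[i]) (u : int -> R[i]) (phi : R[i] -> R).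
Local Notation C := (R[i] : numFieldType).

(** Pigeonhole: the interval splits into d + 1 windows of length 2e with disjoint interiors. At most
    d of them contain a point of [p], and the centre of a free window is the level sought. *)
Lemma avoid_level (p : int -> R) (e t : R) (d : nat) : 0 < e ->
  count_bound [set n | t < p n < t + 2 * d.+1%:R * e] d ->
  exists2 s, t < s < t + 2 * d.+1%:R * e & forall n, e <= `|p n - s|.
Proof.
move=> e0 cb; apply: contrapT => ns.
(* The guard on [k] sits under the existential, with the dummy index 0 beyond [d], so that [choice]
   yields a total function. *)
have lev (k : nat) : exists n, (k <= d)%N -> `|p n - (t + (2 * k%:R + 1) * e)| < e.
  have [kd|] := leqP k d; last by exists 0.
  apply: contrapT => nn; apply: ns; exists (t + (2 * k%:R + 1) * e).
    rewrite ltrDl ltrD2l ltr_pM2r// mulr_gt0 ?ltr_wpDl//=.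
    have : (k%:R : R) + 1 <= d.+1%:R by rewrite natr1 ler_nat.
    lra.
  by move=> n; rewrite leNgt; apply/negP => h; apply: nn; exists n.
have [f hf] := choice lev.
have finj : {in iota 0 d.+1 &, injective f}.
  move=> k l; rewrite !mem_iota !add0n !ltnS => kd ld E.
  have := hf _ ld; have := hf _ kd; rewrite E !ltr_norml => /andP[h1 h2] /andP[h3 h4].
  have kl : (2 * k%:R + 1) * e < (2 * l%:R + 1) * e + 2 * e by lra.
  have lk : (2 * l%:R + 1) * e < (2 * k%:R + 1) * e + 2 * e by lra.
  rewrite -mulrDl ltr_pM2r// in kl; rewrite -mulrDl ltr_pM2r// in lk.
  have : (k%:R : R) < l.+1%:R by rewrite -natr1; lra.
  have : (l%:R : R) < k.+1%:R by rewrite -natr1; lra.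
  by rewrite !ltr_nat !ltnS => ? ?; apply/eqP; rewrite eqn_leq; apply/andP.
have := cb [seq f k | k <- iota 0 d.+1].
rewrite map_inj_in_uniq// iota_uniq size_map size_iota ltnn => /(_ isT) h.
suff: false by [].
apply: h => n /mapP[k]; rewrite mem_iota add0n ltnS => kd -> /=.
have := hf k kd; rewrite ltr_norml => /andP[h1 h2].
have k0 : 0 <= 2 * k%:R * e by rewrite !mulr_ge0 ?(ltW e0).
have : (2 * k%:R + 2) * e <= 2 * d.+1%:R * e.
  rewrite ler_pM2r//; have : (k%:R : R) + 1 <= d.+1%:R by rewrite natr1 ler_nat.
  lra.
by move=> ?; apply/andP; split; lra.
Qed.

Lemma lipschitz_continuous phi : (forall z w, `|phi z - phi w| <= normc (z - w)) ->
  continuous (phi : C -> R).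
Proof.
move=> lip z; apply/(@cvgrPdist_lt _ _ _ (nbhs (z : C)) (nbhs_filter (z : C))) => /= e e0.
have eC : (0 : C) < e%:C by rewrite ltcR.
near=> w; apply: le_lt_trans (lip _ _) _.
by rewrite -ltcR -norm_normc; near: w; exact: (@cvgr_dist_lt _ _ _ (nbhs z) _ id).
Unshelve. all: by end_near. Qed.

Lemma connected_below (S : set C) (phi : C -> R) a b (s : R) : continuous phi ->
  connected_component S a b -> (forall w, S w -> phi w != s) ->
  phi a < s -> phi b < s.
Proof.
move=> phic [B [Ba BS cB] Bb] Ss pas; rewrite ltNge; apply/negP => spb.
have /connected_intervalP I : connected (phi @` B).
  by apply: connected_continuous_connected => //; exact: continuous_subspaceT.
have [w Bw ws] : (phi @` B) s.
  by apply: (I (phi a) (phi b)); [exists a|exists b|rewrite (ltW pas)].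
by have := Ss _ (BS _ Bw); rewrite ws eqxx.
Qed.

(** A level [s] at distance at least [eps] from every [phi (u n)] is not attained on any disc of
    radius [eps], because [phi] is 1-Lipschitz; a connected subset of [Omega] cannot cross it. *)
Lemma component_below u phi (eps M s : R) a b :
  (forall z w, `|phi z - phi w| <= normc (z - w)) ->
  (forall n, eps <= `|phi (u n) - s|) -> (forall w, normc w < M -> phi w != s) ->
  connected_component (Omega u eps M : set C) a b -> phi a < s -> phi b < s.
Proof.
move=> lip hu hM ab; apply: connected_below ab _; first exact: lipschitz_continuous.
move=> w [|[n _]]; rewrite /disc/=; first by rewrite subr0; exact: hM.
move=> wn; apply/eqP => E; have := hu n; rewrite leNgt => /negP; apply.
by rewrite -E distrC; apply: le_lt_trans (lip _ _) wn.
Qed.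

Lemma Re_lipschitz z w : `|Re z - Re w| <= normc (z - w).
Proof. by rewrite -Re_opp -Re_add Re_le_normc. Qed.

Lemma dist_lipschitz c z w : `|normc (z - c) - normc (w - c)| <= normc (z - w).
Proof.
have -> : z - w = (z - c) - (w - c) by ring.
rewrite ler_norml le_normc_sub andbT lerNl opprB [leRHS]normcB.
exact: le_normc_sub.
Qed.

Variables (u : int -> R[i]) (d : nat).
Hypothesis ud : forall t : R, count_bound [set n | `|Re (u n) - t| <= 1] d.

Let d1 : 0 < 2 * d.+1%:R :> R. Proof. by rewrite mulr_gt0. Qed.

(** The barrier is a circle around [u n] of radius below [eps]. As [eps] is at most 1, the density
    bound leaves at most [d] radii to avoid, which is why the discs are shrunk by the factor 2(d +
    1); the lower bound on |u n| keeps the circle off the central disc. *)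
Lemma component_small (eps M : R) n b : 0 < eps -> eps <= 1 ->
  M + eps <= normc (u n) ->
  connected_component (Omega u (eps / (2 * d.+1%:R)) M : set C) (u n) b ->
  normc (b - u n) < eps.
Proof.
move=> e0 e1 Mn cb; set e := eps / _ in cb.
have e_gt0 : 0 < e by rewrite divr_gt0.
have eE : 2 * d.+1%:R * e = eps by rewrite /e mulrCA mulfV ?mulr1// gt_eqF.
have [|s] := @avoid_level (fun k => normc (u k - u n)) e 0 d e_gt0.
  apply: (count_bound_sub _ (@ud (Re (u n)))) => k /=; rewrite add0r eE => /andP[_ h].
  by apply: le_trans (Re_lipschitz _ _) _; apply: le_trans e1; exact: ltW.
rewrite add0r eE => /andP[s0 se] hs.
apply: lt_trans (se); apply: (component_below (dist_lipschitz (u n)) hs _ cb).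
  move=> w wM; rewrite gt_eqF//; apply: lt_trans se _.
  by have := le_normc_sub (u n) w; rewrite [normc (u n - w)]normcB; lra.
by rewrite subrr normc0.
Qed.

Lemma component_bounded (M h : R) n b : 0 < M -> (forall k, `|Im (u k)| <= h) ->
  connected_component (Omega u (2 * d.+1%:R)^-1 M : set C) (u n) b ->
  `|Re b - Re (u n)| <= 2 * M + 3 /\ `|Im b| <= M + h + 1.
Proof.
move=> M0 hI cb; set e := _^-1 in cb.
have e_gt0 : 0 < e by rewrite invr_gt0.
have eE : 2 * d.+1%:R * e = 1 by rewrite mulfV ?gt_eqF.
have h0 : 0 <= h by apply: le_trans (hI 0).
(* The barrier is a vertical line with abscissa in (t, t + 1). The condition on [t] keeps it off the
   central disc, and the density bound is applied at the midpoint t + 1/2. *)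
have right t : M <= t \/ t + 1 <= - M -> Re (u n) <= t -> Re b < t + 1.
  move=> Mt nt; have [|s] := @avoid_level (fun k => Re (u k)) e t d e_gt0.
    apply: (count_bound_sub _ (@ud (t + 2^-1))) => k /=; rewrite eE => /andP[? ?].
    by rewrite ler_norml; apply/andP; split; lra.
  rewrite eE => /andP[ts st] hs; apply: lt_trans (st).
  apply: (component_below Re_lipschitz hs _ cb); last exact: le_lt_trans ts.
  move=> w wM; have := Re_le_normc w; rewrite ler_norml => /andP[w1 w2].
  by apply/eqP => E; case: Mt => Mt; lra.
have Ren_lip z w : `|- Re z - - Re w| <= normc (z - w).
  by rewrite -opprD normrN; exact: Re_lipschitz.
have left t : M <= t \/ t + 1 <= - M -> - Re (u n) <= t -> - Re b < t + 1.
  move=> Mt nt; have [|s] := @avoid_level (fun k => - Re (u k)) e t d e_gt0.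
    apply: (count_bound_sub _ (@ud (- (t + 2^-1)))) => k /=; rewrite eE => /andP[? ?].
    by rewrite ler_norml; apply/andP; split; lra.
  rewrite eE => /andP[ts st] hs; apply: lt_trans (st).
  apply: (component_below Ren_lip hs _ cb); last exact: le_lt_trans ts.
  move=> w wM; have := Re_le_normc w; rewrite ler_norml => /andP[w1 w2].
  by apply/eqP => E; case: Mt => Mt; lra.
(* A barrier within distance 1 of [u n] exists unless the central disc is in the way; otherwise it
   is placed just beyond that disc, at distance at most 2M + 2. *)
split.
  rewrite ler_norml; apply/andP; split.
    have [hn|hn] := leP (Re (u n)) (M + 1).
      have [hn'|hn'] := leP (- Re (u n)) M.
        have : - Re b < M + 1 by apply: left => //; left.
        lra.
      have : - Re b < - Re (u n) + 1 by apply: left => //; left; exact: ltW.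
      lra.
    have : - Re b < - Re (u n) + 1 by apply: left => //; right; lra.
    lra.
  have [hn|hn] := leP (- Re (u n)) (M + 1).
    have [hn'|hn'] := leP (Re (u n)) M.
      have : Re b < M + 1 by apply: right => //; left.
      lra.
    have : Re b < Re (u n) + 1 by apply: right => //; left; exact: ltW.
    lra.
  have : Re b < Re (u n) + 1 by apply: right => //; right; lra.
  lra.
have : Omega u e M b by move: cb => [B [_ BS _] Bb]; exact: BS.
case=> [|[k _]]; rewrite /disc/=.
  rewrite subr0 => /ltW hb; apply: le_trans (Im_le_normc _) _.
  by apply: le_trans hb _; lra.
move=> /ltW hb; have := le_trans (Im_le_normc _) hb; rewrite Im_add Im_opp.
have e1 : e <= 1 by rewrite invf_le1 ?d1// -natrM ler1n muln_gt0.
have := hI k; rewrite !ler_norml => /andP[? ?] /andP[? ?].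
by apply/andP; split; lra.
Qed.

End components.

(** * Uniform localization and asymptotics of the zeros *)

Section proposition.
Context {R : realType}.
Variables (b1 b2 : R) (A : 'M[R[i]]_(2, 4)) (u : int -> R[i]).
Hypotheses (b10 : b1 < 0) (b20 : 0 < b2) (reg : regular_bc A).
Hypothesis hu : zeros_of (Delta0 b1 b2 A) u.

(** An error below C/3 times [growth] leaves |Delta_Q| at least 2C/3 times [growth], strictly above
    C/2 times it. The constant is produced before [K], and only the radius [M] depends on the
    compact set. *)
Lemma localizes_compact (eps : R) : 0 < eps -> exists2 C, 0 < C &
  forall K : set (potential R), compact K -> exists2 M, 0 < M &
    forall Q Delta, K Q -> is_char_det b1 b2 A Q Delta ->
      localizes b1 b2 Delta (Delta0 b1 b2 A) u eps M C.
Proof.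
move=> eps0; have [C C0 low] := delta_lower b10 b20 reg eps0.
exists (C / 2); first by rewrite divr_gt0.
move=> K cK; have C3 : 0 < C / 3 by rewrite divr_gt0.
have [M M0 HM] := char_det_compact A b10 b20 cK C3.
exists M => // Q Delta KQ cd lam lamO.
have Ml : M <= normc lam.
  by rewrite leNgt; apply/negP => h; apply: lamO; left; rewrite /disc/= subr0.
have {}low : C * growth b1 b2 lam <= normc (Delta0 b1 b2 A lam).
  apply: low => z /(zeros_of_surj b10 b20 reg hu)[n <-].
  by rewrite leNgt; apply/negP => h; apply: lamO; right; exists n.
have := HM Q Delta lam KQ cd Ml; have g0 := growth_gt0 b10 b20 lam.
have Cg : 0 < C * growth b1 b2 lam by rewrite mulr_gt0.
have tri : normc (Delta0 b1 b2 A lam) - normc (Delta lam) <= normc (Delta lam - Delta0 b1 b2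
  A lam).
  by rewrite [leRHS]normcB le_normc_sub.
rewrite -/(growth b1 b2 lam) => h; split; lra.
Qed.

Lemma count_bound_finite (S : set int) d : count_bound S d ->
  exists N : nat, forall n, S n -> (`|n| <= N)%N.
Proof.
move=> /count_bound_card Sd.
have /finite_seqP[s Ss] : finite_set S by apply: card_le_finite Sd _; exact: finite_II.
exists (\max_(n <- s) `|n|)%N => n; rewrite Ss /= => ns.
exact: (leq_bigmax_seq (F := fun n : int => `|n|%N) n ns).
Qed.

Lemma zeros_far (T : R) : exists N : nat, forall n : int, (N < `|n|)%N -> T < `|Re (u n)|.
Proof.
have T0 : 0 < `|T| + 1 by rewrite ltr_wpDl.
have [d hd] := zeros_density b10 b20 reg hu T0.
have [N hN] := count_bound_finite (@hd 0).
exists N => n; apply: contraTT; rewrite -leqNgt -leNgt => h; apply: hN.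
rewrite /= subr0; apply: le_trans h _; apply: le_trans (ler_norm _) _.
by rewrite lerDl.
Qed.

(** Strict regularity says nothing about indices up to [n0]; this bound keeps their discs away from
    the circles of large index. *)
Lemma zeros_bounded_near (n0 : nat) : exists B : R, forall n : int, (`|n| <= n0)%N -> `|Re (u
  n)| <= B.
Proof.
exists (\sum_(k < n0.+1) (`|Re (u k%:Z)| + `|Re (u (- k%:Z))|)) => n nn0.
have kn : (`|n| < n0.+1)%N by [].
rewrite (bigD1 (Ordinal kn))//=; apply: le_trans (_ : `|Re (u `|n|%:Z)| +
  `|Re (u (- `|n|%:Z))| <= _).
  by case: (intP n) => [|k|k]; rewrite ?lerDl// abszN lerDr.
by rewrite lerDl; apply: sumr_ge0 => k _; rewrite addr_ge0.
Qed.

Lemma uniform_location (K : set (potential R)) : compact K ->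
  (exists M : R, 0 < M /\
    forall Q Delta lamQ, K Q -> is_char_det b1 b2 A Q Delta ->
      canonically_ordered b1 b2 Delta (Delta0 b1 b2 A) u lamQ ->
      forall n, normc (lamQ n - u n) <= M) /\
  (exists (h : R) (d : nat), 0 < h /\
    forall Q Delta lamQ, K Q -> is_char_det b1 b2 A Q Delta ->
      canonically_ordered b1 b2 Delta (Delta0 b1 b2 A) u lamQ ->
      incompressible lamQ d /\ forall n, `|Im (lamQ n)| <= h).
Proof.
move=> cK; have [d ud] := zeros_density b10 b20 reg hu ltr01.
have [h h0 strip] := delta_strip b10 b20 reg.
have eps0 : 0 < (2 * d.+1%:R)^-1 :> R by rewrite invr_gt0 mulr_gt0.
have [C C0 /(_ K cK)[M M0 loc]] := localizes_compact eps0.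
have bound Q Delta lamQ : K Q -> is_char_det b1 b2 A Q Delta ->
    canonically_ordered b1 b2 Delta (Delta0 b1 b2 A) u lamQ ->
    forall n, `|Re (lamQ n) - Re (u n)| <= 2 * M + 3 /\ `|Im (lamQ n)| <= M + h + 1.
  move=> KQ cd [_ co] n; apply: (component_bounded ud M0).
    by move=> k; apply: strip; exact: zeros_of_zero hu k.
  exact: co eps0 M0 C0 (loc _ _ KQ cd) n.
split.
  (* The sum of 2M + 3 for the real parts, M + h + 1 for Im (lamQ n) and h for Im (u n). *)
  exists (3 * M + 2 * h + 4); split; first by rewrite !addr_gt0 ?mulr_gt0.
  move=> Q Delta lamQ KQ cd co n; have [hR hI] := bound Q Delta lamQ KQ cd co n.
  apply: le_trans (normc_le_ReIm _) _; rewrite Re_add Im_add Re_opp Im_opp.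
  have := strip _ (zeros_of_zero b10 b20 reg hu n).
  have := ler_normB (Im (lamQ n)) (Im (u n)); lra.
(* A window of half-width 1 for [lamQ], enlarged by the displacement 2M + 3, becomes a window for
   [u]. *)
have T0 : 0 < 2 * M + 4 by rewrite addr_gt0// mulr_gt0.
have [d' hd'] := zeros_density b10 b20 reg hu T0.
exists (M + h + 1), d'; split; first by rewrite !addr_gt0.
move=> Q Delta lamQ KQ cd co; have B := bound Q Delta lamQ KQ cd co.
split => [t|n]; last by have [] := B n.
apply: count_bound_card; apply: (count_bound_sub _ (@hd' t)) => n /= hn.
have [hR _] := B n; rewrite -(subrKA (Re (lamQ n))).
apply: le_trans (ler_normD _ _) _; rewrite distrC; lra.
Qed.

Lemma uniform_asymptotics : exists eps0 : R, 0 < eps0 /\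
  forall eps : R, 0 < eps -> exists Ct : R, 0 < Ct /\
  forall K : set (potential R), compact K ->
  exists N : nat, forall Q Delta lamQ, K Q -> is_char_det b1 b2 A Q Delta ->
    canonically_ordered b1 b2 Delta (Delta0 b1 b2 A) u lamQ ->
    (forall n : int, (N < `|n|)%N -> normc (lamQ n - u n) <= eps) /\
    (strictly_regular_bc A u -> eps <= eps0 ->
      (forall n m : int, n != m -> (N < `|n|)%N -> (N < `|m|)%N ->
        disc (lamQ n) (2 * eps) `&` disc (lamQ m) (2 * eps) = set0) /\
      (forall n : int, (N < `|n|)%N ->
        forall lam, normc (lam - lamQ n) = 2 * eps -> Ct <= normc (Delta lam))).
Proof.
have [d ud] := zeros_density b10 b20 reg hu ltr01.
(* [eps0] must be named before strict regularity is assumed, hence the arbitrary value [tau = 1] in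
   the other case. *)
have [tau [n0 [tau0 sep]]] : exists (tau : R) (n0 : nat), 0 < tau /\
    (strictly_regular_bc A u -> forall n m : int, n != m -> (n0 < `|n|)%N -> (n0 < `|m|)%N ->
      2 * tau < normc (u n - u m)).
  have [[_ [n0 [tau [tau0 sep]]]]|nsr] := pselect (strictly_regular_bc A u).
    by exists tau, n0.
  by exists 1, 0%N.
have [B hB] := zeros_bounded_near n0.
(* Two intersecting discs would put [u n] and [u m] at distance less than 6 eps, at most 3 tau/2,
   although separation gives more than 2 tau. *)
exists (tau / 4); split; first by rewrite divr_gt0.
move=> eps eps0; pose eps1 := Num.min eps 1.
have e10 : 0 < eps1 by rewrite lt_min eps0 ltr01.
have e1e : eps1 <= eps by rewrite ge_min lexx.
have e11 : eps1 <= 1 by rewrite ge_min lexx orbT.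
have d0 : 0 < 2 * d.+1%:R :> R by rewrite mulr_gt0.
have d1 : 1 <= 2 * d.+1%:R :> R by rewrite -natrM ler1n muln_gt0.
pose e := eps1 / (2 * d.+1%:R); have e0 : 0 < e by rewrite divr_gt0.
have ee1 : e <= eps1 by rewrite ler_pdivrMr// ler_peMr// ltW.
have [C C0 loc] := localizes_compact e0.
exists C; split => // K cK; have [M M0 {}loc] := loc K cK.
(* [M + 1] serves [component_small]. A point of the circle lies within 3 eps of [u n], so the other
   summands leave it farther than eps from the zeros of index at most [n0] and outside the central
   disc. *)
have [N1 far] := zeros_far (M + 1 + 3 * eps + (`|B| + 4 * eps)).
exists (maxn N1 n0) => Q Delta lamQ KQ cd [_ co].
have lQ := loc Q Delta KQ cd.
have near n : (maxn N1 n0 < `|n|)%N -> normc (lamQ n - u n) < eps1.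
  rewrite gtn_max => /andP[/far nN _].
  apply: (component_small ud e10 e11 (M := M)); last exact: co e0 M0 C0 lQ n.
  have := Re_le_normc (u n); have := normr_ge0 B; lra.
split => [n nN|sr etau]; first by apply/ltW/(lt_le_trans (near n nN)).
have {}sep := sep sr; split.
  move=> n m nm nN mN; rewrite -subset0 => z []; rewrite /disc/= => zn zm.
  have := near n nN; have := near m mN.
  have : 2 * tau < normc (u n - u m).
    by move: nN mN; rewrite !gtn_max => /andP[_ ?] /andP[_ ?]; exact: sep.
  have : normc (u n - u m) <= normc (lamQ n - u n) + normc (z - lamQ n) +
    normc (z - lamQ m) + normc (lamQ m - u m).
    have -> : u n - u m = (z - lamQ m) - (z - lamQ n) - (lamQ n - u n) + (lamQ m - u m) by ring.
    apply: le_trans (le_normcD _ _) _; rewrite lerD2r.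
    apply: le_trans (le_normcB _ _) _.
    have := le_normcB (z - lamQ m) (z - lamQ n); lra.
  by lra.
move=> n nN lam hl; have nn := near n nN.
have [nN1 nn0] : (N1 < `|n|)%N /\ (n0 < `|n|)%N by move: nN; rewrite gtn_max => /andP[].
have un := far n nN1; have B0 := ler_norm B; have B1 := normr_ge0 B.
have lu_lt : normc (lam - u n) < 3 * eps.
  have -> : lam - u n = (lam - lamQ n) + (lamQ n - u n) by ring.
  have := le_normcD (lam - lamQ n) (lamQ n - u n); lra.
have lu_gt : eps < normc (lam - u n).
  have := le_normc_sub (lam - lamQ n) (u n - lamQ n).
  have -> : lam - lamQ n - (u n - lamQ n) = lam - u n by ring.
  rewrite [normc (u n - _)]normcB; lra.
have Rlam : `|Re (u n)| - 3 * eps < `|Re lam|.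
  have := Re_lipschitz lam (u n); have := lerB_dist (Re (u n)) (Re lam).
  rewrite [`|Re (u n) - _|]distrC; lra.
(* The circle has distance more than eps from [u n] and, by separation, more than 5 eps from the
   other zeros of large index, while the discs have radius [e], at most eps. *)
have lamO : ~ Omega u e M lam.
  case=> [|[m _]]; rewrite /disc/=.
    by rewrite subr0; have := Re_le_normc lam; lra.
  have [->|nm] := eqVneq m n; first lra.
  have [mn0|mn0] := leqP `|m| n0.
    have := hB m mn0; have := Re_lipschitz lam (u m).
    have := lerB_dist (Re lam) (Re (u m)); lra.
  have := sep n m; rewrite eq_sym nm => /(_ isT nn0 mn0).
  have := le_normcD (u n - lam) (lam - u m).
  have -> : u n - lam + (lam - u m) = u n - u m by ring.
  rewrite [normc (u n - lam)]normcB; lra.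
have [_ /ltW] := lQ lam lamO; apply: le_trans.
by rewrite -/(growth b1 b2 lam) ler_peMr ?(ltW C0)// growth_ge1.
Qed.

End proposition.

Theorem proposition6p1 (R : realType) (b1 b2 : R) (A : 'M[R[i]]_(2, 4))
    (lam0 : int -> R[i])
    (hb1 : b1 < 0) (hb2 : 0 < b2) (hA : row_free A) (hreg : regular_bc A)
    (hlam0 : zeros_of (Delta0 b1 b2 A) lam0)
    (hord : forall n : int, Re (lam0 n) <= Re (lam0 (n + 1))) :
  (forall K : set (potential R), compact K ->
    (exists M : R, 0 < M /\
      forall Q Delta lamQ, K Q -> is_char_det b1 b2 A Q Delta ->
        canonically_ordered b1 b2 Delta (Delta0 b1 b2 A) lam0 lamQ ->
        forall n, normc (lamQ n - lam0 n) <= M) /\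
    (exists (h : R) (d : nat), 0 < h /\
      forall Q Delta lamQ, K Q -> is_char_det b1 b2 A Q Delta ->
        canonically_ordered b1 b2 Delta (Delta0 b1 b2 A) lam0 lamQ ->
        incompressible lamQ d /\ forall n, `|Im (lamQ n)| <= h)) /\
  (exists eps0 : R, 0 < eps0 /\
    forall eps : R, 0 < eps -> exists Ct : R, 0 < Ct /\
    forall K : set (potential R), compact K ->
    exists N : nat, forall Q Delta lamQ, K Q -> is_char_det b1 b2 A Q Delta ->
      canonically_ordered b1 b2 Delta (Delta0 b1 b2 A) lam0 lamQ ->
      (forall n : int, (N < `|n|)%N -> normc (lamQ n - lam0 n) <= eps) /\
      (strictly_regular_bc A lam0 -> eps <= eps0 ->
        (forall n m : int, n != m -> (N < `|n|)%N -> (N < `|m|)%N ->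
          disc (lamQ n) (2 * eps) `&` disc (lamQ m) (2 * eps) = set0) /\
        (forall n : int, (N < `|n|)%N ->
          forall lam, normc (lam - lamQ n) = 2 * eps ->
            Ct <= normc (Delta lam)))).
Proof.
split=> [K cK|]; first exact: (uniform_location hb1 hb2 hreg hlam0 cK).
exact: (uniform_asymptotics hb1 hb2 hreg hlam0).
Qed.
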